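(* Assume that $R=R^*$, that $R$ is one to one, and that there is an orthonormal basis of $X$ consisting of eigenvectors of $R$. Let $u\in L^p(X,\nu)$ for some $p>1$. Then $u\in BV_0(X,\nu)$ if and only if $V_0(u)<+\infty$. In this case the measure $m_0$ from the definition of $BV_0(X,\nu)$ satisfies $|m_0|(X)=V_0(u)$.
   Context: $X$ is a separable real Hilbert space with inner product $\langle\cdot,\cdot\rangle$ and norm $\|\cdot\|$, $\nu$ is a Borel probability measure on $X$, $R\in\mathcal L(X)$. $C^1_b(X)$ is the space of bounded, continuously Fréchet differentiable $\varphi:X\to\mathbb R$ with bounded gradient; $\partial\varphi/\partial y:=\langle\nabla\varphi,y\rangle$. Standing assumption: for every $z\in X$ there exists $v_z\in\bigcap_{p>1}L^p(X,\nu)$ with $\int_X\langle R\nabla\varphi,z\rangle\,d\nu=\int_X v_z\varphi\,d\nu$ for all $\varphi\in C^1_b(X)$. $\widetilde C^1_b(X,R(X))$ is the set of vector fields $F=\sum_{i=1}^n f_iy_i$ with $f_i\in C^1_b(X)$, $y_i\in R(X)$; for such $F$ set $\nabla^*F:=\sum_{i=1}^n\big(-\frac{\partial f_i}{\partial y_i}+v_{R^{-1}y_i}f_i\big)$. For $u\in L^1(X,\nu)$ with $uv_z\in L^1(X,\nu)$ for all $z$, $V_0(u):=\sup\{\int_X u\,\nabla^*F\,d\nu:\ F\in\widetilde C^1_b(X,R(X)),\ \|F(x)\|\le1\ \forall x\}$. $\mathcal M(X,X)$ is the set of countably additive $X$-valued Borel measures with finite total variation $|m|(X)=\sup\sum_n\|m(B_n)\|$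 over countable Borel partitions. Such $u$ belongs to $BV_0(X,\nu)$ if there is $m_0\in\mathcal M(X,X)$ with $\int_X u(\langle\nabla\varphi,y\rangle-v_{R^{-1}y}\varphi)\,d\nu=-\int_X\varphi\,d\langle m_0,y\rangle$ for all $y\in R(X)$ and $\varphi\in C^1_b(X)$, where $\langle m_0,y\rangle(B):=\langle m_0(B),y\rangle$. *)

(* Defs.v *)
From HB Require Import structures.
From mathcomp Require Import all_boot all_order all_algebra.
From mathcomp Require Import all_classical all_reals all_analysis.
Set Implicit Arguments. Unset Strict Implicit. Unset Printing Implicit Defensive.
Import Order.TTheory GRing.Theory Num.Theory.
Import numFieldNormedType.Exports.
Local Open Scope classical_set_scope.
Local Open Scope ring_scope.

Section Defs.
Context {R : realType} {X : normedModType R}.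

Definition is_inner_product (ip : X -> X -> R) : Prop :=
  (forall x y, ip x y = ip y x) /\
  (forall (a : R) x y z, ip (a *: x + y) z = a * ip x z + ip y z) /\
  (forall x, `|x| ^+ 2 = ip x x).

Definition separable_space : Prop :=
  exists D : set X, countable D /\ closure D = setT.

(** orthonormal basis = maximal orthonormal set *)
Definition orthonormal_basis (ip : X -> X -> R) (B : set X) : Prop :=
  (forall e, B e -> ip e e = 1) /\
  (forall e e', B e -> B e' -> e <> e' -> ip e e' = 0) /\
  (forall x, (forall e, B e -> ip x e = 0) -> x = 0).

Definition C1b (ip : X -> X -> R) (phi : X -> R) (g : X -> X) : Prop :=
  (exists M : R, forall x, `|phi x| <= M) /\
  (forall x, differentiable phi x) /\
  (forall x h, 'd phi x h = ip (g x) h) /\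
  continuous g /\
  (exists M : R, forall x, `|g x| <= M).

End Defs.

Definition borel_of (X : topologicalType) := g_sigma_algebraType (@open X).

Section MeasDefs.
Context {R : realType} {X : normedModType R}.
Local Notation BX := (borel_of X).
Local Open Scope ereal_scope.

Definition in_Lp (nu : {measure set BX -> \bar R}) (p : R) (u : X -> R) : Prop :=
  measurable_fun [set: BX] u /\
  \int[nu]_x ((`|u x| `^ p)%:E) < +oo.

Definition vector_measure (m : set BX -> X) : Prop :=
  forall B : (set BX)^nat, (forall n, measurable (B n)) ->
    trivIset setT B ->
    (fun N => (\sum_(n < N) m (B n))%R) @ \oo --> m (\bigcup_n B n).

Definition vector_total_variation (m : set BX -> X) : \bar R :=
  ereal_sup [set t | exists B : (set BX)^nat,
     [/\ (forall n, measurable (B n)), trivIset setT B,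
         \bigcup_n B n = setT &
         t = \sum_(0 <= n <oo) (`|m (B n)|)%:E]].

Definition in_MXX (m : set BX -> X) : Prop :=
  vector_measure m /\ vector_total_variation m < +oo.

(** [signed_integral mu phi r]: r is the integral of phi against the
    real signed measure mu, computed through a decomposition of mu as a
    difference of two finite measures (the value does not depend on the
    decomposition). *)
Definition signed_integral (mu : set BX -> R) (phi : X -> R) (r : R) : Prop :=
  exists mu1 mu2 : {finite_measure set BX -> \bar R},
    (forall B, measurable B -> mu B = (fine (mu1 B) - fine (mu2 B))%R) /\
    r%:E = \int[mu1]_x (phi x)%:E - \int[mu2]_x (phi x)%:E.

(** nabla^* F for F = sum_i f_i y_i with y_i = Rop (w i), i.e.
    w i = R^{-1} y_i; g i is the gradient of f i. *)
Definition nabla_star (ip : X -> X -> R) (Rop : X -> X) (v : X -> X -> R)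
  (n : nat) (f : 'I_n -> X -> R) (g : 'I_n -> X -> X) (w : 'I_n -> X) (x : X)
  : R :=
  (\sum_(i < n) (- ip (g i x) (Rop (w i)) + v (w i) x * f i x))%R.

Definition V0 (nu : {measure set BX -> \bar R}) (ip : X -> X -> R)
  (Rop : X -> X) (v : X -> X -> R) (u : X -> R) : \bar R :=
  ereal_sup [set t | exists (n : nat) (f : 'I_n -> X -> R)
                          (g : 'I_n -> X -> X) (w : 'I_n -> X),
     [/\ (forall i, C1b ip (f i) (g i)),
         (forall x, `|(\sum_(i < n) f i x *: Rop (w i))%R| <= 1)%R &
         t = \int[nu]_x ((u x * nabla_star ip Rop v f g w x)%R)%:E]].

Definition BV0_measure (nu : {measure set BX -> \bar R}) (ip : X -> X -> R)
  (Rop : X -> X) (v : X -> X -> R) (u : X -> R) (m0 : set BX -> X) : Prop :=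
  in_MXX m0 /\
  forall (w : X) (phi : X -> R) (g : X -> X), C1b ip phi g ->
    signed_integral (fun B => ip (m0 B) (Rop w)) phi
      (- fine (\int[nu]_x ((u x * (ip (g x) (Rop w) - v w x * phi x))%R)%:E))%R.

Definition in_BV0 (nu : {measure set BX -> \bar R}) (ip : X -> X -> R)
  (Rop : X -> X) (v : X -> X -> R) (u : X -> R) : Prop :=
  nu.-integrable setT (fun x => (u x)%:E) /\
  (forall z, nu.-integrable setT (fun x => (u x * v z x)%:E)) /\
  exists m0, BV0_measure nu ip Rop v u m0.

End MeasDefs.

(* Main.v *)
(** For [F = sum_i f_i y_i] write [L F] for the integral of [u nabla^* F].  Finiteness of
    [V = V_0(u)] makes [L] a linear functional of the field [F] alone, with
    [L F <= V sup |F|].  If [F] with [|F| <= 1] almost attains [V], then so does [psi F] for the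
    weight [psi x = 1 / (1 + a |x|^2)] with [a] small; since [psi F + (1 - psi) G] again has norm
    at most 1, [L ((1 - psi) G)] is uniformly small, so [L] is tight along balls.  On balls,
    which are weakly compact, Dini's theorem holds for cylindrical functions.  Hence the
    positive functionals
    [P_{y,c} f = sup { L F : |F - f y| <= c f }], formally [L (f y) + c V-measure (f)],
    have the Daniell property on the lattice of uniform limits of cylindrical [C^1_b]
    functions, and are measures on the Borel sets.  The signed measure
    [m_y = P_{y,|y|} - P_{0,|y|}] represents [phi |-> L (phi y)] for [y] in the range of [R] and
    satisfies [|m_y| <= |y| P_{0,1}].  Along a basis of eigenvectors [e_k], which belong to the
    range of [R], the vector with coordinates [m_{e_k}(B)] is [m_0(B)], of norm at most
    [P_{0,1}(B)]; thus [|m_0|(X) <= P_{0,1}(X) <= V].  The converse inequality follows by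
    approximating fields by step functions, and [m_0] is unique because cylindrical functions
    determine finite Borel measures and [R] is injective. *)

Require Import Defs.
From HB Require Import structures.
From mathcomp Require Import all_boot all_order all_algebra.
From mathcomp Require Import all_classical all_reals all_analysis.
From mathcomp Require Import measurable_realfun ring lra.
Set Implicit Arguments. Unset Strict Implicit. Unset Printing Implicit Defensive.
Import Order.TTheory GRing.Theory Num.Theory.
Import numFieldNormedType.Exports.
Local Open Scope classical_set_scope.
Local Open Scope ring_scope.

(** * Bases of Hilbert space *)

(** A Hilbert space of infinite dimension is not locally compact, so positivity of a functional does
    not by itself produce a measure, and [L] has no sign at all. The constant [c] in [P_{y,c}] cures
    the second defect: as soon as [|y| <= c], the zero field competes and [P_{y,c}] is nonnegative.
    The least such constant, [c = |y|], is what makes the estimate sharp: then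
    [P_{y,|y|} <= 2 P_{0,|y|}], so both signs of [m_y] are dominated by [P_{0,|y|} <= |y| P_{0,1}],
    and nothing is lost in [|m_0|(X) <= V]. Uniform limits are forced by the lattice operations,
    which leave the class C^1; since [f y] is then no longer a field, the constraint on [F] carries
    a slack that tends to 0. The spectral hypothesis puts every finite section of a vector along the
    basis into the range of [R], where the pairing is defined. That [u] is in L^p enters through the
    integrability of [u] and of all products [u v_z]. *)

Section hilbert.
Context {R : realType} {X : completeNormedModType R}.
Variable ip : X -> X -> R.
Hypothesis ip_inner : is_inner_product ip.

Lemma ipC x y : ip x y = ip y x. Proof. by case: ip_inner. Qed.

Lemma ipP a x y z : ip (a *: x + y) z = a * ip x z + ip y z.
Proof. by case: ip_inner => _ []. Qed.

Lemma ipxx x : ip x x = `|x| ^+ 2. Proof. by case: ip_inner => _ [_ ->]. Qed.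

Lemma ip0l y : ip 0 y = 0.
Proof. by have := ipP 1 0 0 y; rewrite scaler0 addr0 mul1r; lra. Qed.

Lemma ipDl x y z : ip (x + y) z = ip x z + ip y z.
Proof. by rewrite -[x]scale1r ipP mul1r scale1r. Qed.

Lemma ipZl a x z : ip (a *: x) z = a * ip x z.
Proof. by rewrite -[a *: x]addr0 ipP ip0l addr0. Qed.

Lemma ipNl x z : ip (- x) z = - ip x z.
Proof. by rewrite -scaleN1r ipZl mulN1r. Qed.

Lemma ipBl x y z : ip (x - y) z = ip x z - ip y z.
Proof. by rewrite ipDl ipNl. Qed.

Lemma ip0r y : ip y 0 = 0. Proof. by rewrite ipC ip0l. Qed.

Lemma ipDr x y z : ip x (y + z) = ip x y + ip x z.
Proof. by rewrite ipC ipDl !(ipC x). Qed.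

Lemma ipZr a x z : ip x (a *: z) = a * ip x z.
Proof. by rewrite ipC ipZl ipC. Qed.

Lemma ipNr x y : ip x (- y) = - ip x y.
Proof. by rewrite ipC ipNl ipC. Qed.

Lemma ipBr x y z : ip x (y - z) = ip x y - ip x z.
Proof. by rewrite ipDr ipNr. Qed.

Lemma ip_suml (I : Type) (s : seq I) (P : pred I) (F : I -> X) y :
  ip (\sum_(i <- s | P i) F i) y = \sum_(i <- s | P i) ip (F i) y.
Proof.
elim/big_rec2: _ => [|i a b _ <-]; first exact: ip0l.
by rewrite ipDl.
Qed.

Lemma ip_sumr (I : Type) (s : seq I) (P : pred I) (F : I -> X) y :
  ip y (\sum_(i <- s | P i) F i) = \sum_(i <- s | P i) ip y (F i).
Proof. by rewrite ipC ip_suml; apply: eq_bigr => i _; rewrite ipC. Qed.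

Lemma cauchy_schwarz x y : `|ip x y| <= `|x| * `|y|.
Proof.
have [->|y0] := eqVneq y 0; first by rewrite ip0r !normr0 mulr0.
have ny : 0 < `|y| by rewrite normr_gt0.
have : 0 <= ip (x - (ip x y / `|y| ^+ 2) *: y) (x - (ip x y / `|y| ^+ 2) *: y).
  by rewrite ipxx sqr_ge0.
rewrite !(ipBl, ipBr, ipZl, ipZr) !ipxx (ipC y x).
have -> : `|x| ^+ 2 - ip x y / `|y| ^+ 2 * ip x y -
   (ip x y / `|y| ^+ 2 * ip x y - ip x y / `|y| ^+ 2 * (ip x y / `|y| ^+ 2 * `|y| ^+ 2)) =
   `|x| ^+ 2 - (ip x y) ^+ 2 / `|y| ^+ 2 by field; rewrite gt_eqF.
rewrite subr_ge0 ler_pdivrMr ?exprn_gt0// -exprMn => h.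
by rewrite -(ler_pXn2r (ltn0Sn 1)) ?nnegrE ?mulr_ge0 ?normr_ge0// real_normK ?num_real.
Qed.

Lemma ip_sep x : (forall y, ip x y = 0) -> x = 0.
Proof. by move=> /(_ x); rewrite ipxx => /eqP; rewrite expf_eq0/= normr_eq0 => /eqP. Qed.

Lemma ip_cvg (T : Type) (F : set_system T) {FF : Filter F} (f g : T -> X) a b :
  f @ F --> a -> g @ F --> b -> (fun t => ip (f t) (g t)) @ F --> ip a b.
Proof.
move=> fa gb.
apply/cvgrPdist_le => e e0.
pose d := Num.min 1 (e / (1 + `|a| + `|b|)).
have D0 : 0 < 1 + `|a| + `|b| by have := normr_ge0 a; have := normr_ge0 b; lra.
have d0 : 0 < d by rewrite lt_min ltr01 divr_gt0.
move/cvgrPdist_le : fa => /(_ _ d0) fa.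
move/cvgrPdist_le : gb => /(_ _ d0) gb.
near=> t.
have A : `|a - f t| <= d by near: t.
have B : `|b - g t| <= d by near: t.
have -> : ip a b - ip (f t) (g t) =
    ip (a - f t) b + ip a (b - g t) - ip (a - f t) (b - g t).
  by rewrite !(ipBl, ipBr); lra.
have d1 : d <= 1 by rewrite ge_min lexx.
have d2 : d * (1 + `|a| + `|b|) <= e by rewrite -ler_pdivlMr// ge_min lexx orbT.
have := cauchy_schwarz (a - f t) b; have := cauchy_schwarz a (b - g t).
have := cauchy_schwarz (a - f t) (b - g t).
have h1 : `|a - f t| * `|b| <= d * `|b| by rewrite ler_wpM2r.
have h2 : `|a| * `|b - g t| <= `|a| * d by rewrite ler_wpM2l.
have h3 : `|a - f t| * `|b - g t| <= d * 1.
  by apply: ler_pM => //; apply: le_trans B d1.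
have := ler_normD (ip (a - f t) b + ip a (b - g t)) (- ip (a - f t) (b - g t)).
have := ler_normD (ip (a - f t) b) (ip a (b - g t)).
rewrite normrN; lra.
Unshelve. all: by end_near.
Qed.

Lemma ip_continuous (T : topologicalType) (f g : T -> X) :
  continuous f -> continuous g -> continuous (fun t => ip (f t) (g t)).
Proof. by move=> cf cg t; apply: ip_cvg; [exact: cf|exact: cg]. Qed.

Definition orthonormal_seq (e : nat -> X) :=
  [/\ forall i, ip (e i) (e i) = 1 \/ e i = 0,
      forall i j, i <> j -> ip (e i) (e j) = 0 &
      forall x, (forall i, ip x (e i) = 0) -> x = 0].

(** Distinct basis vectors lie at distance the square root of 2, so a point of the countable dense
    set closer than 1/2 to a basis vector determines it. The number of that point, under an
    injection of the dense set into [nat], is the index of the vector. *)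
Lemma orthonormal_seq_exists B : separable_space (X := X) ->
  orthonormal_basis ip B ->
  exists2 e, orthonormal_seq e & forall i, B (e i) \/ e i = 0.
Proof.
move=> [D [cD clD]] [B1 [B2 B3]].
have near_D b : exists d, D d /\ `|b - d| < 2^-1.
  have /(_ (ball b 2^-1)) : closure D b by rewrite clD.
  case; first by apply: nbhsx_ballx; lra.
  by move=> d [Dd]; rewrite -ball_normE => ?; exists d.
have [dd ddP] := choice near_D.
have /countable_injP[f finj] := cD.
have finjD x y : D x -> D y -> f x = f y -> x = y.
  by move=> Dx Dy; apply: finj; rewrite inE.
pose P k b := B b /\ f (dd b) = k.
have Puniq k b b' : P k b -> P k b' -> b = b'.
  move=> [Bb fb] [Bb' fb']; apply: contrapT => bb'.
  have db : dd b = dd b'.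
    by apply: finjD; [have [] := ddP b|have [] := ddP b'|rewrite fb fb'].
  have [_ h1] := ddP b; have [_ h2] := ddP b'.
  have : `|b - b'| < 1.
    have -> : b - b' = (b - dd b) - (b' - dd b') by rewrite db opprB addrA subrK.
    by rewrite (le_lt_trans (ler_normB _ _))//; lra.
  have : `|b - b'| ^+ 2 = 2.
    by rewrite -ipxx !(ipBl, ipBr) (ipC b') !B1 ?(B2 b b')//; lra.
  by move=> + h; have := normr_ge0 (b - b'); nra.
pose e k := match pselect (exists b, P k b) with
            | left h => projT1 (cid h) | right _ => 0 end.
have eP k : P k (e k) \/ ((forall b, ~ P k b) /\ e k = 0).
  rewrite /e; case: pselect => [h|h]; first by left; case: cid.
  by right; split=> // b Pb; apply: h; exists b.
exists e; last by move=> i; case: (eP i) => [[]|[]]; [left|right].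
split.
- by move=> i; case: (eP i) => [[/B1]|[]]; [left|right].
- move=> i j ij; case: (eP i) => [[Bi fi]|[_ ->]]; last by rewrite ip0l.
  case: (eP j) => [[Bj fj]|[_ ->]]; last by rewrite ip0r.
  by apply: B2 => // ee; apply: ij; rewrite -fi -fj ee.
- move=> x xe; apply: B3 => b Bb.
  case: (eP (f (dd b))) => [h|[h _]]; last by case: (h b).
  by rewrite (Puniq _ _ _ (conj Bb erefl) h).
Qed.

Variable e : nat -> X.
Hypothesis e_on : orthonormal_seq e.

Definition proj n x := \sum_(0 <= k < n) ip x (e k) *: e k.

(** The condition on [a] accounts for the zero entries of [e], along which a coefficient cannot be
    recovered. *)
Lemma ip_comb (a : nat -> R) m n j : (forall k, e k = 0 -> a k = 0) ->
  ip (\sum_(m <= k < n) a k *: e k) (e j) = if (m <= j < n)%N then a j else 0.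
Proof.
move=> ae; case: e_on => e1 e2 _.
rewrite ip_suml.
under eq_bigr do rewrite ipZl.
case: ifPn => [jn|jn].
  rewrite (bigD1_seq j) ?mem_index_iota ?iota_uniq//= big1 ?addr0; last first.
    by move=> i ij; rewrite e2 ?mulr0//; exact/eqP.
  by case: (e1 j) => [->|ej]; [rewrite mulr1|rewrite (ae _ ej) mul0r].
rewrite big_nat big1// => i ij; rewrite e2 ?mulr0// => ji; move: jn; rewrite -ji.
by rewrite ij.
Qed.

Lemma norm_comb (a : nat -> R) m n : (forall k, e k = 0 -> a k = 0) ->
  `|\sum_(m <= k < n) a k *: e k| ^+ 2 = \sum_(m <= k < n) a k ^+ 2.
Proof.
move=> ae; rewrite -ipxx ip_sumr big_nat [RHS]big_nat.
by apply: eq_bigr => j jn; rewrite ipZr ip_comb// jn expr2.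
Qed.

Lemma ip_coord0 x k : e k = 0 -> ip x (e k) = 0.
Proof. by move=> ->; rewrite ip0r. Qed.

Lemma norm_proj n x : `|proj n x| ^+ 2 = \sum_(0 <= k < n) ip x (e k) ^+ 2.
Proof. by rewrite norm_comb//; exact: ip_coord0. Qed.

Lemma ip_proj n x j : ip (proj n x) (e j) = if (j < n)%N then ip x (e j) else 0.
Proof. by rewrite ip_comb//; exact: ip_coord0. Qed.

Lemma projC n x y : ip (proj n x) y = ip x (proj n y).
Proof.
rewrite /proj ip_suml ip_sumr; apply: eq_bigr => k _.
by rewrite ipZl ipZr (ipC y) mulrC.
Qed.

Lemma bessel n x : \sum_(0 <= k < n) ip x (e k) ^+ 2 <= `|x| ^+ 2.
Proof.
have : 0 <= `|x - proj n x| ^+ 2 by rewrite sqr_ge0.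
rewrite -[X in _ <= X]ipxx !(ipBl, ipBr) ipxx.
have -> : ip (proj n x) (proj n x) = `|proj n x| ^+ 2 by rewrite ipxx.
have E : ip x (proj n x) = `|proj n x| ^+ 2.
  rewrite norm_proj /proj ip_sumr; apply: eq_bigr => k _.
  by rewrite ipZr expr2.
by rewrite (ipC (proj n x)) E norm_proj; lra.
Qed.

Lemma norm_proj_le n x : `|proj n x| <= `|x|.
Proof.
by rewrite -(ler_pXn2r (ltn0Sn 1)) ?nnegrE// norm_proj bessel.
Qed.

Lemma proj_proj m n x : (m <= n)%N -> proj m (proj n x) = proj m x.
Proof.
move=> mn; rewrite {1 3}/proj big_nat [RHS]big_nat.
apply: eq_bigr => k /andP[_ km]; rewrite ip_proj.
by rewrite (leq_trans km mn).
Qed.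

Lemma proj_is_linear n : linear (proj n).
Proof.
move=> a x y; rewrite /proj scaler_sumr -big_split/=.
by apply: eq_bigr => k _; rewrite ipDl ipZl scalerDl scalerA.
Qed.

Lemma projB n x y : proj n (x - y) = proj n x - proj n y.
Proof. by rewrite addrC -[- y]scaleN1r proj_is_linear scaleN1r addrC. Qed.

Lemma proj_continuous n : continuous (proj n).
Proof.
move=> x; apply/cvgrPdist_le => eps eps0.
move/cvgrPdist_le : (@cvg_id _ (nbhs x)) => /(_ _ eps0).
by apply: filterS => y; rewrite -projB; exact/le_trans/norm_proj_le.
Qed.

(** By Pythagoras, blocks of the vector series have as squared norms the blocks of a convergent real
    series, so completeness applies. This supplies the weak limits in the Dini argument and the
    values of the vector measure. *)
Lemma riesz_fischer (a : nat -> R) (C : R) : 0 <= C ->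
  (forall k, e k = 0 -> a k = 0) ->
  (forall n, \sum_(0 <= k < n) a k ^+ 2 <= C ^+ 2) ->
  exists x, [/\ forall k, ip x (e k) = a k, `|x| <= C &
    (fun n => \sum_(0 <= k < n) a k *: e k) @ \oo --> x].
Proof.
move=> C0 ae aC.
pose s := series (fun k => a k *: e k).
have cs : cvgn s.
  apply/cauchy_cvgP/cauchy_seriesP => eps eps0.
  have : cvgn (series (fun k => a k ^+ 2)).
    apply: nondecreasing_is_cvgn.
      by apply: nondecreasing_series => k _ _; exact: sqr_ge0.
    by exists (C ^+ 2) => _ [n _ <-]; exact: aC.
  move=> /cvg_cauchy/cauchy_seriesP/(_ (eps ^+ 2)).
  rewrite exprn_gt0// => /(_ isT).
  apply: filterS => -[m n]/= h.
  rewrite -(ltr_pXn2r (ltn0Sn 1)) ?nnegrE// ?(ltW eps0)//.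
  rewrite norm_comb// (le_lt_trans _ h)//; exact: ler_norm.
exists (limn s); split => //.
- move=> k.
  have h1 : (fun n => ip (s n) (e k)) @ \oo --> ip (limn s) (e k).
    by apply: ip_cvg => //; exact: cvg_cst.
  have h2 : (fun n => ip (s n) (e k)) @ \oo --> a k.
    apply: cvg_near_cst; near=> n; rewrite /s /series/= ip_comb//=.
    by rewrite ifT//; near: n; exists k.+1.
  exact: (cvg_unique _ h1 h2).
- have : (fun n => `|s n|) @ \oo --> `|limn s| by apply: cvg_norm.
  move/cvgr_to_le; apply; near=> n.
  rewrite -(ler_pXn2r (ltn0Sn 1)) ?nnegrE// /s /series/= norm_comb//.
Unshelve. all: by end_near.
Qed.

(** Bessel's inequality makes the coordinates of [x] square summable; the vector that they define
    agrees with [x] against every [e i], hence equals it. *)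
Lemma proj_cvg x : proj ^~ x @ \oo --> x.
Proof.
have [y [ye _ yx]] := riesz_fischer (normr_ge0 x)
  (@ip_coord0 x) (fun n => bessel n x).
suff xy : y = x by rewrite xy in yx.
case: e_on => _ _ e3; apply/eqP; rewrite -subr_eq0; apply/eqP/e3 => i.
by rewrite ipBl ye subrr.
Qed.

End hilbert.

(** * Cylindrical C1 functions *)

Section gradients.
Context {R : realType} {X : completeNormedModType R}.
Variable ip : X -> X -> R.
Hypothesis ip_inner : is_inner_product ip.
Implicit Types (f h q : X -> R) (g k : X -> X) (x y : X).

Definition has_grad q g := forall x, is_diff x q (ip (g x)).

Lemma C1bP q g : C1b ip q g <->
  [/\ has_grad q g, continuous g, exists M, forall x, `|q x| <= M &
      exists M, forall x, `|g x| <= M].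
Proof.
split=> [[bq [dq [dqg [cg bg]]]]|[gq cg bq bg]].
  by split=> // x; apply: DiffDef => //; apply/funext => h; exact: dqg.
split=> //; split; first by move=> x; have [] := gq x.
by split=> // x h; have [_ ->] := gq x.
Qed.

Lemma C1b_grad {q g} : C1b ip q g -> has_grad q g. Proof. by move=> /C1bP[]. Qed.

Lemma C1b_bounded {q g} : C1b ip q g ->
  exists2 M, 0 < M & forall x, `|q x| <= M /\ `|g x| <= M.
Proof.
move=> /C1bP[_ _ [M qM] [N gN]].
exists (Num.max M N + 1) => [|x].
  have := le_trans (normr_ge0 _) (qM 0).
  by have : M <= Num.max M N by [rewrite le_max lexx]; lra.
have := qM x; have := gN x.
have : M <= Num.max M N by rewrite le_max lexx.
have : N <= Num.max M N by rewrite le_max lexx orbT.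
by split; lra.
Qed.

Lemma has_grad_continuous q g : has_grad q g -> continuous q.
Proof. by move=> qg x; apply: differentiable_continuous; have [] := qg x. Qed.

Lemma C1b_continuous q g : C1b ip q g -> continuous q.
Proof. by move=> /C1b_grad/has_grad_continuous. Qed.

Lemma ip_linear y : linear (ip y : X -> R).
Proof. by move=> a x z; rewrite ipDr// ipZr. Qed.

Lemma ip_is_diff x q (g : X) :
  (forall e, 0 < e -> \forall h \near (0 : X),
    `|q (h + x) - (q x + ip g h)| <= e * `|h|) ->
  is_diff x q (ip g).
Proof.
move=> H.
pose L : {linear X -> R} := HB.pack (ip g) (GRing.isLinear.Build _ _ _ _ _ (ip_linear g)).
have cL : continuous L.
  by apply: ip_continuous => //; [exact: cst_continuous|move=> z; exact: cvg_id].
have E : q \o shift x = cst (q x) + L +o_ 0 id by apply/eqaddoP.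
have D : 'd q x = L :> (X -> R) by exact: diff_unique.
by apply: DiffDef => //; apply/diff_locallyP; rewrite D.
Qed.

Lemma has_grad_cst a : has_grad (fun=> a) (fun=> 0).
Proof.
move=> x; apply: ip_is_diff => e e0; near=> h.
by rewrite ip0l// addr0 subrr normr0 mulr_ge0// ltW.
Unshelve. all: by end_near.
Qed.

Lemma has_gradD q1 g1 q2 g2 : has_grad q1 g1 -> has_grad q2 g2 ->
  has_grad (fun x => q1 x + q2 x) (fun x => g1 x + g2 x).
Proof.
move=> H1 H2 x; have := is_diffD (H1 x) (H2 x) => /is_diff_eq; apply.
by apply/funext => h; rewrite ipDl.
Qed.

Lemma has_gradM q1 g1 q2 g2 : has_grad q1 g1 -> has_grad q2 g2 ->
  has_grad (fun x => q1 x * q2 x) (fun x => q1 x *: g2 x + q2 x *: g1 x).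
Proof.
move=> H1 H2 x; have := is_diffM (H1 x) (H2 x) => /is_diff_eq; apply.
by apply/funext => h; rewrite ipDl// !(ipZl ip_inner).
Qed.

Lemma has_grad_ip y : has_grad (fun x => ip x y) (fun=> y).
Proof.
move=> x; apply: ip_is_diff => e e0; near=> h.
rewrite (ipC ip_inner y) ipDl//.
have -> : ip h y + ip x y - (ip x y + ip h y) = 0 by lra.
by rewrite normr0 mulr_ge0// ltW.
Unshelve. all: by end_near.
Qed.

Lemma has_grad_sqnorm : has_grad (fun x => `|x| ^+ 2) (fun x => 2 *: x).
Proof.
move=> x; apply: ip_is_diff => e e0.
move/cvgrPdist_le : (@cvg_id _ (nbhs (0 : X))) => /(_ _ e0).
apply: filterS => h; rewrite sub0r normrN => he.
rewrite -(ipxx ip_inner (h + x)) -(ipxx ip_inner x).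
rewrite !(ipDl ip_inner) !(ipDr ip_inner) (ipZl ip_inner) (ipC ip_inner h x).
have -> : ip h h + ip x h + (ip x h + ip x x) - (ip x x + 2 * ip x h) = ip h h by lra.
by rewrite (ipxx ip_inner) expr2 normrM normr_id ler_wpM2r.
Qed.

Lemma has_grad_comp q g (t dt : R -> R) : has_grad q g ->
  (forall x, is_derive (q x) 1 t (dt (q x))) ->
  has_grad (t \o q) (fun x => dt (q x) *: g x).
Proof.
move=> H Ht x; have [dtx Etx] := Ht x.
have Dt : is_diff (q x) t ( *:%R^~ (dt (q x))).
  apply: DiffDef; first exact/derivable1_diffP.
  by rewrite deriv1E// derive1E Etx.
apply: (is_diff_eq (is_diff_comp (H x) Dt)).
by apply/funext => h /=; rewrite ipZl// mulrC.
Qed.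

Lemma has_gradV q g : has_grad q g -> (forall x, q x != 0) ->
  has_grad (fun x => (q x)^-1) (fun x => - (q x) ^- 2 *: g x).
Proof.
move=> H q0; apply: (@has_grad_comp q g (GRing.inv) (fun t => - t ^- 2)) => // x.
have := is_derive_id (q x) (1 : R) => /(is_deriveV (q0 x)).
by rewrite scaler1 => D; exact: is_derive_eq D _.
Qed.

Lemma has_grad_sqrt q g : has_grad q g -> (forall x, 0 < q x) ->
  has_grad (fun x => Num.sqrt (q x)) (fun x => (2 * Num.sqrt (q x))^-1 *: g x).
Proof.
move=> H q0.
apply: (@has_grad_comp q g (@Num.sqrt R) (fun t => (2 * Num.sqrt t)^-1)) => // x.
exact: is_derive1_sqrt.
Qed.

(** Symmetry of [P] moves it from the increment to the gradient, which is why the new gradient has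
    [P] on both sides of [g]. *)
Lemma has_grad_lin q g (P : X -> X) : linear P -> continuous P ->
  (forall x y, ip (P x) y = ip x (P y)) ->
  has_grad q g -> has_grad (q \o P) (P \o g \o P).
Proof.
move=> linP cP sP H x.
pose L : {linear X -> X} := HB.pack P (GRing.isLinear.Build _ _ _ _ _ linP).
have cL : continuous L by exact: cP.
have DL : is_diff x P P.
  by apply: DiffDef; [exact: (@linear_differentiable _ _ _ L)|exact: (@diff_lin _ _ _ L)].
apply: (is_diff_eq (is_diff_comp DL (H (P x)))).
by apply/funext => h /=; rewrite sP.
Qed.

Lemma C1b_cst a : C1b ip (fun=> a) (fun=> 0).
Proof.
apply/C1bP; split; first exact: has_grad_cst.
- exact: cst_continuous.
- by exists `|a|.
- by exists 0 => x; rewrite normr0.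
Qed.

Lemma C1bD f g h k : C1b ip f g -> C1b ip h k ->
  C1b ip (fun x => f x + h x) (fun x => g x + k x).
Proof.
move=> Cf Ch; have /C1bP[_ cg _ _] := Cf; have /C1bP[_ ck _ _] := Ch.
have [M _ fM] := C1b_bounded Cf; have [N _ hN] := C1b_bounded Ch.
apply/C1bP; split; first by apply: has_gradD; exact: C1b_grad.
- by move=> x; apply: cvgD; [exact: cg|exact: ck].
- exists (M + N) => x; rewrite (le_trans (ler_normD _ _))// lerD//.
    by have [] := fM x.
  by have [] := hN x.
- exists (M + N) => x; rewrite (le_trans (ler_normD _ _))// lerD//.
    by have [] := fM x.
  by have [] := hN x.
Qed.

Lemma C1bM f g h k : C1b ip f g -> C1b ip h k ->
  C1b ip (fun x => f x * h x) (fun x => f x *: k x + h x *: g x).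
Proof.
move=> Cf Ch; have /C1bP[_ cg _ _] := Cf; have /C1bP[_ ck _ _] := Ch.
have cf := C1b_continuous Cf; have ch := C1b_continuous Ch.
have [M M0 fM] := C1b_bounded Cf; have [N N0 hN] := C1b_bounded Ch.
apply/C1bP; split; first by apply: has_gradM; exact: C1b_grad.
- move=> x; apply: cvgD; apply: cvgZ; [exact: cf|exact: ck|exact: ch|exact: cg].
- exists (M * N) => x; rewrite normrM ler_pM//.
    by have [] := fM x.
  by have [] := hN x.
- exists (M * N + N * M) => x.
  have [? ?] := fM x; have [? ?] := hN x.
  by rewrite (le_trans (ler_normD _ _))// !normrZ lerD// ler_pM.
Qed.

Lemma C1bN f g : C1b ip f g -> C1b ip (fun x => - f x) (fun x => - g x).
Proof.
move=> Cf; have := C1bM (C1b_cst (-1)) Cf.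
congr (C1b _ _ _); apply/funext => x; first by rewrite mulN1r.
by rewrite scaleN1r scaler0 addr0.
Qed.

Lemma C1bV f g d : 0 < d -> (forall x, d <= f x) -> C1b ip f g ->
  C1b ip (fun x => (f x)^-1) (fun x => - (f x) ^- 2 *: g x).
Proof.
move=> d0 df Cf; have /C1bP[_ cg _ _] := Cf; have cf := C1b_continuous Cf.
have f0 x : 0 < f x by exact: lt_le_trans (df x).
have f0' x : f x != 0 by rewrite gt_eqF.
have [M M0 fM] := C1b_bounded Cf.
have fd x : (f x)^-1 <= d^-1 by rewrite lef_pV2 ?posrE.
apply/C1bP; split; first by apply: has_gradV => //; exact: C1b_grad.
- move=> x; apply: cvgZ; last exact: cg.
  apply: cvgN; apply: cvgV; first by rewrite expf_neq0.
  by rewrite expr2; apply: cvgM; exact: cf.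
- by exists d^-1 => x; rewrite gtr0_norm ?invr_gt0.
- exists (d^-1 ^+ 2 * M) => x; rewrite normrZ ler_pM//; last by have [] := fM x.
  by rewrite normrN gtr0_norm ?invr_gt0 ?exprn_gt0// -exprVn lerXn2r// nnegrE invr_ge0 ltW.
Qed.

Lemma C1b_sqrt f g d : 0 < d -> (forall x, d <= f x) -> C1b ip f g ->
  C1b ip (fun x => Num.sqrt (f x)) (fun x => (2 * Num.sqrt (f x))^-1 *: g x).
Proof.
move=> d0 df Cf; have /C1bP[_ cg _ _] := Cf; have cf := C1b_continuous Cf.
have f0 x : 0 < f x by exact: lt_le_trans (df x).
have [M M0 fM] := C1b_bounded Cf.
have csf : continuous (fun x => Num.sqrt (f x)).
  by move=> x; apply: continuous_comp; [exact: cf|exact: sqrt_continuous].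
apply/C1bP; split; first by apply: has_grad_sqrt => //; exact: C1b_grad.
- move=> x; apply: cvgZ; last exact: cg.
  apply: cvgV; first by rewrite gt_eqF// mulr_gt0// sqrtr_gt0.
  by apply: cvgM; [exact: cvg_cst|exact: csf].
- exists (Num.sqrt M) => x; rewrite ger0_norm ?sqrtr_ge0// ler_wsqrtr//.
  by have [h _] := fM x; exact: le_trans (ler_norm _) h.
- exists ((2 * Num.sqrt d)^-1 * M) => x; rewrite normrZ ler_pM//; last by have [] := fM x.
  rewrite gtr0_norm ?invr_gt0 ?mulr_gt0 ?sqrtr_gt0//.
  by rewrite lef_pV2 ?posrE ?mulr_gt0 ?sqrtr_gt0// ler_pM2l// ler_wsqrtr.
Qed.

(** For fixed [a] this vanishes at infinity, which localizes fields to balls; as [a] tends to 0 it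
    tends to 1 pointwise with gradients bounded independently of [a], which feeds dominated
    convergence. *)
Definition weight (a : R) x := (1 + a * `|x| ^+ 2)^-1.

Definition weight_grad (a : R) x := - (2 * a * weight a x ^+ 2) *: x.

Lemma weight_den a x : 0 < a -> 1 <= 1 + a * `|x| ^+ 2.
Proof. by move=> a0; rewrite lerDl mulr_ge0 ?sqr_ge0// ltW. Qed.

Lemma weight_gt0 a x : 0 < a -> 0 < weight a x.
Proof. by move=> a0; rewrite invr_gt0; have := weight_den x a0; lra. Qed.

Lemma weight_le1 a x : 0 < a -> weight a x <= 1.
Proof. by move=> a0; rewrite invf_le1; have := weight_den x a0; lra. Qed.

(** Write [t] for the norm of [x] and [w] for the weight. As [w <= 1] and [2 t <= 1 + t^2], the norm
    is at most [a w + a w t^2], and both terms are at most 1. *)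
Lemma weight_grad_le a x : 0 < a <= 1 -> `|weight_grad a x| <= 2.
Proof.
move=> /andP[a0 a1]; rewrite normrZ normrN ger0_norm; last first.
  by rewrite mulr_ge0 ?sqr_ge0// mulr_ge0 ?(ltW a0).
have := weight_gt0 x a0; have := weight_le1 x a0.
have : weight a x * (1 + a * `|x| ^+ 2) = 1.
  by rewrite mulVf// gt_eqF//; have := weight_den x a0; lra.
move: (weight a x) (normr_ge0 x) => w; set t := `|x| => t0 wt w1 w0.
have h : 2 * t <= 1 + t ^+ 2 by have := sqr_ge0 (t - 1); lra.
have : a * w * (2 * t) <= a * w * (1 + t ^+ 2) by rewrite ler_wpM2l// mulr_ge0 ?(ltW w0)// ltW.
have e1 : a * w * (1 + t ^+ 2) = a * w + w * (a * t ^+ 2) by ring.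
have : w * (a * t ^+ 2) <= 1 by lra.
have : a * w <= 1 by rewrite mulr_ile1// ltW.
move=> A B C.
have D : a * w * (2 * t) <= 2 by lra.
have -> : 2 * a * w ^+ 2 * t = w * (a * w * (2 * t)) by ring.
have E : 0 <= a * w * (2 * t) by rewrite !mulr_ge0// ltW.
by apply: le_trans D; rewrite ler_piMl// ltW.
Qed.

Lemma C1b_weight a : 0 < a <= 1 -> C1b ip (weight a) (weight_grad a).
Proof.
move=> a01; have /andP[a0 a1] := a01.
have g0 : has_grad (weight a) (weight_grad a).
  have /has_gradV := has_gradD (has_grad_cst 1) (has_gradM (has_grad_cst a) has_grad_sqnorm).
  have h x : 1 + a * `|x| ^+ 2 != 0 by rewrite gt_eqF//; have := weight_den x a0; lra.
  move=> /(_ h); congr (has_grad _ _); apply/funext => x.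
  rewrite /weight_grad /weight scaler0 addr0 add0r !scalerA; congr (_ *: _).
  by rewrite exprVn mulNr; ring.
apply/C1bP; split => //.
- move=> x; apply: cvgZ; last exact: cvg_id.
  have cw := has_grad_continuous g0.
  apply: cvgN; apply: cvgM; first exact: cvg_cst.
  by rewrite expr2; apply: cvgM; exact: cw.
- by exists 1 => x; rewrite gtr0_norm ?weight_gt0// weight_le1.
- by exists 2 => x; rewrite weight_grad_le.
Qed.

(** The function [s / (1 + s^2)] is bounded and has the sign of [s], so its positivity set here is
    an open half-space. Its derivative is [1 / (1 + s^2)] minus twice the square of [s / (1 + s^2)],
    whence the factor 3 = 1 + 2 in the gradient bound. *)
Lemma C1b_coord y a :
  exists g, C1b ip (fun x => (ip x y - a) / (1 + (ip x y - a) ^+ 2)) g.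
Proof.
pose t x := ip x y - a.
have gt : has_grad t (fun=> y + 0).
  by apply: has_gradD; [exact: has_grad_ip|exact: has_grad_cst].
have den x : 1 + t x ^+ 2 != 0 by rewrite gt_eqF//; have := sqr_ge0 (t x); lra.
have := has_gradM gt (has_gradV (has_gradD (has_grad_cst 1) (has_gradM gt gt)) den).
set g := (X in has_grad _ X) => H; exists g.
have ct := has_grad_continuous gt.
have cden : continuous (fun x => 1 + t x * t x).
  by move=> x; apply: cvgD; [exact: cvg_cst|apply: cvgM; exact: ct].
have cV : continuous (fun x => (1 + t x * t x)^-1).
  by move=> x; apply: cvgV; [exact: den|exact: cden].
have bt (s : R) : `|s / (1 + s * s)| <= 1.
  have h : 0 < 1 + s * s by have := sqr_ge0 s; lra.
  rewrite normrM normfV (gtr0_norm h) ler_pdivrMr// mul1r.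
  by have := sqr_ge0 (s - 1); have := sqr_ge0 (s + 1); case: (ger0P s); lra.
apply/C1bP; split => //.
- move=> x; rewrite /g; apply: cvgD.
    apply: cvgZ; first exact: ct.
    apply: cvgZ.
      apply: cvgN; apply: cvgV; first by rewrite expf_neq0// den.
      by rewrite expr2; apply: cvgM; exact: cden.
    apply: cvgD; first exact: cvg_cst.
    by apply: cvgD; apply: cvgZ; [exact: ct|exact: cvg_cst|exact: ct|exact: cvg_cst].
  by apply: cvgZ; [exact: cV|exact: cvg_cst].
- by exists 1 => x; exact: bt.
- exists (3 * `|y|) => x; rewrite /g addr0 add0r -scalerDl !scalerA -scalerDl normrZ -!expr2.
  rewrite ler_wpM2r//; move: (t x) (den x) (bt (t x)) => s ds bs.
  have h : 0 < 1 + s * s by have := sqr_ge0 s; lra.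
  set A := (X in `|X|).
  have -> : A = (1 + s * s)^-1 - 2 * (s / (1 + s * s) * (s / (1 + s * s))) by rewrite /A; field.
  rewrite (le_trans (ler_normB _ _))//.
  have : `|(1 + s * s)^-1| <= 1.
    by rewrite gtr0_norm ?invr_gt0// invf_le1//; have := sqr_ge0 s; lra.
  have : `|2 * (s / (1 + s * s) * (s / (1 + s * s)))| <= 2.
    by rewrite normrM ger0_norm// normrM ler_piMr// mulr_ile1.
  lra.
Qed.

Variable e : nat -> X.
Hypothesis e_on : orthonormal_seq ip e.
Local Notation proj := (proj ip e).

Lemma C1b_proj f g n : C1b ip f g -> C1b ip (f \o proj n) (proj n \o g \o proj n).
Proof.
move=> Cf; have /C1bP[gf cg _ _] := Cf; have [M M0 fM] := C1b_bounded Cf.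
have cp : continuous (proj n) by exact: proj_continuous.
apply/C1bP; split.
- by apply: has_grad_lin => //; [exact: proj_is_linear|move=> *; exact: projC].
- move=> x; apply: continuous_comp; first exact: cp.
  by apply: continuous_comp; [exact: cg|exact: cp].
- by exists M => x /=; have [] := fM (proj n x).
- exists M => x /=; rewrite (le_trans (norm_proj_le ip_inner e_on _ _))//.
  by have [] := fM (proj n x).
Qed.

Definition cylC1 f := (exists g, C1b ip f g) /\ exists n, forall x, f x = f (proj n x).

Lemma cylC1_cst a : cylC1 (fun=> a).
Proof. by split; [exists (fun=> 0); exact: C1b_cst|exists 0%N]. Qed.

Lemma cyl_widen f n m : (n <= m)%N ->
  (forall x, f x = f (proj n x)) -> forall x, f x = f (proj m x).
Proof.
by move=> nm fn x; rewrite fn [RHS]fn proj_proj.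
Qed.

Lemma cylC1_op2 (op : R -> R -> R) f h : cylC1 f -> cylC1 h ->
  (forall g k, C1b ip f g -> C1b ip h k -> exists g', C1b ip (fun x => op (f x) (h x)) g') ->
  cylC1 (fun x => op (f x) (h x)).
Proof.
move=> [[g fg] [n fn]] [[k hk] [m hm]] H; split; first exact: H fg hk.
exists (maxn n m) => x.
by rewrite -(cyl_widen (leq_maxl n m) fn) -(cyl_widen (leq_maxr n m) hm).
Qed.

Lemma cylC1D f h : cylC1 f -> cylC1 h -> cylC1 (fun x => f x + h x).
Proof. by move=> Cf Ch; apply: (@cylC1_op2 +%R) => // g k fg hk; eexists; exact: C1bD fg hk. Qed.

Lemma cylC1M f h : cylC1 f -> cylC1 h -> cylC1 (fun x => f x * h x).
Proof. by move=> Cf Ch; apply: (@cylC1_op2 *%R) => // g k fg hk; eexists; exact: C1bM fg hk. Qed.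

Lemma cylC1_sqrt f d : 0 < d -> (forall x, d <= f x) -> cylC1 f ->
  cylC1 (fun x => Num.sqrt (f x)).
Proof.
move=> d0 df [[g fg] [n fn]]; split; first by eexists; exact: C1b_sqrt d0 df fg.
by exists n => x; rewrite -fn.
Qed.

Lemma cylC1_coord i a : cylC1 (fun x => (ip x (e i) - a) / (1 + (ip x (e i) - a) ^+ 2)).
Proof.
split; first exact: C1b_coord.
by exists i.+1 => x; rewrite ip_proj// ltnSn.
Qed.

Lemma cylC1_proj f g n : C1b ip f g -> cylC1 (f \o proj n).
Proof.
move=> fg; split; first by eexists; exact: C1b_proj fg.
by exists n => x /=; rewrite proj_proj.
Qed.

(** The uniform closure is taken because maxima and minima of C^1 functions are in general not C^1,
    whereas their uniform limits form a lattice. *)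
Definition ucyl f := forall d, 0 < d -> exists2 h, cylC1 h & forall x, `|f x - h x| <= d.

Lemma cylC1_ucyl f : cylC1 f -> ucyl f.
Proof. by move=> Cf d d0; exists f => // x; rewrite subrr normr0 ltW. Qed.

Lemma ucyl_bounded f : ucyl f -> exists2 M, 0 < M & forall x, `|f x| <= M.
Proof.
move=> /(_ 1 ltr01)[h [[g hg] _] fh].
have [M M0 hM] := C1b_bounded hg; exists (M + 1) => [|x]; first by lra.
have [hx _] := hM x; have := fh x; have := ler_normD (f x - h x) (h x).
by rewrite subrK; lra.
Qed.

Lemma uniform_limit_continuous (T : topologicalType) (f : T -> R) :
  (forall d, 0 < d -> exists2 h : T -> R, continuous h & forall t, `|f t - h t| <= d) ->
  continuous f.
Proof.
move=> H x; apply/cvgrPdist_le => d d0.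
have [h ch fh] := H (d / 3) ltac:(lra).
have /cvgrPdist_le/(_ (d / 3) ltac:(lra)) := ch x.
apply: filterS => y hxy.
have := fh x; have := fh y; rewrite (distrC (f y)).
have -> : f x - f y = (f x - h x) + (h x - h y) + (h y - f y) by lra.
have := ler_normD (f x - h x + (h x - h y)) (h y - f y).
have := ler_normD (f x - h x) (h x - h y); lra.
Qed.

Lemma ucyl_continuous f : ucyl f -> continuous f.
Proof.
move=> Hf; apply: uniform_limit_continuous => d /Hf[h [[g hg] _] fh].
by exists h => //; exact: C1b_continuous hg.
Qed.

Lemma ucylD f h : ucyl f -> ucyl h -> ucyl (fun x => f x + h x).
Proof.
move=> Hf Hh d d0; have [|f' Cf ff'] := Hf (d / 2); first lra.
have [|h' Ch hh'] := Hh (d / 2); first lra.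
exists (fun x => f' x + h' x); first exact: cylC1D.
move=> x; have -> : f x + h x - (f' x + h' x) = (f x - f' x) + (h x - h' x) by lra.
by have := ff' x; have := hh' x; have := ler_normD (f x - f' x) (h x - h' x); lra.
Qed.

Lemma ucylZ a f : ucyl f -> ucyl (fun x => a * f x).
Proof.
move=> Hf d d0; have a1 : 0 < `|a| + 1 by have := normr_ge0 a; lra.
have [|h Ch fh] := Hf (d / (`|a| + 1)); first by rewrite divr_gt0.
exists (fun x => a * h x); first by apply: cylC1M => //; exact: cylC1_cst.
move=> x; rewrite -mulrBr normrM (le_trans (ler_wpM2l (normr_ge0 _) (fh x)))//.
by rewrite mulrCA ler_piMr ?(ltW d0)// ler_pdivrMr// mul1r lerDl.
Qed.

Lemma ucyl_cst a : ucyl (fun=> a).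
Proof. exact/cylC1_ucyl/cylC1_cst. Qed.

Lemma ucylB f h : ucyl f -> ucyl h -> ucyl (fun x => f x - h x).
Proof.
move=> Hf Hh; have := ucylD Hf (ucylZ (-1) Hh).
by congr ucyl; apply/funext => x; rewrite mulN1r.
Qed.

(** The root of [h^2 + (d / 2)^2] is smooth, its argument being bounded away from 0, and it exceeds
    the absolute value of [h] by at most [d / 2]. *)
Lemma ucyl_norm f : ucyl f -> ucyl (fun x => `|f x|).
Proof.
move=> Hf d d0; have [|h Ch fh] := Hf (d / 2); first lra.
have d1 : 0 < d / 2 by lra.
have d2 : 0 < (d / 2) ^+ 2 by rewrite exprn_gt0.
exists (fun x => Num.sqrt (h x * h x + (d / 2) ^+ 2)).
  apply: (cylC1_sqrt d2) => [x|]; first by have := sqr_ge0 (h x); lra.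
  by apply: cylC1D (cylC1_cst _); exact: cylC1M.
move=> x; set s := Num.sqrt _.
have s0 : 0 <= s by exact: sqrtr_ge0.
have ss : s ^+ 2 = `|h x| ^+ 2 + (d / 2) ^+ 2.
  by rewrite sqr_sqrtr ?real_normK ?num_real -?expr2// addr_ge0 ?sqr_ge0.
have := normr_ge0 (h x); set a := `|h x| in ss * => a0.
have h1 : a <= s by rewrite -(ler_pXn2r (ltn0Sn 1)) ?nnegrE// ss lerDl ltW.
have h2 : s <= a + d / 2.
  rewrite -(ler_pXn2r (ltn0Sn 1)) ?nnegrE//; last lra.
  have ad : 0 <= a * (d / 2) by apply: mulr_ge0 => //; lra.
  rewrite ss -subr_ge0.
  have -> : (a + d / 2) ^+ 2 - (a ^+ 2 + (d / 2) ^+ 2) = 2 * (a * (d / 2)) by ring.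
  by rewrite mulr_ge0.
have := ler_dist_dist (f x) (h x); have := fh x; rewrite -/a.
have -> : `|f x| - s = (`|f x| - a) + (a - s) by lra.
have := ler_normD (`|f x| - a) (a - s).
have : `|a - s| <= d / 2 by rewrite ler0_norm; lra.
lra.
Qed.

Lemma ucyl_max f h : ucyl f -> ucyl h -> ucyl (fun x => Num.max (f x) (h x)).
Proof.
move=> Hf Hh.
have := ucylZ 2^-1 (ucylD (ucylD Hf Hh) (ucyl_norm (ucylB Hf Hh))).
congr ucyl; apply/funext => x; rewrite maxr_absE.
by rewrite mulrC.
Qed.

Lemma ucyl_min f h : ucyl f -> ucyl h -> ucyl (fun x => Num.min (f x) (h x)).
Proof.
move=> Hf Hh.
have := ucylZ 2^-1 (ucylB (ucylD Hf Hh) (ucyl_norm (ucylB Hf Hh))).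
congr ucyl; apply/funext => x; rewrite minr_absE.
by rewrite mulrC.
Qed.

End gradients.

(** * Daniell functionals *)

Section daniell.
Context {R : realType} {T : Type}.
Variables (H : (T -> R) -> Prop).

Definition nonneg_in f := H f /\ forall x, 0 <= f x.

Record function_lattice : Prop := FunctionLattice {
  lattice_cst : forall a : R, H (fun=> a) ;
  latticeD : forall f g, H f -> H g -> H (fun x => f x + g x) ;
  latticeZ : forall (a : R) f, H f -> H (fun x => a * f x) ;
  lattice_max : forall f g, H f -> H g -> H (fun x => Num.max (f x) (g x)) ;
  lattice_min : forall f g, H f -> H g -> H (fun x => Num.min (f x) (g x)) }.

(** Additivity is recorded on the nonnegative cone; monotonicity and compatibility with integer
    multiples follow from it and take the place of real homogeneity. *)
Record daniell_functional (I : (T -> R) -> R) : Prop := DaniellFunctional {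
  daniellD : forall f g, nonneg_in f -> nonneg_in g ->
    I (fun x => f x + g x) = I f + I g ;
  daniell_ge0 : forall f, nonneg_in f -> 0 <= I f ;
  daniell_cvg0 : forall f : nat -> T -> R, (forall n, nonneg_in (f n)) ->
    (forall x m n, (m <= n)%N -> f n x <= f m x) ->
    (forall x eps, 0 < eps -> exists n, f n x <= eps) ->
    forall eps, 0 < eps -> exists n, I (f n) <= eps }.

(** The admissible bounds for the upper integral of the indicator of [A]: increasing sequences stand
    for their suprema, which need not belong to the lattice. *)
Definition daniell_cover (I : (T -> R) -> R) (A : set T) (t : R) :=
  exists s : nat -> T -> R, [/\ forall n, nonneg_in (s n),
    forall x m n, (m <= n)%N -> s m x <= s n x,
    forall x, A x -> exists n, 1 <= s n x & forall n, I (s n) <= t].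

Definition daniell_outer I A : \bar R := ereal_inf [set t%:E | t in daniell_cover I A].

Hypothesis Hlat : function_lattice.

Let HB f g : H f -> H g -> H (fun x => f x - g x).
Proof.
move=> Hf Hg; have := latticeD Hlat Hf (latticeZ Hlat (-1) Hg).
by congr H; apply/funext => x; rewrite mulN1r.
Qed.

Lemma nonneg_inD f g : nonneg_in f -> nonneg_in g -> nonneg_in (fun x => f x + g x).
Proof. by move=> [Hf f0] [Hg g0]; split; [exact: (latticeD Hlat)|move=> x; rewrite addr_ge0]. Qed.

Lemma nonneg_in_pos f : H f -> nonneg_in (fun x => Num.max (f x) 0).
Proof.
move=> Hf; split; first by apply: (lattice_max Hlat) => //; exact: (lattice_cst Hlat).
by move=> x; rewrite le_max lexx orbT.
Qed.

Lemma nonneg_in_posB f g : nonneg_in f -> nonneg_in g ->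
  nonneg_in (fun x => Num.max (f x - g x) 0).
Proof. by move=> [Hf _] [Hg _]; apply: nonneg_in_pos; exact: HB. Qed.

Lemma nonneg_in_min f g : nonneg_in f -> nonneg_in g ->
  nonneg_in (fun x => Num.min (f x) (g x)).
Proof.
move=> [Hf f0] [Hg g0]; split; first exact: (lattice_min Hlat).
by move=> x; rewrite le_min f0 g0.
Qed.

Lemma nonneg_inB f g : nonneg_in f -> H g -> (forall x, g x <= f x) ->
  nonneg_in (fun x => f x - g x).
Proof. by move=> [Hf f0] Hg gf; split; [exact: HB|move=> x; rewrite subr_ge0]. Qed.

Lemma nonneg_in_cst (a : R) : 0 <= a -> nonneg_in (fun=> a).
Proof. by move=> a0; split => //; exact: (lattice_cst Hlat). Qed.

Lemma nonneg_inZ (a : R) f : 0 <= a -> nonneg_in f -> nonneg_in (fun x => a * f x).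
Proof. by move=> a0 [Hf f0]; split; [exact: (latticeZ Hlat)|move=> x; rewrite mulr_ge0]. Qed.

Section functional.
Variable I : (T -> R) -> R.
Hypothesis HI : daniell_functional I.

Lemma daniell_le f g : nonneg_in f -> nonneg_in g -> (forall x, f x <= g x) -> I f <= I g.
Proof.
move=> Hf Hg fg.
have Hgf : nonneg_in (fun x => g x - f x) by apply: nonneg_inB => //; have [] := Hf.
have -> : g = (fun x => f x + (g x - f x)) by apply/funext => x; lra.
by rewrite (daniellD HI) // lerDl (daniell_ge0 HI).
Qed.

Lemma daniell0 : I (fun=> 0) = 0.
Proof.
have H0 : nonneg_in (fun=> 0) by exact: nonneg_in_cst.
have := daniellD HI H0 H0; have -> : (fun _ : T => 0 + 0 : R) = (fun=> 0).
  by apply/funext => x; rewrite addr0.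
by lra.
Qed.

Lemma daniellMn f n : nonneg_in f -> I (fun x => n%:R * f x) = n%:R * I f.
Proof.
move=> Hf; elim: n => [|n ih].
  by rewrite mul0r -[RHS]daniell0; congr I; apply/funext => x; rewrite mul0r.
have -> : (fun x => n.+1%:R * f x) = (fun x => n%:R * f x + f x).
  by apply/funext => x; rewrite -natr1 mulrDl mul1r.
by rewrite (daniellD HI) ?ih -?natr1 ?mulrDl ?mul1r//; exact: nonneg_inZ.
Qed.

Local Notation D := (daniell_outer I).

Lemma daniell_outer_le A h : nonneg_in h -> (forall x, A x -> 1 <= h x) ->
  (D A <= (I h)%:E)%E.
Proof.
move=> Hh hA; apply: ereal_inf_lbound; exists (I h) => //.
by exists (fun=> h); split => // x Ax; exists 0%N; exact: hA.
Qed.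

Lemma daniell_outer_ge0 A : (0 <= D A)%E.
Proof.
apply: le_ereal_inf_tmp => _ [t [s [Hs _ _ It]] <-].
by rewrite lee_fin (le_trans _ (It 0%N))// (daniell_ge0 HI).
Qed.

Lemma daniell_outer_le1 A : (D A <= (I (fun=> 1))%:E)%E.
Proof. by apply: daniell_outer_le => //; exact: nonneg_in_cst. Qed.

Lemma daniell_outer_fin_num A : D A \is a fin_num.
Proof.
rewrite ge0_fin_numE ?daniell_outer_ge0//.
by rewrite (le_lt_trans (daniell_outer_le1 A))// ltry.
Qed.

Lemma daniell_outer_adherent A e : 0 < e ->
  exists2 t, daniell_cover I A t & (t%:E <= D A + e%:E)%E.
Proof.
move=> e0; have := @lb_ereal_inf_adherent R [set t%:E | t in daniell_cover I A] e e0.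
move=> /(_ (daniell_outer_fin_num A))[_ [t tA <-] h].
by exists t => //; exact: ltW.
Qed.

Lemma daniell_outer0 : D set0 = 0%E.
Proof.
apply/eqP; rewrite eq_le daniell_outer_ge0 andbT.
rewrite -[leRHS]/(EFin 0) -daniell0; apply: daniell_outer_le => //; exact: nonneg_in_cst.
Qed.

Lemma le_daniell_outer : {homo D : A B / A `<=` B >-> (A <= B)%E}.
Proof.
move=> A B AB; apply: ereal_inf_le_tmp => _ [t [s [Hs ms sB It]] <-].
by exists t => //; exists s; split => // x /AB/sB.
Qed.

Lemma daniell_sum (f : nat -> T -> R) n : (forall i, nonneg_in (f i)) ->
  nonneg_in (fun x => \sum_(0 <= i < n) f i x) /\
  I (fun x => \sum_(0 <= i < n) f i x) = \sum_(0 <= i < n) I (f i).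
Proof.
move=> Hf; elim: n => [|n [ih1 ih2]].
  have -> : (fun x : T => \sum_(0 <= i < 0) f i x) = (fun=> 0).
    by apply/funext => x; rewrite big_nil.
  by rewrite daniell0 big_nil; split => //; exact: nonneg_in_cst.
have -> : (fun x : T => \sum_(0 <= i < n.+1) f i x) = (fun x => \sum_(0 <= i < n) f i x + f n x).
  by apply/funext => x; rewrite big_nat_recr.
by split; [exact: nonneg_inD|rewrite (daniellD HI)// ih2 [RHS]big_nat_recr].
Qed.

(** Covers of [F i] with error [e / 2^(i+1)] are merged diagonally: the [n]-th function adds the
    [n]-th members of the first [n] covers. It increases with [n] because both the number of terms
    and each term do. *)
Lemma daniell_outer_sigma_subadditive : sigma_subadditive D.
Proof.
move=> F.
have [/eqP ->|fin] := boolP (\sum_(i <oo) D (F i) == +oo)%E; first exact: leey.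
have S0 : (0 <= \sum_(i <oo) D (F i))%E by apply: nneseries_ge0 => *; exact: daniell_outer_ge0.
have Sfin : (\sum_(i <oo) D (F i))%E \is a fin_num by rewrite ge0_fin_numE// ltey.
apply/lee_addgt0Pr => e e0.
have /choice[t tP] (i : nat) : exists t, daniell_cover I (F i) t /\
    (t%:E <= D (F i) + (e / (2 ^ i.+1)%:R)%:E)%E.
  have [|t t1 t2] := @daniell_outer_adherent (F i) (e / (2 ^ i.+1)%:R).
    by rewrite divr_gt0// ltr0n expn_gt0.
  by exists t.
have /choice[s sP] i : exists s : nat -> T -> R, [/\ forall n, nonneg_in (s n),
    forall x m n, (m <= n)%N -> s m x <= s n x,
    forall x, F i x -> exists n, 1 <= s n x & forall n, I (s n) <= t i].
  by have [] := tP i.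
rewrite -(fineK Sfin) -EFinD; apply: ereal_inf_lbound; eexists; last reflexivity.
have sHi n i : nonneg_in (s i n) by have [] := sP i.
exists (fun n x => \sum_(0 <= i < n) s i n x); split.
- by move=> n; have [] := @daniell_sum (fun i => s i n) n (sHi n).
- move=> x m n mn; rewrite (big_cat_nat (leq0n m) mn)/=.
  rewrite -[leLHS]addr0 lerD//.
    by apply: ler_sum => i _; have [_ + _ _] := sP i; apply.
  by apply: sumr_ge0 => i _; have [] := sHi n i.
- move=> x [i _ Fix].
  have [_ mi /(_ _ Fix)[k h1] _] := sP i.
  exists (maxn k i.+1); rewrite (big_cat_nat (leq0n i.+1) (leq_maxr _ _))/= big_nat_recr//=.
  have := mi x k (maxn k i.+1) (leq_maxl _ _).
  have : 0 <= \sum_(0 <= j < i) s j (maxn k i.+1) x.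
    by apply: sumr_ge0 => j _; have [] := sHi (maxn k i.+1) j.
  have : 0 <= \sum_(i.+1 <= j < maxn k i.+1) s j (maxn k i.+1) x.
    by apply: sumr_ge0 => j _; have [] := sHi (maxn k i.+1) j.
  by lra.
- move=> n; have [_ ->] := @daniell_sum (fun i => s i n) n (sHi n).
  rewrite -lee_fin EFinD (fineK Sfin).
  apply: le_trans (epsilon_trick xpredT (fun i => daniell_outer_ge0 (F i)) (ltW e0)).
  have h0 i : (0 <= D (F i) + (e / (2 ^ i.+1)%:R)%:E)%E.
    by rewrite adde_ge0 ?daniell_outer_ge0// lee_fin divr_ge0// ltW.
  apply: le_trans (nneseries_lim_ge n _) => //.
  rewrite -sumEFin; apply: lee_sum => i _.
  have [_ ti] := tP i; apply: le_trans ti.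
  by rewrite lee_fin; have [] := sP i.
Qed.

Lemma daniell_outer_is_outer_measure :
  {mu : {outer_measure set T -> \bar R} | (mu : set T -> \bar R) = D}.
Proof.
pose mu : {outer_measure set T -> \bar R} := HB.pack D
  (isOuterMeasure.Build R T D daniell_outer0 daniell_outer_ge0 le_daniell_outer
    daniell_outer_sigma_subadditive).
by exists mu.
Qed.

(* A cover [s] of [A] splits as [min s g + max (s - g) 0], where [g] increases to the
   indicator of [f > 0]; freezing [g] in the second summand costs at most [eps]. *)
Lemma daniell_outer_caratheodory f A : H f ->
  (D (A `&` [set x | 0 < f x]%R) + D (A `&` ~` [set x | 0 < f x]%R) <= D A)%E.
Proof.
move=> Hf; set G := [set x | 0 < f x].
pose g (n : nat) x := Num.min (n%:R * Num.max (f x) 0) 1.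
have Hg n : nonneg_in (g n).
  apply: nonneg_in_min; last exact: nonneg_in_cst.
  by apply: nonneg_inZ => //; exact: nonneg_in_pos.
have gm x m n : (m <= n)%N -> g m x <= g n x.
  move=> mn; rewrite /g le_min ge_min; apply/andP; split; last by rewrite ge_min lexx orbT.
  by rewrite ler_wpM2r ?ler_nat// le_max lexx orbT.
have g1 x : G x -> exists n, forall k, (n <= k)%N -> g k x = 1.
  move=> fx; exists (Num.truncn (f x)^-1).+1 => k nk.
  apply/min_idPr; rewrite (max_idPl (ltW fx)) -ler_pdivrMr// div1r.
  by rewrite (le_trans (ltW (truncnS_gt _)))// ler_nat.
have g0 x n : ~ G x -> g n x = 0.
  move=> /negP; rewrite -leNgt => fx.
  by rewrite /g (max_idPr fx) mulr0; apply/min_idPl.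
apply/lee_addgt0Pr => e e0; have e2 : 0 < e / 2 by lra.
have [t [s [Hs ms sA It]] tD] := daniell_outer_adherent A e2.
pose a n := I (fun x => Num.min (s n x) (g n x)).
have Hmin n k : nonneg_in (fun x => Num.min (s n x) (g k x)) by exact: nonneg_in_min.
have at_ n : a n <= t.
  by apply: le_trans (It n); apply: daniell_le => // x; rewrite ge_min lexx.
have am m n : (m <= n)%N -> a m <= a n.
  move=> mn; apply: daniell_le => // x.
  by rewrite le_min; apply/andP; split; rewrite ge_min ?(ms x m n mn)// (gm x m n mn) orbT.
have hs : has_sup (range a) by split; [exists (a 0%N), 0%N|exists t => _ [n _ <-]].
(* [l] bounds the part of [A] inside [G] and [t - a k] the part outside; since [a k > l - e / 2],
   the two add up to less than [t + e / 2]. *)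
pose l := sup (range a).
have al n : a n <= l by apply: ub_le_sup; [case: hs|exists n].
have [_ [k _ <-]] := sup_adherent e2 hs; rewrite -/l => kl.
have DG : (D (A `&` G) <= l%:E)%E.
  apply: ereal_inf_lbound; exists l => //.
  exists (fun n x => Num.min (s n x) (g n x)); split => //.
    by move=> x m n mn;  rewrite le_min; apply/andP; split; rewrite ge_min ?(ms x m n mn)// (gm x m n mn) orbT.
  move=> x [Ax Gx]; have [n1 h1] := sA _ Ax; have [n2 h2] := g1 _ Gx.
  exists (maxn n1 n2); rewrite le_min h2 ?leq_maxr// lexx andbT.
  by rewrite (le_trans h1)// ms// leq_maxl.
have DC : (D (A `&` ~` G) <= (t - a k)%:E)%E.
  apply: ereal_inf_lbound; exists (t - a k) => //.
  exists (fun n x => Num.max (s n x - g k x) 0); split.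
  - by move=> n; exact: nonneg_in_posB.
  - move=> x m n mn; rewrite ge_max le_max lerB ?ms//=.
    by rewrite le_max lexx orbT.
  - move=> x [Ax Gx]; have [n h] := sA _ Ax; exists n.
    by rewrite (g0 _ _ Gx) subr0 le_max h.
  - have main n : (k <= n)%N -> I (fun x => Num.max (s n x - g k x) 0) <= t - a k.
      move=> kn.
      have E : s n = (fun x => Num.min (s n x) (g k x) + Num.max (s n x - g k x) 0).
        by apply/funext => x; case: (leP (s n x) (g k x)) => h;
          [rewrite (max_idPr _)|rewrite (max_idPl _)]; lra.
      have := It n; rewrite {1}E (daniellD HI)//; last exact: nonneg_in_posB.
      have : a k <= I (fun x => Num.min (s n x) (g k x)).
        by apply: daniell_le => // x; rewrite le_min; apply/andP; split; rewrite ge_min ?(ms x k n kn)// lexx orbT.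
      lra.
    move=> n; apply: le_trans (main (maxn n k) (leq_maxr _ _)).
    apply: daniell_le; [exact: nonneg_in_posB|exact: nonneg_in_posB|] => x.
    rewrite ge_max !le_max lexx orbT andbT lerB ?orTb//.
    by rewrite ms ?leq_maxl.
apply: (@le_trans _ _ (l%:E + (t - a k)%:E)%E); first exact: leeD.
have : (t%:E + (e / 2)%:E <= D A + e%:E)%E.
  apply: le_trans (leeD2r _ tD) _.
  by rewrite -addeA leeD2l// -EFinD lee_fin; lra.
by apply: le_trans; rewrite -!EFinD lee_fin; lra.
Qed.

(** Continuity of [I] along decreasing sequences enters here: for a cover [s] of the whole space,
    the positive parts of [1 - s n] decrease to 0, so no cover can have total below [I 1]. *)
Lemma daniell_outerT : D setT = (I (fun=> 1))%:E.
Proof.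
apply/eqP; rewrite eq_le daniell_outer_le1/=.
apply: le_ereal_inf_tmp => _ [t [s [Hs ms s1 It]] <-].
rewrite lee_fin; apply/ler_addgt0Pr => e e0.
have H1 : nonneg_in (fun=> 1) by exact: nonneg_in_cst.
have [|||n hn] := @daniell_cvg0 _ HI (fun n x => Num.max (1 - s n x) 0) _ _ _ e e0.
- by move=> n; exact: nonneg_in_posB.
- move=> x m n mn; rewrite ge_max !le_max lexx orbT andbT lerB// ?ms//.
- move=> x eps eps0; have [n h] := s1 x Logic.I; exists n.
  by rewrite ge_max (ltW eps0) andbT; lra.
- have := It n.
  have : I (fun=> 1) <= I (fun x => s n x + Num.max (1 - s n x) 0).
    apply: daniell_le => //; first by apply: nonneg_inD => //; exact: nonneg_in_posB.
    move=> x; have : 1 - s n x <= Num.max (1 - s n x) 0 by rewrite le_max lexx.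
    by lra.
  rewrite (daniellD HI)//; last exact: nonneg_in_posB.
  lra.
Qed.

End functional.

(** A cover for [J] with bound [t] is one for [I] with bound [c t]. Dividing the error by [c + 1]
    rather than [c] includes the case [c = 0]. *)
Lemma daniell_outer_mono I J (c : R) A : daniell_functional I -> daniell_functional J ->
  0 <= c -> (forall f, nonneg_in f -> I f <= c * J f) ->
  (daniell_outer I A <= c%:E * daniell_outer J A)%E.
Proof.
move=> HI HJ c0 IJ; apply/lee_addgt0Pr => e e0.
have e1 : 0 < e / (c + 1) by rewrite divr_gt0//; lra.
have [t [s [Hs ms s1 Jt]] tD] := daniell_outer_adherent HJ A e1.
apply: (@le_trans _ _ (c * t)%:E).
  apply: ereal_inf_lbound; exists (c * t) => //; exists s; split => // n.
  by rewrite (le_trans (IJ _ (Hs n)))// ler_wpM2l.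
rewrite EFinM; apply: le_trans (lee_wpmul2l _ tD) _; first by rewrite lee_fin.
rewrite muleDr ?fin_num_adde_defl// leeD2l//.
by rewrite -EFinM lee_fin mulrCA ler_piMr ?(ltW e0)// ler_pdivrMr ?mul1r//; lra.
Qed.

End daniell.

(** * Finite Borel measures *)

Section finite_measures.
Context d (T : measurableType d) (R : realType).
Implicit Types (m n k : {finite_measure set T -> \bar R}) (f : T -> R).

Lemma bounded_integrable m f M : measurable_fun setT f ->
  (forall x, `|f x| <= M) -> m.-integrable setT (EFin \o f).
Proof.
move=> mf fM; apply: measurable_bounded_integrable => //.
  by rewrite -ge0_fin_numE// fin_num_measure.
exists M; split; first exact: num_real.
by move=> y My x _; rewrite /= (le_trans (fM x))// ltW.
Qed.

Lemma Rintegral_cvg_dominated (m : {measure set T -> \bar R}) (f_ : nat -> T -> R) f (g : T -> R) :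
  (forall i, measurable_fun setT (f_ i)) -> measurable_fun setT f ->
  (forall x, f_ ^~ x @ \oo --> f x) -> m.-integrable setT (EFin \o g) ->
  (forall i x, `|f_ i x| <= g x) ->
  (fun i => \int[m]_x f_ i x) @ \oo --> \int[m]_x f x.
Proof.
move=> mf_ mf ff ig fg.
have [||||| If _ H] := @dominated_convergence _ _ _ m setT measurableT
  (fun i => EFin \o f_ i) (EFin \o f) (EFin \o g).
- by move=> i; exact/measurable_EFinP.
- exact/measurable_EFinP.
- by apply: aeW => x _; apply: cvg_EFin; [exact: nearW|exact: ff].
- exact: ig.
- by apply: aeW => x i _ /=; rewrite lee_fin.
- apply: fine_cvg; rewrite fineK//; exact: integrable_fin_num If.
Qed.

Lemma finite_measure_add m n : exists k,
  (forall A, k A = (m A + n A)%E) /\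
  forall f M, measurable_fun setT f -> (forall x, `|f x| <= M) ->
    \int[k]_x f x = \int[m]_x f x + \int[n]_x f x.
Proof.
pose k0 : {measure set T -> \bar R} := measure_add m n.
have k0E A : k0 A = (m A + n A)%E by exact: measure_addE.
have fk : fin_num_fun k0.
  by move=> A mA; rewrite k0E fin_numD !fin_num_measure.
pose k : {finite_measure set T -> \bar R} :=
  HB.pack (k0 : set T -> \bar R) (Measure.class k0) (Measure_isFinite.Build _ T R k0 fk).
exists k; split; first exact: k0E.
move=> f M mf fM.
have im := bounded_integrable m mf fM; have in_ := bounded_integrable n mf fM.
rewrite /Rintegral -fineD; [|exact: integrable_fin_num im|exact: integrable_fin_num in_].
by rewrite -integral_measure_add//; exact/measurable_EFinP.
Qed.

Lemma finite_measure_scale m (a : R) : 0 <= a -> exists k,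
  (forall A, k A = (a%:E * m A)%E) /\
  forall f M, measurable_fun setT f -> (forall x, 0 <= f x <= M) ->
    \int[k]_x f x = a * \int[m]_x f x.
Proof.
move=> a0; exists (mscale (NngNum a0) m); split => // f M mf fM.
have im : m.-integrable setT (EFin \o f).
  by apply: (@bounded_integrable m f M) => // x; have /andP[? ?] := fM x; rewrite ger0_norm.
rewrite /Rintegral ge0_integral_mscale//.
- by rewrite fineM//; exact: integrable_fin_num im.
- exact/measurable_EFinP.
- by move=> x _; rewrite lee_fin; have /andP[] := fM x.
Qed.

(** Measures can be scaled by nonnegative numbers only; a negative coefficient is absorbed by
    exchanging [m1] and [m2]. *)
Lemma measure_difference_comb (a : R) m1 m2 n1 n2 : exists k1 k2,
  (forall A, measurable A -> fine (k1 A) - fine (k2 A) =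
     a * (fine (m1 A) - fine (m2 A)) + (fine (n1 A) - fine (n2 A))) /\
  forall f M, measurable_fun setT f -> (forall x, 0 <= f x <= M) ->
    \int[k1]_x f x - \int[k2]_x f x =
    a * (\int[m1]_x f x - \int[m2]_x f x) + (\int[n1]_x f x - \int[n2]_x f x).
Proof.
wlog a0 : a m1 m2 / 0 <= a.
  move=> H; have [/H//|a0] := leP 0 a.
  have [|k1 [k2 [kA kf]]] := H (- a) m2 m1; first by rewrite oppr_ge0 ltW.
  exists k1, k2; split => [A mA|f M mf fM]; first by rewrite kA//; ring.
  by rewrite (kf f M)//; ring.
have [p1 [p1A p1f]] := finite_measure_scale m1 a0.
have [p2 [p2A p2f]] := finite_measure_scale m2 a0.
have [k1 [k1A k1f]] := finite_measure_add p1 n1.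
have [k2 [k2A k2f]] := finite_measure_add p2 n2.
exists k1, k2; split => [A mA|f M mf fM].
  rewrite k1A k2A !fineD ?fin_num_measure// p1A p2A !fineM ?fin_num_measure//=.
  by ring.
have fM' x : `|f x| <= M by have /andP[? ?] := fM x; rewrite ger0_norm.
by rewrite (k1f f M)// (k2f f M)// (p1f f M)// (p2f f M)//; ring.
Qed.

End finite_measures.

(** * Representation of Daniell functionals by Borel measures *)

Section borel.
Context {R : realType} {X : completeNormedModType R}.
Local Notation BX := (borel_of X).

Lemma continuous_borel (f : X -> R) : continuous f -> measurable_fun [set: BX] f.
Proof.
move=> /continuousP cf; apply: (measurability _ (RGenOpens.measurableE R)).
move=> _ [_ [a [b ->] <-]]; rewrite setTI.
by apply: sub_sigma_algebra; exact/cf/interval_open.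
Qed.

Variable H : (X -> R) -> Prop.
Hypothesis Hlat : function_lattice H.
Hypothesis Hcont : forall f, H f -> continuous f.
Hypothesis Hbound : forall f, H f -> exists M, forall x, `|f x| <= M.
Hypothesis Hgen : @open X `<=` <<s [set A | exists2 f, H f & A = [set x | 0 < f x]] >>.

Let G : set (set X) := [set A | exists2 f, H f & A = [set x | 0 < f x]].

Let GE : <<s G >> = <<s @open X >>.
Proof.
apply/seteqP; split; last exact: smallest_sub.
apply: smallest_sub => // _ [f Hf ->].
have -> : [set x | 0 < f x] = f @^-1` [set t | 0 < t] by [].
apply: sub_sigma_algebra; have /continuousP := Hcont Hf; apply.
exact: open_gt.
Qed.

Lemma nonneg_in_measurable f : nonneg_in H f -> measurable_fun [set: BX] f.
Proof. by move=> [/Hcont/continuous_borel]. Qed.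

(** The truncations of [i f^+] at height 1 increase to the indicator of the set where [f > 0], so
    the measures agree on positivity sets. These are stable under intersection, by minima, and
    generate the Borel sets. *)
Lemma finite_measure_ext (m n : {finite_measure set BX -> \bar R}) :
  (forall f, nonneg_in H f -> \int[m]_x f x = \int[n]_x f x) ->
  forall A : set BX, measurable A -> m A = n A.
Proof.
move=> mn A mA.
have cvg_pos f (k : {finite_measure set BX -> \bar R}) : H f ->
    (fun i : nat => \int[k]_x Num.min (i%:R * Num.max (f x) 0) 1) @ \oo -->
      fine (k [set x | 0 < f x]).
  move=> Hf.
  have mG : measurable ([set x | 0 < f x] : set BX).
    rewrite /measurable/= -GE.
    by apply: sub_sigma_algebra; exists f.
  rewrite (_ : fine _ = \int[k]_x (\1_[set x | 0 < f x] x)); last first.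
    by rewrite /Rintegral integral_indic// setIT.
  apply: (@Rintegral_cvg_dominated _ _ _ k _ _ (fun=> 1)).
  - move=> i; apply: nonneg_in_measurable; apply: nonneg_in_min => //.
      by apply: nonneg_inZ => //; exact: nonneg_in_pos.
    exact: nonneg_in_cst.
  - exact: measurable_indic.
  - move=> x; apply: cvg_near_cst; rewrite indicE.
    have [fx|fx] := boolP (x \in [set x | 0 < f x]); move: fx; rewrite ?inE/=.
      move=> fx; near=> i.
      apply/min_idPr; rewrite (max_idPl (ltW fx)) -ler_pdivrMr// div1r.
      rewrite (le_trans (ltW (truncnS_gt _)))// ler_nat.
      by near: i; exists (Num.truncn (f x)^-1).+1.
    rewrite notin_setE/= => /negP; rewrite -leNgt => fx; near=> i.
    by rewrite (max_idPr fx) mulr0; apply/min_idPl.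
  - by apply: (@bounded_integrable _ _ _ k _ 1) => // x; rewrite normr1.
  - move=> i x; rewrite ger0_norm ?ge_min ?lexx ?orbT//.
    by rewrite le_min ler01 andbT mulr_ge0// le_max lexx orbT.
have mnG B : G B -> m B = n B.
  move=> [f Hf ->].
  have E : fine (m [set x | 0 < f x]) = fine (n [set x | 0 < f x]).
    have := cvg_pos f m Hf; have := cvg_pos f n Hf.
    rewrite (_ : (fun i : nat => \int[n]_x _) = (fun i : nat =>
      \int[m]_x Num.min (i%:R * Num.max (f x) 0) 1)) => [c1 c2|].
      exact: cvg_unique c2 c1.
    apply/funext => i; rewrite mn//.
    by apply: nonneg_in_min => //; [apply: nonneg_inZ => //; exact: nonneg_in_pos|exact: nonneg_in_cst].
  have mG : measurable ([set x | 0 < f x] : set BX).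
    by rewrite /measurable/= -GE; apply: sub_sigma_algebra; exists f.
  by rewrite -[LHS]fineK ?fin_num_measure// -[RHS]fineK ?fin_num_measure// E.
have GT : G setT.
  exists (fun=> 1); first exact: (lattice_cst Hlat).
  by apply/seteqP; split => // x _ /=; exact: ltr01.
apply: (@g_sigma_algebra_measure_unique _ _ BX G _ (fun=> setT) _ _ m n) => //.
- by move=> B GB; rewrite /measurable/= -GE; exact: sub_sigma_algebra.
- by rewrite bigcup_const//; exists 0%N.
- move=> _ _ [f Hf ->] [g Hg ->]; exists (fun x => Num.min (f x) (g x)).
    exact: (lattice_min Hlat).
  by apply/seteqP; split => x /=; rewrite lt_min => /andP.
- by move=> k; rewrite -ge0_fin_numE// fin_num_measure.
- by rewrite GE.
Unshelve. all: by end_near.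
Qed.

(** Borel sets are Caratheodory measurable because positivity sets are. For the integral formula
    only one inequality is proved directly, by slicing; the other follows by applying it to [K - f],
    equality being known on constants. *)
Lemma daniell_measure_exists I : daniell_functional H I ->
  exists m : {finite_measure set BX -> \bar R},
    (forall A, m A = daniell_outer H I A) /\
    forall f, nonneg_in H f -> \int[m]_x f x = I f.
Proof.
move=> HI.
have [mu muE] := daniell_outer_is_outer_measure Hlat HI.
have cara A : <<s @open X >> A -> (mu : set X -> \bar R).-caratheodory A.
  rewrite -GE; apply: smallest_sub; last first.
    move=> _ [f Hf ->]; apply: le_caratheodory_measurable => Y.
    by rewrite muE; exact: daniell_outer_caratheodory.
  exact: (@sigma_algebra_measurable _ (caratheodory_type (mu : set X -> \bar R))).
pose D : set BX -> \bar R := mu.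
have D0 : D set0 = 0%E by exact: outer_measure0.
have Dge0 A : (0 <= D A)%E by exact: outer_measure_ge0.
have Dsig : semi_sigma_additive D.
  move=> F mF tF mUF.
  apply: (@caratheodory_measure_sigma_additive _ _ mu) => //.
  - by move=> i; exact: (cara _ (mF i)).
  - exact: (cara _ mUF).
have Dfin : fin_num_fun D.
  by move=> A mA; rewrite /D muE (daniell_outer_fin_num Hlat HI).
pose m0 : {measure set BX -> \bar R} := HB.pack D (isMeasure.Build _ BX R D D0 Dge0 Dsig).
have [m mE] : exists m : {finite_measure set BX -> \bar R},
    forall A, m A = daniell_outer H I A.
  pose m : {finite_measure set BX -> \bar R} :=
    HB.pack D (Measure.class m0) (Measure_isFinite.Build _ BX R m0 Dfin).
  by exists m => A; rewrite -muE.
exists m; split => //.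
have mb f : nonneg_in H f -> m.-integrable setT (EFin \o f).
  move=> Hf; have [M fM] := Hbound Hf.1.
  exact: bounded_integrable (nonneg_in_measurable Hf) fM.
have m1 (a : R) : \int[m]_x a = a * I (fun=> 1).
  rewrite Rintegral_cst//; congr (_ * _); transitivity (fine (daniell_outer H I setT)).
    by congr fine; exact: mE.
  by rewrite (daniell_outerT Hlat HI).
have I1 : 0 <= I (fun=> 1) by apply: (daniell_ge0 HI); exact: nonneg_in_cst.
have mset f (a : R) : H f -> measurable ([set x | a < f x] : set BX).
  move=> Hf; have -> : [set x | a < f x] = f @^-1` [set t | a < t] by [].
  by apply: sub_sigma_algebra; have /continuousP := Hcont Hf; apply; exact: open_gt.
(* Slicing [f] at height [1/n] transfers each slice to the measure of a superlevel set. *)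
have slice n K f : nonneg_in H f -> (forall x, f x <= K%:R / n.+1%:R) ->
    \int[m]_x f x <= I f + n.+1%:R^-1 * fine (m [set x | 0 < f x]).
  elim: K f => [|K ih] f Hf fK.
    have E x : f x = 0.
      by apply/eqP; rewrite eq_le Hf.2 andbT (le_trans (fK x))// mul0r.
    rewrite (_ : \int[m]_x f x = 0); last first.
      by rewrite (_ : f = fun=> 0) ?Rintegral_cst ?mul0r//; exact/funext.
    by rewrite addr_ge0// ?(daniell_ge0 HI)// mulr_ge0// fine_ge0.
  set d := n.+1%:R^-1 in fK *.
  have d0 : 0 < d by rewrite invr_gt0.
  pose g x := Num.min (f x) d; pose h x := Num.max (f x - d) 0.
  have Hd : nonneg_in H (fun=> d) by apply: nonneg_in_cst => //; exact: ltW.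
  have Hg : nonneg_in H g by exact: nonneg_in_min.
  have Hh : nonneg_in H h by exact: nonneg_in_posB.
  have fgh : f = (fun x => g x + h x).
    apply/funext => x; rewrite /g /h; case: (leP (f x) d) => fd.
      by rewrite (max_idPr _) ?addr0// subr_le0.
    by rewrite (max_idPl _) ?subr_ge0 ?ltW// addrC subrK.
  have hK x : h x <= K%:R * d.
    rewrite /h ge_max mulr_ge0 ?(ltW d0)// andbT lerBlDr.
    by rewrite (le_trans (fK x))// -natr1 mulrDl mul1r.
  have Ih := ih h Hh hK; rewrite -/d in Ih.
  have -> : \int[m]_x f x = \int[m]_x g x + \int[m]_x h x.
    by rewrite -RintegralD//; [rewrite {1}fgh|exact: mb|exact: mb].
  have -> : I f = I g + I h by rewrite {1}fgh (daniellD HI).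
  have A1 : \int[m]_x g x <= d * fine (m [set x | 0 < f x]).
    have -> : fine (m [set x | 0 < f x]) = \int[m]_x (\1_[set x | 0 < f x] x).
      by rewrite /Rintegral integral_indic ?setIT//; exact: mset Hf.1.
    have i1 : m.-integrable setT (EFin \o (\1_[set x | 0 < f x] : X -> R)).
      apply: (@bounded_integrable _ _ _ m _ 1); first by apply: measurable_indic; exact: mset Hf.1.
      by move=> x; rewrite indicE; case: (_ \in _); rewrite ?normr1 ?normr0.
    rewrite -RintegralZl//; apply: le_Rintegral => //; first exact: mb.
      by have := integrableZl measurableT d i1.
    move=> x _; rewrite indicE /g; have [fx|] := boolP (x \in _).
      by rewrite mulr1 ge_min lexx orbT.
    rewrite notin_setE/= => /negP; rewrite -leNgt => fx.
    by rewrite mulr0 ge_min fx.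
  (* [g / d] is at least 1 where [f > d], so it covers that set. The slice height is the inverse of
     an integer because [I] is known to commute with integer multiples. Each slice thus pays for the
     set above it, and only the bottom term [d m (f > 0)] remains as error. *)
  have A2 : d * fine (m [set x | 0 < h x]) <= I g.
    have -> : [set x | 0 < h x] = [set x | d < f x].
      by apply/funext => x; rewrite /h /= lt_max ltxx orbF subr_gt0.
    rewrite -ler_pdivlMl// invrK -(daniellMn Hlat HI)//.
    rewrite -lee_fin fineK; last by rewrite fin_num_measure//; exact: mset Hf.1.
    rewrite mE; apply: daniell_outer_le.
      by apply: nonneg_inZ.
    move=> x /= dx; rewrite /g (min_idPr (ltW dx)).
    by rewrite /d mulfV ?pnatr_eq0.
  lra.
have le_I f : nonneg_in H f -> \int[m]_x f x <= I f.
  move=> Hf; apply/ler_addgt0Pr => e e0.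
  have [M fM] := Hbound Hf.1.
  pose n := Num.truncn (I (fun=> 1) / e).
  have := slice n (Num.truncn (M * n.+1%:R)).+1 f Hf.
  have h1 x : f x <= (Num.truncn (M * n.+1%:R)).+1%:R / n.+1%:R.
    rewrite ler_pdivlMr//; apply: le_trans (ltW (truncnS_gt _)).
    by rewrite ler_wpM2r// (le_trans (ler_norm _) (fM x)).
  move/(_ h1)/le_trans; apply; rewrite lerD2l.
  rewrite ler_pdivrMl//.
  have h2 : fine (m [set x | 0 < f x]) <= I (fun=> 1).
    rewrite -lee_fin fineK ?fin_num_measure//; last exact: mset Hf.1.
    by rewrite mE; exact: (daniell_outer_le1 Hlat I).
  apply: (le_trans h2).
  by rewrite -ler_pdivrMr// ltW// truncnS_gt.
move=> f Hf; apply/eqP; rewrite eq_le le_I//=.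
have [M fM] := Hbound Hf.1.
pose K := (Num.truncn M).+1.
have HK : nonneg_in H (fun=> K%:R) by exact: nonneg_in_cst.
have HKf : nonneg_in H (fun x => K%:R - f x).
  apply: nonneg_inB => //; first exact: Hf.1.
  by move=> x; rewrite (le_trans (ler_norm _))// (le_trans (fM x))// ltW// truncnS_gt.
have := le_I _ HKf; rewrite RintegralB//; [|exact: mb|exact: mb].
have : I (fun=> K%:R) = I f + I (fun x => K%:R - f x).
  rewrite -(daniellD HI)//; congr I; apply/funext => x.
  by rewrite addrC subrK.
have : I (fun=> K%:R) = K%:R * I (fun=> 1).
  rewrite -(daniellMn Hlat HI); last exact: nonneg_in_cst.
  by congr I; apply/funext => x; rewrite mulr1.
rewrite m1; lra.
Qed.

End borel.

(** * Dini's theorem on balls *)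

Section cylindrical.
Context {R : realType} {X : completeNormedModType R}.
Variable ip : X -> X -> R.
Hypothesis ip_inner : is_inner_product ip.
Variable e : nat -> X.
Hypothesis e_on : orthonormal_seq ip e.

Lemma ucyl_lattice : function_lattice (ucyl ip e).
Proof.
split; [exact: ucyl_cst|exact: ucylD|exact: ucylZ|exact: ucyl_max|exact: ucyl_min].
Qed.

(** Half-spaces along the basis are positivity sets, so coordinates are measurable for the generated
    sigma-algebra, then squared distances as limits of their finite sections, then balls;
    separability writes an open set as a countable union of balls. *)
Lemma open_ucyl_generated : separable_space (X := X) ->
  @open X `<=` <<s [set A | exists2 f, ucyl ip e f & A = [set x | 0 < f x]] >>.
Proof.
move=> [D [cD clD]]; set G := [set A | _].
pose Y := g_sigma_algebraType G.
have mcoord k : measurable_fun [set: Y] (fun x : Y => ip x (e k)).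
  apply: (measurability _ (RGenOInfty.measurableE R)).
  move=> _ [_ [a ->] <-]; rewrite setTI; apply: sub_sigma_algebra.
  exists (fun x => (ip x (e k) - a) / (1 + (ip x (e k) - a) ^+ 2)).
    by apply: cylC1_ucyl; exact: cylC1_coord.
  apply/seteqP; split => x /=; rewrite in_itv/= andbT -(subr_gt0 a) pmulr_lgt0//.
    by rewrite invr_gt0; have := sqr_ge0 (ip x (e k) - a); lra.
  by rewrite invr_gt0; have := sqr_ge0 (ip x (e k) - a); lra.
have mdist a : measurable_fun [set: Y] (fun x : Y => `|(x : X) - a| ^+ 2).
  apply: (@measurable_fun_cvg _ _ _ _ (fun n (x : Y) => `|proj ip e n ((x : X) - a)| ^+ 2)).
    move=> n.
    rewrite (_ : (fun _ => _) = (fun x : Y => \sum_(0 <= k < n) (ip x (e k) - ip a (e k)) ^+ 2)).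
      apply: measurable_sum => k; apply: measurable_funX.
      by apply: measurable_funB => //; exact: measurable_cst.
    apply/funext => x; rewrite norm_proj//; apply: eq_bigr => k _.
    by rewrite ipBl.
  move=> x _; have h := @proj_cvg _ _ _ ip_inner _ e_on ((x : X) - a).
  by rewrite expr2; under eq_fun do rewrite expr2; apply: cvgM; exact: cvg_norm.
have mball a r : 0 < r -> <<s G >> (ball a r : set X).
  move=> r0; have -> : ball a r = [set x | `|x - a| ^+ 2 < r ^+ 2].
    apply/seteqP; split => x; rewrite -ball_normE/= distrC => h.
      by rewrite ltr_pXn2r// nnegrE// ltW.
    by move: h; rewrite ltr_pXn2r// nnegrE// ltW.
  have := mdist a measurableT `]-oo, (r ^+ 2)[%classic (measurable_itv _).
  rewrite setTI; congr (<<s G >> _); apply/seteqP; split => x /=; by rewrite in_itv.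
have /countable_injP[f finj] := cD.
move=> U oU.
pose P (i : nat * nat) d := [/\ D d, f d = i.1 & ball d i.2.+1%:R^-1 `<=` U].
(* The pair encodes the number of a dense point and a radius [1 / (n + 1)]; it contributes the empty
   set when no such ball lies in [U]. *)
pose F (i : nat * nat) : set Y :=
  match pselect (exists d, P i d) with
  | left h => ball (projT1 (cid h)) i.2.+1%:R^-1
  | right _ => set0
  end.
have -> : U = \bigcup_i F i.
  apply/seteqP; split; last first.
    move=> x [i _]; rewrite /F; case: pselect => // h.
    by case: cid => d /= [_ _]; apply.
  move=> x Ux; have /nbhs_ballP[r /= r0 rU] : nbhs x U by exact: open_nbhs_nbhs.
  pose n := Num.truncn (2 / r).
  have nr : n.+1%:R^-1 < r / 2.
    by rewrite invf_plt ?posrE ?divr_gt0// invf_div truncnS_gt.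
  have [d [Dd xd]] : exists d, D d /\ ball x n.+1%:R^-1 d.
    have /(_ (ball x n.+1%:R^-1)) : closure D x by rewrite clD.
    by case; [exact: nbhsx_ballx|move=> d [? ?]; exists d].
  have Pd : P (f d, n) d.
    split => // y dy; apply: rU; rewrite (splitr r).
    apply: (ball_triangle (y := d)).
      by apply: le_ball xd; exact: ltW.
    by apply: le_ball dy; exact: ltW.
  exists (f d, n) => //; rewrite /F; case: pselect => [h|[]]; last by exists d.
  case: cid => d' [Dd' fd' _] /=.
  have -> : d' = d by apply: finj; rewrite ?inE.
  exact: ball_sym.
have mF i : measurable (F i).
  rewrite /F; case: pselect => [h|_]; last exact: measurable0.
  by apply: mball; rewrite invr_gt0.
exact: (@countable_bigcupT_measurable _ Y _ F _ mF).
Qed.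

(** A single ultrafilter gives limits of all coordinate sequences at once, in place of a diagonal
    extraction of subsequences. *)
Lemma ultra_bounded_cvg (U : set_system nat) (s : nat -> R) (C : R) : UltraFilter U ->
  (forall n, `|s n| <= C) -> exists l : R, s @ U --> l.
Proof.
move=> UU sC.
have [|l [_ cl]] := @segment_compact R (- C) C (s @ U) _.
  suff : U (s @^-1` `[- C, C]%classic) by [].
  by apply: filterE => n /=; rewrite in_itv/= -ler_norml.
exists l => V lV.
have [//|sV] := in_ultra_setVsetC (s @^-1` V) UU.
by have [y [/= nVy]] := cl (~` V) V sV lV.
Qed.

(* Bounded sets are weakly relatively compact and cylindrical functions are weakly
   continuous on them, so Dini's argument works on balls. *)
Lemma ucyl_dini (f : nat -> X -> R) (rho eps : R) : 0 <= rho -> 0 < eps ->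
  (forall n, ucyl ip e (f n)) ->
  (forall x m n, (m <= n)%N -> f n x <= f m x) ->
  (forall x d, 0 < d -> exists n, f n x <= d) ->
  exists n, forall x, `|x| <= rho -> f n x <= eps.
Proof.
move=> rho0 eps0 uf fm f0; apply: contrapT => H.
have /choice[x xP] n : exists x, `|x| <= rho /\ eps < f n x.
  apply: contrapT => h; apply: H; exists n => x xr.
  by rewrite leNgt; apply/negP => fx; apply: h; exists x.
have [U [UU oU]] := ultraFilterLemma (eventually_filter).
have /choice[a aP] k : exists l : R, (fun n => ip (x n) (e k)) @ U --> l.
  apply: (ultra_bounded_cvg (C := rho * `|e k|)) => n.
  rewrite (le_trans (cauchy_schwarz ip_inner _ _))// ler_wpM2r//.
  by have [] := xP n.
have ae k : e k = 0 -> a k = 0.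
  move=> ek; have := aP k; rewrite ek; under eq_fun do rewrite ip0r//.
  move=> h; apply/esym; exact: (cvg_unique _ (cvg_cst 0) h).
have sum_cvg n : (fun i => \sum_(0 <= k < n) ip (x i) (e k) ^+ 2) @ U -->
    \sum_(0 <= k < n) a k ^+ 2.
  elim: n => [|n ih].
    by under eq_fun do rewrite big_nil; rewrite big_nil; exact: cvg_cst.
  under eq_fun do rewrite big_nat_recr//=.
  rewrite big_nat_recr//=; apply: cvgD => //.
  by rewrite expr2; under eq_fun do rewrite expr2; apply: cvgM; exact: aP.
have ar n : \sum_(0 <= k < n) a k ^+ 2 <= rho ^+ 2.
  apply: (cvgr_to_le (sum_cvg n)); apply: nearW => i.
  rewrite (le_trans (bessel ip_inner e_on _ _))// lerXn2r ?nnegrE//.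
  by have [] := xP i.
have [y [ya _ _]] := riesz_fischer ip_inner e_on rho0 ae ar.
have proj_cvg n : (fun i => proj ip e n (x i)) @ U --> proj ip e n y.
  rewrite /proj; elim: n => [|n ih].
    by under eq_fun do rewrite big_nil; rewrite big_nil; exact: cvg_cst.
  under eq_fun do rewrite big_nat_recr//=.
  rewrite big_nat_recr//=; apply: cvgD => //.
  by apply: cvgZ; [rewrite ya; exact: aP|exact: cvg_cst].
(* For [i >= n], monotonicity gives [f n (x i) >= f i (x i) > eps]. A cylindrical approximation of
   [f n] passes to the weak limit [y], at the cost of [eps / 4] twice. *)
have fy n : eps / 2 <= f n y.
  have d0 : 0 < eps / 4 by lra.
  have [h [[g hg] [m hm]] fh] := uf n _ d0.
  have hc : (fun i => h (x i)) @ U --> h y.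
    rewrite hm; under eq_fun do rewrite hm.
    apply: (cvg_comp _ _ (proj_cvg m)).
    exact: (C1b_continuous hg).
  have : eps - eps / 4 <= h y.
    apply: (cvgr_to_ge hc); apply: oU; exists n => // i /= ni.
    have [_ xi] := xP i; have := fm (x i) n i ni; have := fh (x i).
    by rewrite ler_norml => /andP[]; lra.
  by have := fh y; rewrite ler_norml => /andP[]; lra.
have e2 : 0 < eps / 3 by lra.
by have [n] := f0 y _ e2; have := fy n; lra.
Qed.

End cylindrical.

(** * The divergence functional *)

Section variation.
Context {R : realType} {X : completeNormedModType R}.
Variable ip : X -> X -> R.
Hypothesis ip_inner : is_inner_product ip.
Local Notation BX := (borel_of X).
Variables (nu : probability BX R) (Rop : {linear X -> X}) (v : X -> X -> R) (u : X -> R).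

Definition div_pairing (phi : X -> R) (g : X -> X) (w : X) : R :=
  \int[nu]_x (u x * (- ip (g x) (Rop w) + v w x * phi x)).

(** A field is kept as a list of terms with their gradients and directions, so [field_div] is
    attached to a presentation; [field_div_ext] shows that it depends on the values of the field
    alone. *)
Record field_term := FieldTerm {
  term_fun : X -> R ; term_grad : X -> X ; term_dir : X ;
  term_C1b : C1b ip term_fun term_grad }.

Definition field_val (s : seq field_term) x :=
  \sum_(t <- s) term_fun t x *: Rop (term_dir t).

Definition field_div (s : seq field_term) :=
  \sum_(t <- s) div_pairing (term_fun t) (term_grad t) (term_dir t).

Definition term_mul q k (qk : C1b ip q k) (t : field_term) :=
  FieldTerm (term_dir t) (C1bM ip_inner qk (term_C1b t)).

Definition field_mul q k (qk : C1b ip q k) := map (term_mul qk).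

Definition field_scale a := field_mul (C1b_cst ip_inner a).

Lemma field_val_cat s1 s2 x : field_val (s1 ++ s2) x = field_val s1 x + field_val s2 x.
Proof. by rewrite /field_val big_cat. Qed.

Lemma field_div_cat s1 s2 : field_div (s1 ++ s2) = field_div s1 + field_div s2.
Proof. by rewrite /field_div big_cat. Qed.

Lemma field_val_mul q k (qk : C1b ip q k) s x :
  field_val (field_mul qk s) x = q x *: field_val s x.
Proof.
rewrite /field_val big_map scaler_sumr; apply: eq_bigr => t _.
by rewrite scalerA.
Qed.

Hypothesis u_int : nu.-integrable setT (EFin \o u).
Hypothesis uv_int : forall z, nu.-integrable setT (fun x => (u x * v z x)%:E).

Let u_meas : measurable_fun [set: BX] u.
Proof. by have /measurable_int/measurable_EFinP := u_int. Qed.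

Let uv_meas z : measurable_fun [set: BX] (fun x => u x * v z x).
Proof. by have /measurable_int/measurable_EFinP := uv_int z. Qed.

Let integrand_meas phi g w : continuous phi -> continuous g ->
  measurable_fun [set: BX] (fun x => u x * (- ip (g x) (Rop w) + v w x * phi x)).
Proof.
move=> cphi cg.
rewrite (_ : (fun _ => _) = (fun x => (u x * v w x) * phi x - u x * ip (g x) (Rop w))).
  apply: measurable_funB; apply: measurable_funM => //; apply: continuous_borel => //.
  by apply: ip_continuous => //; exact: cst_continuous.
by apply/funext => x; ring.
Qed.

Let bound_int (w : X) (C : R) : nu.-integrable setT
  (EFin \o (fun x => C * (`|u x * v w x| + `|u x|))).
Proof.
have h : nu.-integrable setT (EFin \o (fun x => `|u x * v w x| + `|u x|)).
  have := integrableD measurableT (integrable_norm (uv_int w)) (integrable_norm u_int).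
  by [].
by have := integrableZl measurableT C h.
Qed.

Let integrand_bound phi g w (C : R) x : `|phi x| <= C -> `|g x| <= C ->
  `|u x * (- ip (g x) (Rop w) + v w x * phi x)| <=
  C * (1 + `|Rop w|) * (`|u x * v w x| + `|u x|).
Proof.
move=> pC gC.
have C0 : 0 <= C by exact: le_trans pC.
have -> : u x * (- ip (g x) (Rop w) + v w x * phi x) =
  (u x * v w x) * phi x - u x * ip (g x) (Rop w) by ring.
rewrite (le_trans (ler_normB _ _))// !(normrM _ (phi x)) (normrM (u x) (ip _ _)).
have h1 : `|u x * v w x| * `|phi x| <= `|u x * v w x| * C by rewrite ler_wpM2l.
have h2 : `|u x| * `|ip (g x) (Rop w)| <= `|u x| * (C * `|Rop w|).
  rewrite ler_wpM2l// (le_trans (cauchy_schwarz ip_inner _ _))// ler_wpM2r//.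
have := normr_ge0 (Rop w); have := normr_ge0 (u x * v w x); have := normr_ge0 (u x).
set A := `|u x * v w x| in h1 *; set B := `|u x| in h2 *; set D := `|Rop w| in h2 *.
move=> B0 A0 D0.
have := mulr_ge0 (mulr_ge0 C0 D0) A0; have := mulr_ge0 C0 B0.
by nra.
Qed.

Lemma div_pairing_integrable phi g w : C1b ip phi g ->
  nu.-integrable setT (EFin \o (fun x => u x * (- ip (g x) (Rop w) + v w x * phi x))).
Proof.
move=> Cp; have [C C0 pC] := C1b_bounded Cp.
apply: (le_integrable measurableT _ _ (bound_int w (C * (1 + `|Rop w|)))).
  apply/measurable_EFinP; apply: integrand_meas.
    exact: C1b_continuous Cp.
  by have /C1bP[] := Cp.
move=> x _ /=; rewrite lee_fin; apply: le_trans (ler_norm _).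
by have [? ?] := pC x; exact: integrand_bound.
Qed.

Lemma div_pairing_cvg (phi_ : nat -> X -> R) g_ phi g w (C : R) :
  (forall n, C1b ip (phi_ n) (g_ n)) -> C1b ip phi g ->
  (forall n x, `|phi_ n x| <= C) -> (forall n x, `|g_ n x| <= C) ->
  (forall x, phi_ ^~ x @ \oo --> phi x) -> (forall x, g_ ^~ x @ \oo --> g x) ->
  (fun n => div_pairing (phi_ n) (g_ n) w) @ \oo --> div_pairing phi g w.
Proof.
move=> Cn Cp pC gC pp gg.
apply: (@Rintegral_cvg_dominated _ _ _ nu _ _
  (fun x => C * (1 + `|Rop w|) * (`|u x * v w x| + `|u x|))).
- move=> n; apply: integrand_meas; first exact: C1b_continuous (Cn n).
  by have /C1bP[] := Cn n.
- apply: integrand_meas; first exact: C1b_continuous Cp.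
  by have /C1bP[] := Cp.
- move=> x; apply: cvgM; first exact: cvg_cst.
  apply: cvgD; last by apply: cvgM; [exact: cvg_cst|exact: pp].
  apply: cvgN; apply: (ip_cvg ip_inner); [exact: gg|exact: cvg_cst].
- exact: bound_int.
- by move=> n x; exact: integrand_bound.
Qed.

Lemma div_pairingD phi1 g1 phi2 g2 w : C1b ip phi1 g1 -> C1b ip phi2 g2 ->
  div_pairing (fun x => phi1 x + phi2 x) (fun x => g1 x + g2 x) w =
  div_pairing phi1 g1 w + div_pairing phi2 g2 w.
Proof.
move=> C1 C2; rewrite /div_pairing -RintegralD//;
  [|exact: div_pairing_integrable C1|exact: div_pairing_integrable C2].
by apply: eq_Rintegral => x _; rewrite ipDl//; ring.
Qed.

Lemma div_pairingZ a phi g w : C1b ip phi g ->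
  div_pairing (fun x => a * phi x) (fun x => a *: g x + phi x *: 0) w =
  a * div_pairing phi g w.
Proof.
move=> Cp; rewrite /div_pairing -RintegralZl//; last exact: div_pairing_integrable Cp.
by apply: eq_Rintegral => x _; rewrite scaler0 addr0 (ipZl ip_inner); ring.
Qed.

Lemma field_val_scale a s x : field_val (field_scale a s) x = a *: field_val s x.
Proof. by rewrite field_val_mul. Qed.

Lemma field_div_scale a s : field_div (field_scale a s) = a * field_div s.
Proof.
rewrite /field_div big_map mulr_sumr; apply: eq_bigr => t _ /=.
by rewrite div_pairingZ//; exact: term_C1b.
Qed.

Variable V : R.
Hypothesis V_ub : forall s, (forall x, `|field_val s x| <= 1) -> field_div s <= V.
Hypothesis V_approx : forall eps, 0 < eps -> exists s,
  (forall x, `|field_val s x| <= 1) /\ V - eps <= field_div s.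

Lemma variation_ge0 : 0 <= V.
Proof.
have := @V_ub [::]; rewrite /field_div big_nil; apply => x.
by rewrite /field_val big_nil normr0.
Qed.

(** Normalizing by [M + d] instead of [M] covers [M = 0]; the choice [d = eps / (V + 1)] keeps the
    excess [d V] below [eps]. *)
Lemma field_div_le s M : 0 <= M -> (forall x, `|field_val s x| <= M) -> field_div s <= M * V.
Proof.
move=> M0 sM; apply/ler_addgt0Pr => eps eps0.
pose d := eps / (V + 1).
have V0 := variation_ge0.
have V1 : 0 < V + 1 by lra.
have d0 : 0 < d by rewrite divr_gt0.
have Md : 0 < M + d by lra.
have := @V_ub (field_scale (M + d)^-1 s).
rewrite field_div_scale ler_pdivrMl// => H.
have dV : d * V <= eps.
  by rewrite /d -mulrA ler_piMr ?(ltW eps0)// ler_pdivrMl// mulr1; lra.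
have : field_div s <= (M + d) * V.
  apply: H => x; rewrite field_val_scale normrZ gtr0_norm ?invr_gt0//.
  by rewrite ler_pdivrMl// mulr1 (le_trans (sM x))// lerDl ltW.
by rewrite mulrDl => h; lra.
Qed.

Lemma field_div_abs_le s M : 0 <= M -> (forall x, `|field_val s x| <= M) ->
  `|field_div s| <= M * V.
Proof.
move=> M0 sM; rewrite ler_norml field_div_le// andbT.
have := @field_div_le (field_scale (-1) s) M M0.
rewrite field_div_scale mulN1r lerNl; apply => x.
by rewrite field_val_scale scaleN1r normrN.
Qed.

Lemma field_div_sub_le s1 s2 M : 0 <= M ->
  (forall x, `|field_val s1 x - field_val s2 x| <= M) ->
  `|field_div s1 - field_div s2| <= M * V.
Proof.
move=> M0 H; have := @field_div_abs_le (s1 ++ field_scale (-1) s2) M M0.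
rewrite field_div_cat field_div_scale mulN1r; apply => x.
by rewrite field_val_cat field_val_scale scaleN1r.
Qed.

(** This is the difference bound with [M = 0]: a presentation of the zero field has pairing at most
    0 in absolute value. *)
Lemma field_div_ext s1 s2 : (forall x, field_val s1 x = field_val s2 x) ->
  field_div s1 = field_div s2.
Proof.
move=> H; apply/eqP; rewrite -subr_eq0 -normr_le0.
have := @field_div_sub_le s1 s2 0 (lexx _); rewrite mul0r; apply => x.
by rewrite H subrr normr0.
Qed.

Let a_ (n : nat) : R := n.+1%:R^-1.

Let a01 n : 0 < a_ n <= 1.
Proof. by rewrite invr_gt0 ltr0n/= invf_le1 ?ltr0n// ler1n. Qed.

Let a_cvg : a_ @ \oo --> (0 : R).
Proof. exact: cvg_harmonic. Qed.

Let weight_cvg (x : X) : (fun n => weight (a_ n) x) @ \oo --> (1 : R).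
Proof.
rewrite -[X in _ --> X]invr1; apply: cvgV; first by rewrite oner_eq0.
rewrite -[X in _ --> X]addr0 -[X in _ + X](mul0r (`|x| ^+ 2)).
by apply: cvgD; [exact: cvg_cst|apply: cvgM; [exact: a_cvg|exact: cvg_cst]].
Qed.

Let Cw n := C1b_weight ip_inner (a01 n).

Let Cw' n := C1bD ip_inner (C1b_cst ip_inner 1) (C1bN ip_inner (Cw n)).

Let field_div_split n s :
  field_div s = field_div (field_mul (Cw n) s) + field_div (field_mul (Cw' n) s).
Proof.
rewrite -field_div_cat; apply: field_div_ext => x.
by rewrite field_val_cat !field_val_mul -scalerDl addrC subrK scale1r.
Qed.

(** Dominated convergence term by term: the weights tend to 1 and their gradients to 0. The product
    rule and the bound 2 on weight gradients account for the constant [3 C = C + 2 C]. *)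
Lemma field_div_weight_cvg s :
  (fun n => field_div (field_mul (Cw n) s)) @ \oo --> field_div s.
Proof.
elim: s => [|t s ih].
  have E0 : field_div [::] = 0 by rewrite /field_div big_nil.
  by rewrite E0; apply: cvg_near_cst; exact: nearW.
have -> : field_div (t :: s) =
    div_pairing (term_fun t) (term_grad t) (term_dir t) + field_div s.
  by rewrite /field_div big_cons.
rewrite (_ : (fun n => _) = (fun n =>
  div_pairing (fun x => weight (a_ n) x * term_fun t x)
    (fun x => weight (a_ n) x *: term_grad t x + term_fun t x *: weight_grad (a_ n) x)
    (term_dir t) + field_div (field_mul (Cw n) s))); last first.
  by apply/funext => n; rewrite /field_div /= big_cons.
apply: cvgD; last exact: ih.
have Ct := term_C1b t; have [C C0 tC] := C1b_bounded Ct.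
apply: (@div_pairing_cvg _ _ _ _ _ (3 * C)) => //.
- by move=> n; exact: (C1bM ip_inner (Cw n) Ct).
- move=> n x; have /andP[a0 a1] := a01 n.
  have := weight_gt0 x a0; have := weight_le1 x a0.
  move=> w1 w0; rewrite normrM (gtr0_norm w0).
  have [h _] := tC x; have := normr_ge0 (term_fun t x) => h0.
  apply: (@le_trans _ _ (1 * C)); last by lra.
  by apply: ler_pM => //; exact: ltW.
- move=> n x; have /andP[a0 a1] := a01 n.
  have := weight_gt0 x a0; have := weight_le1 x a0 => w1 w0.
  have [h1 h2] := tC x.
  rewrite (le_trans (ler_normD _ _))// !normrZ (gtr0_norm w0).
  apply: (@le_trans _ _ (1 * C + C * 2)); last by lra.
  apply: lerD; first by apply: ler_pM => //; exact: ltW.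
  by apply: ler_pM => //; rewrite -normrZ; exact: weight_grad_le (a01 n).
- move=> x; rewrite -[X in _ --> X]mul1r; apply: cvgM; last exact: cvg_cst.
  exact: weight_cvg.
- move=> x; have g0 : (fun n => weight_grad (a_ n) x) @ \oo --> (0 : X).
    rewrite -(scale0r x); apply: cvgZ; last exact: cvg_cst.
    rewrite -[X in _ --> X]oppr0; apply: cvgN.
    rewrite -[X in _ --> X](mul0r (1 : R)); apply: cvgM.
      by rewrite -[X in _ --> X](mulr0 (2 : R)); apply: cvgM; [exact: cvg_cst|exact: a_cvg].
    rewrite -[X in _ --> X](mul1r (1 : R)) ; under eq_fun do rewrite expr2.
    by apply: cvgM; exact: weight_cvg.
  rewrite -[X in _ --> X]addr0; apply: cvgD.
    by rewrite -[X in _ --> X]scale1r; apply: cvgZ; [exact: weight_cvg|exact: cvg_cst].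
  by rewrite -[X in _ --> X](scaler0 _ (term_fun t x)); apply: cvgZ; [exact: cvg_cst|exact: g0].
Qed.

(* If [F] almost realizes [V], so does [psi F] for a weight [psi] close to 1; adding
   [(1 - psi) G] keeps the pointwise norm below 1 by convexity. *)
Lemma field_div_tight eps : 0 < eps -> exists n, forall s,
  (forall x, `|field_val s x| <= 1) -> field_div (field_mul (Cw' n) s) <= eps.
Proof.
move=> eps0; have e2 : 0 < eps / 2 by lra.
have [s0 [s01 s0V]] := V_approx e2.
have /cvgrPdist_le/(_ _ e2)[n _ /(_ n (leqnn _)) /= H] := @field_div_weight_cvg s0.
exists n => s s1.
have := @V_ub (field_mul (Cw n) s0 ++ field_mul (Cw' n) s).
rewrite field_div_cat => h.
have : field_div (field_mul (Cw n) s0) + field_div (field_mul (Cw' n) s) <= V.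
  apply: h => x; rewrite field_val_cat !field_val_mul.
  have /andP[a0 a1] := a01 n.
  have := weight_gt0 x a0; have := weight_le1 x a0 => w1 w0.
  rewrite (le_trans (ler_normD _ _))// !normrZ (gtr0_norm w0) ger0_norm ?subr_ge0//.
  have : weight (a_ n) x * `|field_val s0 x| <= weight (a_ n) x * 1.
    by rewrite ler_wpM2l// ltW.
  have : (1 - weight (a_ n) x) * `|field_val s x| <= (1 - weight (a_ n) x) * 1.
    by rewrite ler_wpM2l// subr_ge0.
  lra.
by move: H; rewrite ler_norml => /andP[]; lra.
Qed.

(** Homogeneous form of tightness: [F / M] is admissible, so the part of [F] carried by [1 - psi]
    contributes at most [M eps], with one weight for all fields. *)
Lemma field_div_truncate eps : 0 < eps -> exists n : nat, forall s M, 0 < M ->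
  (forall x, `|field_val s x| <= M) ->
  exists s', (forall x, field_val s' x = weight n.+1%:R^-1 x *: field_val s x) /\
    field_div s <= field_div s' + M * eps.
Proof.
move=> /field_div_tight[n H]; exists n => s M M0 sM.
exists (field_mul (Cw n) s); split; first by move=> x; rewrite field_val_mul.
rewrite (field_div_split n s) lerD2l -ler_pdivrMl//.
have := H (field_scale M^-1 s).
rewrite (@field_div_ext _ (field_scale M^-1 (field_mul (Cw' n) s))) => [|x].
  rewrite field_div_scale; apply => x.
  by rewrite field_val_scale normrZ gtr0_norm ?invr_gt0// ler_pdivrMl ?mulr1.
by rewrite !field_val_mul !scalerA mulrC.
Qed.

End variation.

(** * The directional variation functionals *)

Section variation_functional.
Context {R : realType} {X : completeNormedModType R}.
Variable ip : X -> X -> R.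
Hypothesis ip_inner : is_inner_product ip.
Variable e : nat -> X.
Hypothesis e_on : orthonormal_seq ip e.
Local Notation BX := (borel_of X).
Variables (nu : probability BX R) (Rop : {linear X -> X}) (v : X -> X -> R) (u : X -> R).
Hypothesis u_int : nu.-integrable setT (EFin \o u).
Hypothesis uv_int : forall z, nu.-integrable setT (fun x => (u x * v z x)%:E).
Local Notation field := (seq (field_term ip)).
Local Notation F := (field_val Rop).
Local Notation L := (field_div nu Rop v u).
Variable V : R.
Hypothesis V_ub : forall s : field, (forall x, `|F s x| <= 1) -> L s <= V.
Hypothesis V_approx : forall eps, 0 < eps -> exists s : field,
  (forall x, `|F s x| <= 1) /\ V - eps <= L s.

Let V_ge0 : 0 <= V := variation_ge0 V_ub.

Implicit Types (f : X -> R) (w : X) (c d : R) (s : field).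

(** The slack [d] makes the constraint stable under uniform approximation of [f]; the infimum in
    [dir_variation] amounts to letting [d] decrease to 0 in the supremum of [L]. *)
Definition near_dir w c f d s := forall x, `|F s x - f x *: Rop w| <= c * f x + d.

(* On smooth [f] this is the pairing of [u] with [f Rop w] plus [c] times the variation
   measure tested on [f]. *)
Definition dir_variation w c f : R :=
  inf [set t | exists2 d, 0 < d & forall s, near_dir w c f d s -> L s <= t].

Let field_norm_le w c f d s x : 0 <= f x -> near_dir w c f d s ->
  `|F s x| <= (c + `|Rop w|) * f x + d.
Proof.
move=> f0 /(_ x) H; rewrite -[F s x](subrK (f x *: Rop w)).
rewrite (le_trans (ler_normD _ _))// normrZ ger0_norm//; lra.
Qed.

Section cone.
Variables (w : X) (c : R).
Hypothesis wc : `|Rop w| <= c.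

Local Notation H := (nonneg_in (ucyl ip e)).

Let c_ge0 : 0 <= c. Proof. exact: le_trans wc. Qed.

(** The zero field competes exactly because [c] is at least the norm of [Rop w]; nonnegativity of
    [dir_variation] rests on this. *)
Let near_nil f d : (forall x, 0 <= f x) -> 0 < d -> near_dir w c f d [::].
Proof.
move=> f0 d0 x; rewrite /field_val big_nil sub0r normrN normrZ ger0_norm//.
rewrite mulrC; have : `|Rop w| * f x <= c * f x by rewrite ler_wpM2r.
by lra.
Qed.

Let bounded_set f : H f -> has_inf [set t | exists2 d, 0 < d & forall s, near_dir w c f d s -> L s <= t].
Proof.
move=> [Hf f0]; split.
  have [M M0 fM] := ucyl_bounded Hf.
  exists (((c + `|Rop w|) * M + 1) * V); exists 1 => // s sf.
  have k0 : 0 <= c + `|Rop w| by rewrite addr_ge0.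
  apply: (field_div_le ip_inner u_int uv_int V_ub).
    by rewrite addr_ge0// mulr_ge0// ltW.
  move=> x; rewrite (le_trans (field_norm_le (f0 x) sf))// lerD2r ler_wpM2l//.
  by rewrite (le_trans (ler_norm _) (fM x)).
exists 0 => t [d d0 /(_ [::])]; rewrite /field_div big_nil; apply.
exact: near_nil.
Qed.

Lemma dir_variation_ub f eps : H f -> 0 < eps ->
  exists2 d, 0 < d & forall s, near_dir w c f d s -> L s <= dir_variation w c f + eps.
Proof.
move=> Hf eps0; have [t [d d0 dt] te] := inf_adherent eps0 (bounded_set Hf).
by exists d => // s /dt/le_trans; apply; exact: ltW.
Qed.

Lemma dir_variation_adherent f eps d : H f -> 0 < eps -> 0 < d ->
  exists2 s, near_dir w c f d s & dir_variation w c f - eps <= L s.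
Proof.
move=> Hf eps0 d0; apply: contrapT => Hn.
have : dir_variation w c f <= dir_variation w c f - eps.
  apply: ge_inf; first by have [] := bounded_set Hf.
  exists d => // s sf; rewrite leNgt; apply/negP => h; apply: Hn; exists s => //.
  exact: ltW.
by lra.
Qed.

Lemma dir_variation_le f t d : H f -> 0 < d ->
  (forall s, near_dir w c f d s -> L s <= t) -> dir_variation w c f <= t.
Proof.
by move=> Hf d0 dt; apply: ge_inf; [have [] := bounded_set Hf|exists d].
Qed.

Lemma dir_variation_ge f t : H f ->
  (forall d, 0 < d -> exists2 s, near_dir w c f d s & t <= L s) -> t <= dir_variation w c f.
Proof.
move=> Hf Ht; apply/ler_addgt0Pr => eps eps0.
have [d d0 dP] := dir_variation_ub Hf eps0.
by have [s sf ts] := Ht d d0; exact: le_trans ts (dP s sf).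
Qed.

Lemma dir_variation_ge0 f : H f -> 0 <= dir_variation w c f.
Proof.
move=> Hf; apply: dir_variation_ge => // d d0; exists [::]; last by rewrite /field_div big_nil.
by apply: near_nil => //; case: Hf.
Qed.

Let HD f1 f2 : H f1 -> H f2 -> H (fun x => f1 x + f2 x).
Proof. exact: nonneg_inD (ucyl_lattice ip_inner e_on) _ _. Qed.

Lemma dir_variation_superadditive f1 f2 : H f1 -> H f2 ->
  dir_variation w c f1 + dir_variation w c f2 <= dir_variation w c (fun x => f1 x + f2 x).
Proof.
move=> H1 H2; apply/ler_addgt0Pr => eps eps0; rewrite -lerBlDr.
have e2 : 0 < eps / 2 by lra.
apply: dir_variation_ge; first exact: HD.
move=> d d0; have d2 : 0 < d / 2 by lra.
have [s1 n1 l1] := dir_variation_adherent H1 e2 d2.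
have [s2 n2 l2] := dir_variation_adherent H2 e2 d2.
exists (s1 ++ s2); last by rewrite field_div_cat; lra.
move=> x; rewrite field_val_cat scalerDl opprD addrACA.
rewrite (le_trans (ler_normD _ _))//; have := n1 x; have := n2 x; lra.
Qed.

(* The multipliers [h_i / (h_1 + h_2 + d)], with [h_i] smooth and close to [f_i] from
   above, split a field near [(f_1 + f_2) Rop w] into fields near [f_1 Rop w] and [f_2 Rop w]. *)
Lemma dir_variation_subadditive f1 f2 : H f1 -> H f2 ->
  dir_variation w c (fun x => f1 x + f2 x) <= dir_variation w c f1 + dir_variation w c f2.
Proof.
move=> H1 H2; apply/ler_addgt0Pr => eps eps0.
have e4 : 0 < eps / 4 by lra.
have [d1 d10 D1] := dir_variation_ub H1 e4.
have [d2 d20 D2] := dir_variation_ub H2 e4.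
pose k := c + `|Rop w|.
have k0 : 0 <= k by rewrite addr_ge0.
(* [K d] absorbs the errors [c d], [d] and three times [d] times the norm of [Rop w] that occur in
   [piece]. *)
pose K := 4 * k + 1.
have K0 : 0 < K by rewrite /K; lra.
(* The first two bounds bring the pieces within the tolerances [d1] and [d2]. The third bounds the
   contribution of the remainder [d F / q], whose norm is at most [(k + 1) d], by [eps / 4]. *)
pose d := Num.min (Num.min (d1 / K) (d2 / K)) (eps / 4 / ((k + 1) * (V + 1))).
have kV : 0 < (k + 1) * (V + 1) by rewrite mulr_gt0//; have := V_ge0; lra.
have d0 : 0 < d by rewrite !lt_min !divr_gt0.
have dK1 : K * d <= d1.
  by rewrite mulrC -ler_pdivlMr// !ge_min lexx.
have dK2 : K * d <= d2.
  by rewrite mulrC -ler_pdivlMr// !ge_min lexx orbT.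
have dV : (k + 1) * d * V <= eps / 4.
  have : d * ((k + 1) * (V + 1)) <= eps / 4 by rewrite -ler_pdivlMr// ge_min lexx orbT.
  have : 0 <= (k + 1) * d by rewrite mulr_ge0 ?(ltW d0)//; lra.
  have -> : d * ((k + 1) * (V + 1)) = (k + 1) * d * V + (k + 1) * d by ring.
  by lra.
have [s sf sP] := dir_variation_adherent (HD H1 H2) e4 d0.
have smooth_above f : H f -> exists h, (exists g, C1b ip h g) /\ forall x, f x <= h x <= f x + d.
  move=> [Hf _]; have d2' : 0 < d / 2 by lra.
  have [h [[g hg] _] fh] := Hf _ d2'.
  exists (fun x => h x + d / 2); split.
    by eexists; exact: (C1bD ip_inner hg (C1b_cst ip_inner (d / 2))).
  by move=> x; have := fh x; rewrite ler_norml => /andP[? ?]; apply/andP; split; lra.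
have [h1 [[g1 hg1] fh1]] := smooth_above f1 H1.
have [h2 [[g2 hg2] fh2]] := smooth_above f2 H2.
have [_ f10] := H1; have [_ f20] := H2.
pose q x := h1 x + h2 x + d.
have qd x : d <= q x.
  by have /andP[? ?] := fh1 x; have /andP[? ?] := fh2 x; have := f10 x; have := f20 x; rewrite /q; lra.
have qg := C1bV ip_inner d0 qd (C1bD ip_inner (C1bD ip_inner hg1 hg2) (C1b_cst ip_inner d)).
pose s1 := field_mul ip_inner (C1bM ip_inner hg1 qg) s.
pose s2 := field_mul ip_inner (C1bM ip_inner hg2 qg) s.
(* With [r = h / (h + h' + d)] one has [f - 3 d <= r (f + f') <= f + d], so multiplying by [r]
   carries the constraint for [f + f'] to the one for [f] up to a multiple of [d]. *)
have piece (f f' h h' : R) (y : X) : 0 <= f -> 0 <= f' -> f <= h <= f + d -> f' <= h' <= f' + d ->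
    `|y - (f + f') *: Rop w| <= c * (f + f') + d ->
    `|(h * (h + h' + d)^-1) *: y - f *: Rop w| <= c * f + K * d.
  move=> f0 f0' /andP[a1 a2] /andP[b1 b2] yf.
  set r := h * _; have Q0 : 0 < h + h' + d by lra.
  have rE : r * (h + h' + d) = h by rewrite /r mulfVK// gt_eqF.
  have r0 : 0 <= r by rewrite mulr_ge0 ?invr_ge0//; lra.
  have r1 : r <= 1 by rewrite ler_pdivrMr//; lra.
  clearbody r.
  have rf : r * (f + f') <= f + d.
    have : 0 <= r * ((h + h' + d) - (f + f')) by rewrite mulr_ge0//; lra.
    rewrite mulrBr rE; lra.
  have rf' : f - 3 * d <= r * (f + f').
    have : 0 <= r * (f + f' + 3 * d - (h + h' + d)) by rewrite mulr_ge0//; lra.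
    rewrite mulrBr rE mulrDr => h3.
    have : r * (3 * d) <= 3 * d by rewrite ler_piMl//; lra.
    lra.
  have -> : r *: y - f *: Rop w = r *: (y - (f + f') *: Rop w) + (r * (f + f') - f) *: Rop w.
    by rewrite scalerBr scalerA scalerBl addrA subrK.
  rewrite (le_trans (ler_normD _ _))// !normrZ (ger0_norm r0).
  have t1 : r * `|y - (f + f') *: Rop w| <= r * (c * (f + f') + d) by rewrite ler_wpM2l.
  have t2 : `|r * (f + f') - f| <= 3 * d by rewrite ler_norml; apply/andP; split; lra.
  have t3 : `|r * (f + f') - f| * `|Rop w| <= 3 * d * `|Rop w| by rewrite ler_wpM2r.
  have t4 : c * (r * (f + f')) <= c * (f + d) by rewrite ler_wpM2l.
  have t5 : r * d <= d by rewrite ler_piMl// ltW.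
  have t6 : 0 <= `|Rop w| * d by rewrite mulr_ge0// ltW.
  have t7 : 0 <= c * d by rewrite mulr_ge0// ltW.
  have E1 : r * (c * (f + f') + d) = c * (r * (f + f')) + r * d by ring.
  have E2 : K * d = 4 * (c * d) + 4 * (`|Rop w| * d) + d by rewrite /K /k; ring.
  have E3 : 3 * d * `|Rop w| = 3 * (`|Rop w| * d) by ring.
  apply: (le_trans (lerD t1 t3)); rewrite E1 E2 E3; lra.
have n1 : near_dir w c f1 d1 s1.
  move=> x; rewrite field_val_mul.
  apply: (le_trans (piece (f1 x) (f2 x) (h1 x) (h2 x) (F s x) _ _ _ _ (sf x))) => //.
  by rewrite lerD2l.
have n2 : near_dir w c f2 d2 s2.
  move=> x; rewrite field_val_mul.
  have sf' := sf x; rewrite (addrC (f1 x)) in sf'.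
  have := piece _ _ _ _ _ (f20 x) (f10 x) (fh2 x) (fh1 x) sf'.
  by rewrite (addrC (h2 x)) => /le_trans; apply; rewrite lerD2l.
have : `|L s - L (s1 ++ s2)| <= (k + 1) * d * V.
  apply: (field_div_sub_le ip_inner u_int uv_int V_ub).
    by rewrite mulr_ge0 ?(ltW d0)//; lra.
  move=> x; rewrite field_val_cat !field_val_mul -scalerDl -[X in X - _]scale1r -scalerBl.
  have /andP[a1 a2] := fh1 x; have /andP[b1 b2] := fh2 x.
  have f1x := f10 x; have f2x := f20 x.
  have Q0 : 0 < q x by rewrite (lt_le_trans d0).
  have Q1 : f1 x + f2 x + d <= q x by rewrite /q; lra.
  have -> : 1 - (h1 x * (q x)^-1 + h2 x * (q x)^-1) = d / q x.
    by rewrite /q; field; rewrite gt_eqF.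
  rewrite normrZ ger0_norm; last by rewrite divr_ge0// ltW.
  rewrite mulrAC ler_pdivrMr//.
  have f0 : 0 <= f1 x + f2 x by rewrite addr_ge0.
  have := field_norm_le (f := fun x => f1 x + f2 x) f0 sf; rewrite -/k => Fk.
  have : d * `|F s x| <= d * (k * (f1 x + f2 x) + d) by rewrite ler_wpM2l// ltW.
  have : (k + 1) * d * (f1 x + f2 x + d) <= (k + 1) * d * q x.
    by rewrite ler_wpM2l// mulr_ge0 ?(ltW d0)//; lra.
  have : 0 <= k * (d * d) by rewrite mulr_ge0// mulr_ge0// ltW.
  have : 0 <= d * (f1 x + f2 x) by rewrite mulr_ge0// ltW.
  by lra.
rewrite field_div_cat ler_norml => /andP[_].
have := D1 _ n1; have := D2 _ n2; lra.
Qed.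

(** Competitors are uniformly bounded by [K], so tightness replaces them by weighted ones. On a
    large ball Dini's theorem makes [f m], hence the field, small; outside it the weight does. *)
Lemma dir_variation_cvg0 (f : nat -> X -> R) : (forall n, H (f n)) ->
  (forall x m n, (m <= n)%N -> f n x <= f m x) ->
  (forall x eps, 0 < eps -> exists n, f n x <= eps) ->
  forall eps, 0 < eps -> exists n, dir_variation w c (f n) <= eps.
Proof.
move=> Hf fm f0 eps eps0.
have V1 : 0 < V + 1 by have := V_ge0; lra.
have [M0 M00 fM0] := ucyl_bounded (Hf 0%N).1.
pose k := c + `|Rop w|.
have k0 : 0 <= k by rewrite addr_ge0.
pose K := k * M0 + 1.
have K0 : 0 < K by rewrite ltr_wpDl// mulr_ge0// ltW.
pose eta := eps / 2 / (V + 1).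
have eta0 : 0 < eta by rewrite !divr_gt0.
have e2K : 0 < eps / 2 / K by rewrite !divr_gt0.
have [n tight] := field_div_truncate ip_inner u_int uv_int V_ub V_approx e2K.
set a := n.+1%:R^-1 in tight; have a0 : 0 < a by rewrite invr_gt0.
(* The radius at which [eta a rho^2 = K]: beyond it the weight times [K] is below [eta]. *)
pose rho := Num.sqrt (K / eta / a).
have rho2 : rho ^+ 2 = K / eta / a by rewrite sqr_sqrtr// !divr_ge0// ltW.
have eta1 : 0 < eta / 2 / (k + 1) by rewrite !divr_gt0//; lra.
have [m fmball] := ucyl_dini ip_inner e_on (sqrtr_ge0 (K / eta / a)) eta1
  (fun n => (Hf n).1) fm f0.
exists m; pose d := Num.min 1 (eta / 2).
have d0 : 0 < d by rewrite lt_min ltr01 divr_gt0.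
have d1 : d <= 1 by rewrite ge_min lexx.
have d2 : d <= eta / 2 by rewrite ge_min lexx orbT.
apply: (dir_variation_le (Hf m) d0) => s sf.
have fmM x : f m x <= M0.
  by rewrite (le_trans (fm x 0%N m (leq0n m)))// (le_trans (ler_norm _) (fM0 x)).
have f_0 x : 0 <= f m x by have [_] := Hf m.
have Fs x := field_norm_le (f_0 x) sf.
have FK x : `|F s x| <= K.
  rewrite (le_trans (Fs x))// lerD//; rewrite ler_wpM2l//.
have [s' [s'E s'L]] := tight s K K0 FK.
apply: (le_trans s'L).
have -> : K * (eps / 2 / K) = eps / 2 by field; rewrite gt_eqF.
suff : L s' <= eta * V.
  have : eta * V <= eps / 2.
    by rewrite /eta -mulrA ler_piMr ?divr_ge0 ?(ltW eps0)// ler_pdivrMl// mulr1; lra.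
  lra.
apply: (field_div_le ip_inner u_int uv_int V_ub); first exact: ltW.
move=> x; rewrite s'E normrZ.
have w0 := weight_gt0 x a0; have w1 := weight_le1 x a0.
rewrite (gtr0_norm w0).
have [xr|xr] := leP `|x| rho.
  have : `|F s x| <= eta.
    rewrite (le_trans (Fs x))//.
    have : k * f m x <= k * (eta / 2 / (k + 1)) by rewrite ler_wpM2l// fmball.
    have kk : k / (k + 1) <= 1 by rewrite ler_pdivrMr ?mul1r; lra.
    have : k * (eta / 2 / (k + 1)) <= eta / 2.
      by rewrite mulrCA ler_piMr//; lra.
    rewrite -/k; lra.
  by apply: le_trans; rewrite ler_piMl// ltW.
rewrite (le_trans (ler_wpM2l (ltW w0) (FK x)))//.
rewrite /weight mulrC ler_pdivrMr; last by have := weight_den x a0; lra.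
have xr2 : rho ^+ 2 <= `|x| ^+ 2 by rewrite lerXn2r ?nnegrE ?sqrtr_ge0// ltW.
have : eta * (a * rho ^+ 2) <= eta * (a * `|x| ^+ 2) by rewrite !ler_wpM2l// ltW.
have -> : eta * (a * rho ^+ 2) = K by rewrite rho2; field; rewrite !gt_eqF.
by rewrite mulrDr mulr1; lra.
Qed.

Lemma dir_variation_daniell : daniell_functional (ucyl ip e) (dir_variation w c).
Proof.
split.
- move=> f g Hf Hg; apply/eqP; rewrite eq_le.
  by rewrite dir_variation_subadditive// dir_variation_superadditive.
- exact: dir_variation_ge0.
- exact: dir_variation_cvg0.
Qed.

End cone.

(** A competitor for [w] has norm at most [(c + |Rop w|) f + d], so its quotient by [k] competes for
    direction 0 with constant [c']. *)
Lemma dir_variation_mono w c c' k f : `|Rop w| <= c -> 0 <= c' -> 0 <= k ->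
  c + `|Rop w| <= k * c' -> nonneg_in (ucyl ip e) f ->
  dir_variation w c f <= k * dir_variation 0 c' f.
Proof.
move=> wc c'0 k0 kc Hf; apply/ler_addgt0Pr => eps eps0.
have zc : `|Rop 0| <= c' by rewrite linear0 normr0.
have k1 : 0 < k + 1 by lra.
have e1 : 0 < eps / (k + 1) by rewrite divr_gt0.
have [d d0 dP] := dir_variation_ub zc Hf e1.
have ke : k * (eps / (k + 1)) <= eps.
  by rewrite mulrCA ler_piMr ?(ltW eps0)// ler_pdivrMr// mul1r; lra.
have [_ f0] := Hf.
(* No division is possible when [k = 0], but then competitors are bounded by the slack alone. *)
move: k0; rewrite le_eqVlt => /orP[/eqP k0|k0].
  have V1 : 0 < V + 1 by have := V_ge0; lra.
  apply: (@dir_variation_le w c wc f _ (eps / (V + 1))) => //; first by rewrite divr_gt0.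
  move=> s sf; rewrite -k0 mul0r add0r.
  apply: (@le_trans _ _ (eps / (V + 1) * V)); last first.
    by rewrite -mulrA ler_piMr ?(ltW eps0)// ler_pdivrMl// mulr1; lra.
  apply: (field_div_le ip_inner u_int uv_int V_ub); first by rewrite divr_ge0// ltW.
  move=> x; rewrite (le_trans (field_norm_le (f0 x) sf))//.
  move: kc; rewrite -k0 mul0r => kc.
  have : (c + `|Rop w|) * f x <= 0 * f x by rewrite ler_wpM2r.
  lra.
apply: (@dir_variation_le w c wc f _ (k * d)) => //; first by rewrite mulr_gt0.
move=> s sf.
have : near_dir 0 c' f d (field_scale ip_inner k^-1 s).
  move=> x; rewrite linear0 scaler0 subr0 field_val_scale normrZ gtr0_norm ?invr_gt0//.
  rewrite ler_pdivrMl// (le_trans (field_norm_le (f0 x) sf))// mulrDr lerD2r mulrA.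
  by rewrite ler_wpM2r.
move=> /dP; rewrite (@field_div_scale _ _ _ ip_inner _ Rop _ _ u_int uv_int) ler_pdivrMl// mulrDr => h.
by rewrite (le_trans h)// lerD2l.
Qed.

(** For smooth [phi] the field [phi Rop w] is itself available, and adding or subtracting it
    exchanges the competitors for directions 0 and [w] with the same slack. *)
Lemma dir_variation_shift w c phi g : `|Rop w| <= c -> cylC1 ip e phi ->
  C1b ip phi g -> (forall x, 0 <= phi x) ->
  dir_variation w c phi = dir_variation 0 c phi + div_pairing ip nu Rop v u phi g w.
Proof.
move=> wc Cphi phig phi0.
have Hphi : nonneg_in (ucyl ip e) phi by split => //; exact: cylC1_ucyl.
have c0 : 0 <= c by exact: le_trans wc.
have zc : `|Rop 0| <= c by rewrite linear0 normr0.
pose t : field := [:: FieldTerm w phig].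
have tF x : F t x = phi x *: Rop w by rewrite /field_val big_seq1.
have tL : L t = div_pairing ip nu Rop v u phi g w by rewrite /field_div big_seq1.
apply/eqP; rewrite eq_le -tL; apply/andP; split.
  apply/ler_addgt0Pr => eps eps0.
  have [d d0 dP] := dir_variation_ub zc Hphi eps0.
  apply: (dir_variation_le wc Hphi d0) => s sf.
  have : near_dir 0 c phi d (s ++ field_scale ip_inner (-1) t).
    move=> x; rewrite linear0 scaler0 subr0 field_val_cat field_val_scale scaleN1r tF.
    exact: sf.
  move=> /dP; rewrite field_div_cat (@field_div_scale _ _ _ ip_inner _ Rop _ _ u_int uv_int) mulN1r; lra.
apply/ler_addgt0Pr => eps eps0.
have [d d0 dP] := dir_variation_ub wc Hphi eps0.
rewrite -lerBrDr; apply: (dir_variation_le zc Hphi d0) => s sf.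
have : near_dir w c phi d (s ++ t).
  move=> x; rewrite field_val_cat tF addrK.
  by have := sf x; rewrite linear0 scaler0 subr0.
move=> /dP; rewrite field_div_cat; lra.
Qed.

Lemma dir_variation_total : dir_variation 0 1 (fun=> 1) <= V.
Proof.
apply/ler_addgt0Pr => eps eps0.
have V1 : 0 < V + 1 by have := V_ge0; lra.
have zc : `|Rop 0| <= 1 by rewrite linear0 normr0.
have H1 : nonneg_in (ucyl ip e) (fun=> 1).
  by split => //; exact: ucyl_cst.
have d0 : 0 < eps / (V + 1) by rewrite divr_gt0.
apply: (dir_variation_le zc H1 d0) => s sf.
apply: (@le_trans _ _ ((1 + eps / (V + 1)) * V)); last first.
  rewrite mulrDl mul1r lerD2l -mulrA ler_piMr ?(ltW eps0)// ler_pdivrMl// mulr1; lra.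
apply: (field_div_le ip_inner u_int uv_int V_ub).
  by rewrite addr_ge0// ltW.
move=> x; have := field_norm_le (f := fun=> 1) ler01 sf.
by rewrite linear0 normr0 addr0 mul1r; apply.
Qed.

End variation_functional.

(** * Construction of the vector measure *)

Section finite_measure_tail.
Context d (T : measurableType d) (R : realType) (k : {finite_measure set T -> \bar R}).
Variable B : nat -> set T.
Hypotheses (mB : forall n, measurable (B n)) (tB : trivIset setT B).

Lemma fine_measure_tail n : fine (k (\bigcup_i B i)) =
  \sum_(i < n) fine (k (B i)) + fine (k (\bigcup_i B (n + i)%N)).
Proof.
have mT : measurable (\bigcup_i B (n + i)%N) by exact: bigcupT_measurable.
have mU : measurable (\big[setU/set0]_(i < n) B i) by apply: bigsetU_measurable.
rewrite (bigcup_splitn n) measureU//; last first.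
  apply/seteqP; split => // x [].
  rewrite -bigcup_mkord => -[i /= ni Bi] [j _ Bj].
  have /trivIsetP/(_ i (n + j)%N Logic.I Logic.I) := tB.
  have ij : i != (n + j)%N by rewrite neq_ltn ltn_addr.
  by move=> /(_ ij) E; have : (B i `&` B (n + j)%N) x by []; rewrite E.
rewrite fineD ?fin_num_measure//; congr (_ + _).
rewrite (@measure_bigsetU_ord _ _ _ k n predT (fun i : 'I_n => B i))//; last first.
  apply/trivIsetP => i j _ _ ij; have /trivIsetP := tB; apply => //.
rewrite [in RHS](eq_bigr (fun i : 'I_n => fine (k (B i))))//.
by rewrite -sum_fine// => i _; rewrite fin_num_measure.
Qed.

Lemma fine_measure_tail_cvg0 : (fun n => fine (k (\bigcup_i B (n + i)%N))) @ \oo --> 0.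
Proof.
have mU : measurable (\bigcup_i B i) by exact: bigcupT_measurable.
have H : (fun n => \sum_(i < n) fine (k (B i))) @ \oo --> fine (k (\bigcup_i B i)).
  have H0 : (fun n => \sum_(0 <= i < n) k (B i))%E @ \oo --> (fine (k (\bigcup_i B i)))%:E.
    by rewrite fineK ?fin_num_measure//; exact: measure_semi_sigma_additive.
  rewrite (_ : (fun n => _) = fine \o (fun n => \sum_(0 <= i < n) k (B i))%E).
    exact: fine_cvg.
  apply/funext => n /=; rewrite big_mkord -?sum_fine// => i _.
  by rewrite fin_num_measure.
rewrite (_ : (fun n => _) = fun n => fine (k (\bigcup_i B i)) - \sum_(i < n) fine (k (B i))).
  by rewrite -[X in _ --> X](subrr (fine (k (\bigcup_i B i)))); apply: cvgB => //; exact: cvg_cst.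
by apply/funext => n; rewrite (fine_measure_tail n) addrC addKr.
Qed.

End finite_measure_tail.

(** * Determination of measures by cylindrical functions *)

Section cylindrical_uniqueness.
Context {R : realType} {X : completeNormedModType R}.
Variable ip : X -> X -> R.
Hypothesis ip_inner : is_inner_product ip.
Variable e : nat -> X.
Hypothesis e_on : orthonormal_seq ip e.
Hypothesis X_sep : separable_space (X := X).
Local Notation BX := (borel_of X).
Implicit Types m n k : {finite_measure set BX -> \bar R}.

Let ucyl_bound f : ucyl ip e f -> exists M, forall x, `|f x| <= M.
Proof. by move=> /ucyl_bounded[M _ fM]; exists M. Qed.

Lemma ucyl_daniell_measure I : daniell_functional (ucyl ip e) I ->
  exists m, (forall A, m A = daniell_outer (ucyl ip e) I A) /\
    forall f, nonneg_in (ucyl ip e) f -> \int[m]_x f x = I f.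
Proof.
apply: daniell_measure_exists.
- exact: ucyl_lattice.
- by move=> f; exact: ucyl_continuous.
- exact: ucyl_bound.
- exact: open_ucyl_generated.
Qed.

(** A nonnegative uniform limit [f] is approximated from above by [h + d], which is cylindrical and
    still nonnegative; each integral moves by at most [2 d] times the total mass. *)
Lemma cylC1_measure_ext m n :
  (forall f, cylC1 ip e f -> (forall x, 0 <= f x) -> \int[m]_x f x = \int[n]_x f x) ->
  forall A : set BX, measurable A -> m A = n A.
Proof.
move=> mn; apply: (finite_measure_ext (ucyl_lattice ip_inner e_on)).
- by move=> f; exact: ucyl_continuous.
- exact: open_ucyl_generated.
move=> f [Hf f0]; apply/eqP; rewrite -subr_eq0 -normr_le0; apply/ler_addgt0Pr => eps eps0.
rewrite add0r.
pose C := fine (m setT) + fine (n setT).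
have C0 : 0 <= C by rewrite addr_ge0// fine_ge0.
pose d := eps / 2 / (C + 1).
have d0 : 0 < d by rewrite !divr_gt0//; lra.
have [h Ch fh] := Hf d d0.
have Chd : cylC1 ip e (fun x => h x + d) by apply: cylC1D => //; exact: cylC1_cst.
have fh' x : f x <= h x + d <= f x + 2 * d.
  by have := fh x; rewrite ler_norml => /andP[? ?]; apply/andP; split; lra.
have [M _ fM] := ucyl_bounded Hf.
have mf : measurable_fun [set: BX] f by apply: continuous_borel; exact: ucyl_continuous Hf.
have mh : measurable_fun [set: BX] (fun x => h x + d).
  by apply: continuous_borel; have [[g /C1b_continuous]] := Chd.
have diff k : \int[k]_x f x <= \int[k]_x (h x + d) <= \int[k]_x f x + 2 * d * fine (k setT).
  have i1 : k.-integrable setT (EFin \o f) by exact: (bounded_integrable _ mf fM).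
  have i2 : k.-integrable setT (EFin \o (fun x => h x + d)).
    apply: (@bounded_integrable _ _ _ _ _ (M + 2 * d)) => // x.
    have /andP[? ?] := fh' x; have := fM x; rewrite !ger0_norm//; last first.
      by rewrite (le_trans (f0 x)).
    lra.
  have i3 : k.-integrable setT (EFin \o (fun=> 2 * d : R)).
    by apply: (@bounded_integrable _ _ _ _ _ (`|2 * d|)).
  apply/andP; split; first by apply: le_Rintegral => // x _; have /andP[] := fh' x.
  rewrite -(Rintegral_cst k measurableT) -RintegralD//.
  apply: le_Rintegral => //; last by move=> x _; have /andP[] := fh' x.
  by have := integrableD measurableT i1 i3.
have E : \int[m]_x (h x + d) = \int[n]_x (h x + d).
  by apply: mn => // x; have /andP[? _] := fh' x; exact: le_trans (f0 x) _.
have := diff m; have := diff n; rewrite E => /andP[a1 a2] /andP[b1 b2].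
have dC : 2 * d * C <= eps.
  have -> : 2 * d * C = eps * (C / (C + 1)) by rewrite /d; field; rewrite gt_eqF//; lra.
  by rewrite ler_piMr ?(ltW eps0)// ler_pdivrMr ?mul1r; lra.
have m0 : 0 <= fine (m setT) by rewrite fine_ge0.
have n0 : 0 <= fine (n setT) by rewrite fine_ge0.
have E1 : 2 * d * C = 2 * d * fine (m setT) + 2 * d * fine (n setT) by rewrite /C mulrDr.
have E2 : 0 <= 2 * d * fine (m setT) by apply: mulr_ge0 => //; lra.
have E3 : 0 <= 2 * d * fine (n setT) by apply: mulr_ge0 => //; lra.
by rewrite ler_norml; apply/andP; split; lra.
Qed.

(** Moving the subtracted terms across gives an identity between the positive measures [m1 + n2] and
    [n1 + m2]. *)
Lemma cylC1_difference_ext m1 m2 n1 n2 :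
  (forall f, cylC1 ip e f -> (forall x, 0 <= f x) ->
    \int[m1]_x f x - \int[m2]_x f x = \int[n1]_x f x - \int[n2]_x f x) ->
  forall A : set BX, measurable A -> fine (m1 A) - fine (m2 A) = fine (n1 A) - fine (n2 A).
Proof.
move=> H A mA.
have [k [kA kf]] := finite_measure_add m1 n2.
have [l [lA lf]] := finite_measure_add n1 m2.
have : k A = l A.
  apply: cylC1_measure_ext => // f Cf f0.
  have [[g /[dup] fg /C1b_continuous/continuous_borel mf]] := Cf.
  have [M _ fM] := C1b_bounded fg.
  have fM' x : `|f x| <= M by have [] := fM x.
  by rewrite (kf f M)// (lf f M)//; have := H f Cf f0; lra.
rewrite kA lA => /(congr1 fine); rewrite !fineD ?fin_num_measure//; lra.
Qed.

End cylindrical_uniqueness.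

(** * From scalar measures to the vector measure *)

Section construction.
Context {R : realType} {X : completeNormedModType R}.
Variable ip : X -> X -> R.
Hypothesis ip_inner : is_inner_product ip.
Variable e : nat -> X.
Hypothesis e_on : orthonormal_seq ip e.
Hypothesis X_sep : separable_space (X := X).
Local Notation BX := (borel_of X).
Variables (nu : probability BX R) (Rop : {linear X -> X}) (v : X -> X -> R) (u : X -> R).
Hypothesis u_int : nu.-integrable setT (EFin \o u).
Hypothesis uv_int : forall z, nu.-integrable setT (fun x => (u x * v z x)%:E).
Hypothesis Rop_sym : forall x y, ip (Rop x) y = ip x (Rop y).
Hypothesis Rop_inj : injective Rop.
Variable ew : nat -> X.
Hypothesis ew_e : forall k, Rop (ew k) = e k.
Local Notation field := (seq (field_term ip)).
Local Notation F := (field_val Rop).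
Local Notation L := (field_div nu Rop v u).
Local Notation pairing := (div_pairing ip nu Rop v u).
Variable V : R.
Hypothesis V_ub : forall s : field, (forall x, `|F s x| <= 1) -> L s <= V.
Hypothesis V_approx : forall eps, 0 < eps -> exists s : field,
  (forall x, `|F s x| <= 1) /\ V - eps <= L s.

Local Notation P := (dir_variation ip nu Rop v u).
Local Notation D := (daniell_outer (ucyl ip e)).

Let P_daniell w c : `|Rop w| <= c -> daniell_functional (ucyl ip e) (P w c).
Proof. exact: (dir_variation_daniell ip_inner e_on u_int uv_int V_ub V_approx). Qed.

Let P_mono w c c' k f : `|Rop w| <= c -> 0 <= c' -> 0 <= k ->
  c + `|Rop w| <= k * c' -> nonneg_in (ucyl ip e) f -> P w c f <= k * P 0 c' f.
Proof. exact: (dir_variation_mono ip_inner u_int uv_int V_ub). Qed.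

Let Rop0_le c : 0 <= c -> `|Rop 0| <= c. Proof. by rewrite linear0 normr0. Qed.

(** Linearity in the direction is not read off from [v]; it holds because both sides pair [u] with
    presentations of the same field. *)
Lemma pairing_comb a w w' phi g : C1b ip phi g ->
  pairing phi g (a *: w + w') = a * pairing phi g w + pairing phi g w'.
Proof.
move=> phig.
have := field_div_ext ip_inner u_int uv_int V_ub
  (s1 := [:: FieldTerm (a *: w + w') phig])
  (s2 := field_scale ip_inner a [:: FieldTerm w phig] ++ [:: FieldTerm w' phig]).
rewrite field_div_cat (field_div_scale ip_inner Rop u_int uv_int).
rewrite /field_div !big_seq1; apply => x.
rewrite field_val_cat field_val_scale /field_val !big_seq1/=.
by rewrite linearP scalerDr !scalerA mulrC.
Qed.

Lemma variation_measures_exist : exists (mu : {finite_measure set BX -> \bar R})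
    (M N : X -> {finite_measure set BX -> \bar R}),
  [/\ fine (mu setT) <= V,
      forall w A, measurable A ->
        `|fine (M w A) - fine (N w A)| <= `|Rop w| * fine (mu A) &
      forall w phi g, cylC1 ip e phi -> C1b ip phi g -> (forall x, 0 <= phi x) ->
        \int[M w]_x phi x - \int[N w]_x phi x = pairing phi g w].
Proof.
have [mu [muA muf]] := ucyl_daniell_measure ip_inner e_on X_sep (P_daniell (Rop0_le ler01)).
have /choice[M MP] w := ucyl_daniell_measure ip_inner e_on X_sep (P_daniell (lexx `|Rop w|)).
have /choice[N NP] w :=
  ucyl_daniell_measure ip_inner e_on X_sep (P_daniell (Rop0_le (normr_ge0 (Rop w)))).
have lat := ucyl_lattice ip_inner e_on.
exists mu, M, N; split.
- rewrite muA (daniell_outerT lat (P_daniell (Rop0_le ler01)))/=.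
  exact: (dir_variation_total ip_inner e u_int uv_int V_ub).
- move=> w A mA.
  have NA : fine (N w A) <= `|Rop w| * fine (mu A).
    rewrite -lee_fin EFinM !fineK ?fin_num_measure//.
    rewrite (proj1 (NP w)) muA; apply: daniell_outer_mono => //.
    + exact: P_daniell (Rop0_le (normr_ge0 _)).
    + exact: P_daniell (Rop0_le ler01).
    + move=> f Hf; apply: P_mono => //; first exact: Rop0_le.
      by rewrite linear0 normr0 addr0 mulr1.
  (* Together with [M w A >= 0] this gives [|M w A - N w A| <= N w A], without loss of a
     constant. *)
  have MN : fine (M w A) <= 2 * fine (N w A).
    rewrite -lee_fin EFinM !fineK ?fin_num_measure//.
    rewrite (proj1 (NP w)) (proj1 (MP w)); apply: daniell_outer_mono => //.
    + exact: P_daniell (lexx _).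
    + exact: P_daniell (Rop0_le (normr_ge0 _)).
    + move=> f Hf; apply: P_mono => //.
      by rewrite mulr_natl mulr2n.
  have M0 : 0 <= fine (M w A) by rewrite fine_ge0.
  have N0 : 0 <= fine (N w A) by rewrite fine_ge0.
  by rewrite ler_norml; apply/andP; split; lra.
- move=> w phi g Cphi phig phi0.
  have Hphi : nonneg_in (ucyl ip e) phi by split => //; exact: cylC1_ucyl.
  rewrite (proj2 (MP w) _ Hphi) (proj2 (NP w) _ Hphi).
  rewrite (dir_variation_shift ip_inner u_int uv_int V_ub (lexx _) Cphi phig phi0).
  by rewrite addrC addKr.
Qed.

Variables (mu : {finite_measure set BX -> \bar R}) (M N : X -> {finite_measure set BX -> \bar R}).
Hypothesis mu_total : fine (mu setT) <= V.
Hypothesis MN_le : forall w A, measurable A ->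
  `|fine (M w A) - fine (N w A)| <= `|Rop w| * fine (mu A).
Hypothesis MN_pairing : forall w phi g, cylC1 ip e phi -> C1b ip phi g ->
  (forall x, 0 <= phi x) -> \int[M w]_x phi x - \int[N w]_x phi x = pairing phi g w.

Let m w A : R := fine (M w A) - fine (N w A).

Lemma difference_comb a w w' A : measurable A -> m (a *: w + w') A = a * m w A + m w' A.
Proof.
move=> mA; have [k1 [k2 [kA kf]]] := measure_difference_comb a (M w) (N w) (M w') (N w').
rewrite -kA//; apply: (cylC1_difference_ext ip_inner e_on X_sep) => // f Cf f0.
have [[g fg] _] := Cf; have [C _ fC] := C1b_bounded fg.
rewrite (kf f C); last 2 first.
- by apply: continuous_borel; exact: C1b_continuous fg.
- by move=> x; rewrite f0/= (le_trans (ler_norm _))//; have [] := fC x.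
by rewrite !(@MN_pairing _ f g)// pairing_comb.
Qed.

Lemma difference_dir0 A : measurable A -> m 0 A = 0.
Proof.
move=> mA; apply/eqP; rewrite -normr_le0 (le_trans (MN_le 0 mA))//.
by rewrite linear0 normr0 mul0r.
Qed.

Lemma difference_sum n (a : nat -> R) (w : nat -> X) A : measurable A ->
  m (\sum_(0 <= k < n) a k *: w k) A = \sum_(0 <= k < n) a k * m (w k) A.
Proof.
move=> mA; elim: n => [|n ih]; first by rewrite !big_nil difference_dir0.
by rewrite !big_nat_recr//= addrC difference_comb// ih addrC.
Qed.

(** Let [S] be a partial sum of the squares of the prospective coordinates. Testing [m] on the
    matching combination of the [ew k] gives [S <= S^(1/2) mu A], hence square summability with the
    right bound. The formula extends to all [w] because finite sections of [Rop w] lie in the range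
    of [Rop]. *)
Lemma density_vector_exists A : measurable A ->
  exists x, `|x| <= fine (mu A) /\ forall w, ip x (Rop w) = m w A.
Proof.
move=> mA; pose a k := m (ew k) A.
have muA : 0 <= fine (mu A) by rewrite fine_ge0.
have ae k : e k = 0 -> a k = 0.
  move=> ek; apply/eqP; rewrite -normr_le0 (le_trans (MN_le _ mA))//.
  by rewrite ew_e ek normr0 mul0r.
have am n : \sum_(0 <= k < n) a k ^+ 2 <= fine (mu A) ^+ 2.
  set S := \sum_(0 <= k < n) _.
  have S0 : 0 <= S by apply: sumr_ge0 => k _; exact: sqr_ge0.
  have : m (\sum_(0 <= k < n) a k *: ew k) A = S.
    by rewrite difference_sum//; apply: eq_bigr => k _; rewrite expr2.
  have zS : `|Rop (\sum_(0 <= k < n) a k *: ew k)| ^+ 2 = S.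
    rewrite linear_sum /S -(norm_comb ip_inner e_on 0 n ae).
    by congr (`|_| ^+ 2); apply: eq_bigr => k _; rewrite linearZ/= ew_e.
  have := MN_le (\sum_(0 <= k < n) a k *: ew k) mA; rewrite -/(m _ A).
  set z := `|Rop _| in zS *; move=> + mS; rewrite mS (ger0_norm S0) => Sz.
  have z0 : 0 <= z by exact: normr_ge0.
  move: z0; rewrite le_eqVlt => /orP[/eqP z0|z0].
    by rewrite -zS -z0 expr0n sqr_ge0.
  have zm : z <= fine (mu A).
    by rewrite -(ler_pM2l z0) -expr2 zS.
  by rewrite -zS lerXn2r// nnegrE// ltW.
have [x [xe xmu xa]] := riesz_fischer ip_inner e_on muA ae am.
exists x; split => // w; apply/eqP; rewrite -subr_eq0 -normr_le0.
have pc := @proj_cvg _ _ _ ip_inner _ e_on (Rop w).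
have bound n : `|ip x (Rop w) - m w A| <= (fine (mu A) + `|x|) * `|Rop w - proj ip e n (Rop w)|.
  pose z := \sum_(0 <= k < n) ip (Rop w) (e k) *: ew k.
  have Rz : Rop z = proj ip e n (Rop w).
    by rewrite linear_sum; apply: eq_bigr => k _; rewrite linearZ/= ew_e.
  have mz : m z A = ip x (proj ip e n (Rop w)).
    rewrite difference_sum// /proj (ip_sumr ip_inner).
    by apply: eq_bigr => k _; rewrite (ipZr ip_inner) xe.
  have mwz : m w A - m z A = m (w - z) A.
    have -> : w - z = (-1) *: z + w by rewrite scaleN1r addrC.
    by rewrite difference_comb// mulN1r addrC.
  have -> : ip x (Rop w) - m w A =
      ip x (Rop w - proj ip e n (Rop w)) - (m w A - m z A).
    by rewrite (ipBr ip_inner) mz; lra.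
  rewrite (le_trans (ler_normB _ _))// mulrDl addrC lerD//.
    rewrite mwz (le_trans (MN_le _ mA))// linearB/= Rz mulrC//.
  exact: cauchy_schwarz.
have : (fun n => (fine (mu A) + `|x|) * `|Rop w - proj ip e n (Rop w)|) @ \oo --> 0.
  rewrite -[X in _ --> X](mulr0 (fine (mu A) + `|x|)); apply: cvgM; first exact: cvg_cst.
  rewrite -(normr0 X) -[in X in _ --> X](subrr (Rop w)); apply: cvg_norm.
  by apply: cvgB => //; exact: cvg_cst.
by move=> /cvgr_to_ge; apply; exact: nearW.
Qed.

(** Adding a constant removes the sign condition on cylindrical functions. A general [phi] is the
    bounded pointwise limit of its compositions with the projections, whose gradients converge
    boundedly as well. *)
Lemma pairing_repr w phi g : C1b ip phi g ->
  \int[M w]_x phi x - \int[N w]_x phi x = pairing phi g w.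
Proof.
move=> phig.
have cyl_repr f h : cylC1 ip e f -> C1b ip f h ->
    \int[M w]_x f x - \int[N w]_x f x = pairing f h w.
  move=> Cf fh; have [C C0 fC] := C1b_bounded fh.
  have CC := C1b_cst ip_inner C.
  have := MN_pairing w (cylC1D ip_inner e_on Cf (cylC1_cst ip_inner e C)) (C1bD ip_inner fh CC).
  have := MN_pairing w (cylC1_cst ip_inner e C) CC.
  rewrite (@div_pairingD _ _ _ ip_inner _ _ _ _ u_int uv_int _ _ _ _ w fh CC).
  have mf : measurable_fun [set: BX] f by apply: continuous_borel; exact: C1b_continuous fh.
  have fC' x : `|f x| <= C by have [] := fC x.
  have iC (k : {finite_measure set BX -> \bar R}) :
      k.-integrable setT (EFin \o (fun=> C)).
    by apply: (@bounded_integrable _ _ _ _ _ (`|C|)).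
  have if_ (k : {finite_measure set BX -> \bar R}) : k.-integrable setT (EFin \o f).
    exact: (bounded_integrable _ mf fC').
  have split_ (k : {finite_measure set BX -> \bar R}) :
    \int[k]_x (f x + C) = \int[k]_x f x + \int[k]_x C by apply: RintegralD => //; [exact: if_|exact: iC].
  rewrite !split_.
  move=> /(_ (fun=> ltW C0)) h1 h2.
  have : forall x, 0 <= f x + C by move=> x; have := fC' x; rewrite ler_norml => /andP[]; lra.
  by move=> /h2; lra.
have [C C0 phiC] := C1b_bounded phig.
have /C1bP[_ cg _ _] := phig; have cphi := C1b_continuous phig.
have pc := @proj_cvg _ _ _ ip_inner _ e_on.
have phi_cvg x : (fun n => phi (proj ip e n x)) @ \oo --> phi x.
  by apply: (cvg_comp _ _ (@pc x)); exact: cphi.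
have g_cvg x : (fun n => proj ip e n (g (proj ip e n x))) @ \oo --> g x.
  apply/cvgrPdist_le => eps eps0; have e2 : 0 < eps / 2 by lra.
  have /cvgrPdist_le/(_ _ e2) c1 : (fun n => g (proj ip e n x)) @ \oo --> g x.
    by apply: (cvg_comp _ _ (@pc x)); exact: cg.
  have /cvgrPdist_le/(_ _ e2) c2 := @pc (g x).
  near=> n.
  have -> : g x - proj ip e n (g (proj ip e n x)) =
      (g x - proj ip e n (g x)) + proj ip e n (g x - g (proj ip e n x)).
    by rewrite projB// addrA subrK.
  rewrite (le_trans (ler_normD _ _))// (splitr eps) lerD//; first by near: n.
  by rewrite (le_trans (norm_proj_le ip_inner e_on _ _))//; near: n.
have conv (k : {finite_measure set BX -> \bar R}) :
    (fun n => \int[k]_x phi (proj ip e n x)) @ \oo --> \int[k]_x phi x.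
  apply: (@Rintegral_cvg_dominated _ _ _ k _ _ (fun=> C)) => //.
  - move=> n; apply: continuous_borel; exact: C1b_continuous (C1b_proj ip_inner e_on n phig).
  - exact: continuous_borel.
  - by apply: (@bounded_integrable _ _ _ _ _ (`|C|)).
  - by move=> n x; have [] := phiC (proj ip e n x).
have lhs : (fun n => \int[M w]_x phi (proj ip e n x) - \int[N w]_x phi (proj ip e n x)) @ \oo
    --> \int[M w]_x phi x - \int[N w]_x phi x by apply: cvgB; exact: conv.
have rhs : (fun n => \int[M w]_x phi (proj ip e n x) - \int[N w]_x phi (proj ip e n x)) @ \oo
    --> pairing phi g w.
  rewrite (_ : (fun n => _) = (fun n =>
      pairing (phi \o proj ip e n) (proj ip e n \o g \o proj ip e n) w)); last first.
    apply/funext => n; rewrite -cyl_repr//; first exact: cylC1_proj phig.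
    exact: C1b_proj.
  apply: (@div_pairing_cvg _ _ _ ip_inner _ _ _ _ u_int uv_int _ _ _ _ _ C) => //.
  - by move=> n; exact: C1b_proj.
  - by move=> n x; have [] := phiC (proj ip e n x).
  - move=> n x /=; rewrite (le_trans (norm_proj_le ip_inner e_on _ _))//.
    by have [] := phiC (proj ip e n x).
exact: (cvg_unique _ lhs rhs).
Unshelve. all: by end_near.
Qed.

Lemma BV0_measure_of_differences : exists m0, BV0_measure nu ip Rop v u m0 /\
  (vector_total_variation m0 <= V%:E)%E.
Proof.
have /choice[m0 m0P] (A : set BX) : exists x, measurable A ->
    `|x| <= fine (mu A) /\ forall w, ip x (Rop w) = m w A.
  have [mA|nmA] := pselect (measurable A); last by exists 0.
  by have [x xP] := density_vector_exists mA; exists x.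
have m0_tv : (vector_total_variation m0 <= V%:E)%E.
  apply: ge_ereal_sup => _ [B [mB tB BT ->]].
  have : (mu setT <= V%:E)%E by rewrite -(fineK (fin_num_measure mu _ measurableT)) lee_fin.
  apply: le_trans; rewrite -BT measure_semi_bigcup//; last exact: bigcupT_measurable.
  apply: lee_nneseries => // k _.
  rewrite -[leRHS]fineK ?fin_num_measure// lee_fin.
  by have [] := m0P _ (mB k).
exists m0; split => //; split.
  split; last by rewrite (le_lt_trans m0_tv)// ltry.
  move=> B mB tB.
  (* Both sides have the same inner products with the range of [Rop]; by symmetry [Rop] kills their
     difference, and injectivity concludes. The remainder is then small in norm because [mu] of the
     tail tends to 0. *)
  have tail n : m0 (\bigcup_i B i) = \sum_(i < n) m0 (B i) + m0 (\bigcup_i B (n + i)%N).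
    apply/eqP; rewrite -subr_eq0; apply/eqP; set z := _ - _.
    have Rz : Rop z = 0.
      apply: (ip_sep ip_inner) => w; rewrite Rop_sym /z.
      rewrite (ipBl ip_inner) (ipDl ip_inner) (ip_suml ip_inner).
      have -> : \sum_(i < n) ip (m0 (B i)) (Rop w) = \sum_(i < n) m w (B i).
        by apply: eq_bigr => i _; have [_ ->] := m0P _ (mB i).
      have [_ ->] := m0P _ (bigcupT_measurable _ mB).
      have [_ ->] := m0P _ (bigcupT_measurable _ (fun i => mB (n + i)%N)).
      rewrite /m (fine_measure_tail (M w) mB tB n) (fine_measure_tail (N w) mB tB n).
      by rewrite sumrB; lra.
    by apply: Rop_inj; rewrite Rz linear0.
  apply/cvgrPdist_le => eps eps0.
  have /cvgrPdist_le/(_ _ eps0) := fine_measure_tail_cvg0 mu mB tB.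
  apply: filterS => n; rewrite sub0r normrN => h.
  rewrite (tail n) addrC addKr.
  have [h1 _] := m0P _ (bigcupT_measurable _ (fun i => mB (n + i)%N)).
  exact: le_trans h1 (le_trans (ler_norm _) h).
move=> w phi g phig; exists (M w), (N w); split.
  by move=> B mB; have [_ ->] := m0P _ mB.
have [C C0 phiC] := C1b_bounded phig.
have phiC' x : `|phi x| <= C by have [] := phiC x.
have mphi : measurable_fun [set: BX] phi by apply: continuous_borel; exact: C1b_continuous phig.
have fin (k : {finite_measure set BX -> \bar R}) : (\int[k]_x (phi x)%:E)%E \is a fin_num.
  by apply: integrable_fin_num => //; exact: (bounded_integrable _ mphi phiC').
rewrite -(fineK (fin (M w))) -(fineK (fin (N w))) -EFinB; congr EFin.
rewrite [RHS](pairing_repr w phig) /div_pairing.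
transitivity (- 1 * \int[nu]_x (u x * (ip (g x) (Rop w) - v w x * phi x))).
  by rewrite mulN1r.
rewrite -RintegralZl//; first by apply: eq_Rintegral => x _; ring.
have := integrableZl measurableT (-1) (@div_pairing_integrable _ _ _ ip_inner _ Rop _ _ u_int uv_int _ _ w phig).
by congr (nu.-integrable _ _); apply/funext => x /=; rewrite -EFinM; congr EFin; ring.
Qed.

End construction.

(** * Lower bound for the total variation *)

Section grid.
Context d (T : measurableType d) (R : realType).

Lemma Rintegral_sum (m : {measure set T -> \bar R}) (I : Type) (s : seq I) (f : I -> T -> R) :
  (forall i, m.-integrable setT (EFin \o f i)) ->
  \int[m]_x (\sum_(i <- s) f i x) = \sum_(i <- s) \int[m]_x f i x.
Proof.
move=> fi; elim: s => [|i s ih].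
  by rewrite big_nil (_ : (fun=> _) = (fun=> 0)) ?Rintegral_cst ?mul0r//; apply/funext => x; rewrite big_nil.
rewrite big_cons -ih -RintegralD//.
  by apply: eq_Rintegral => x _; rewrite big_cons.
have := integrable_sum measurableT s (P := xpredT) (fun j _ => fi j).
by congr (m.-integrable _ _); apply/funext => x /=; rewrite sumEFin.
Qed.

(** A common finite partition into measurable cells on which each of the first [n] functions
    oscillates by at most [delta], obtained by refining with the levels of one function at a
    time. *)
Lemma grid_exists n (f : nat -> T -> R) (C delta : R) : 0 < delta ->
  (forall i, measurable_fun setT (f i)) -> (forall i x, `|f i x| <= C) ->
  exists K (q : T -> nat), [/\ forall x, (q x < K)%N,
    forall t, measurable [set x | q x = t] &
    forall i x y, (i < n)%N -> q x = q y -> `|f i x - f i y| <= delta].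
Proof.
move=> d0 mf fC; elim: n => [|n [K [q [qK mq qf]]]].
  exists 1%N, (fun=> 0%N); split => // t.
  have [->|t0] := eqVneq t 0%N; first by rewrite (_ : [set _ | _] = setT)//; exact/seteqP.
  rewrite (_ : [set _ | _] = set0)//; apply/seteqP; split => // x /= t0'.
  by rewrite -t0' eqxx in t0.
pose N := (Num.truncn (2 * C / delta)).+1.
pose j x := Num.truncn ((f n x + C) / delta).
have fn0 x : 0 <= (f n x + C) / delta.
  by rewrite divr_ge0 ?(ltW d0)//; have := fC n x; rewrite ler_norml => /andP[]; lra.
have jN x : (j x < N)%N.
  rewrite ltnS; apply: le_truncn; rewrite ler_pM2r ?invr_gt0//.
  by have := fC n x; rewrite ler_norml => /andP[]; lra.
have jP x : (j x)%:R * delta <= f n x + C < (j x).+1%:R * delta.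
  have := truncn_itv (fn0 x); rewrite -/(j x) => /andP[a b].
  by rewrite -ler_pdivlMr// a/= -ltr_pdivrMr.
have mj t : measurable [set x | j x = t].
  rewrite (_ : [set x | j x = t] = f n @^-1` `[t%:R * delta - C, t.+1%:R * delta - C[%classic).
    by rewrite -[X in measurable X]setTI; exact: mf.
  apply/seteqP; split => x /=; rewrite in_itv/= lerBlDr ltrBrDr; first by move=> <-.
  move=> /andP[a b]; apply: truncn_def.
  by rewrite ler_pdivlMr// a/= ltr_pdivrMr.
(* The old cell and the new level, which is below [N], are recovered as quotient and remainder by
   [N]. *)
exists (K * N)%N, (fun x => q x * N + j x)%N; split.
- move=> x; apply: (@leq_trans ((q x).+1 * N)); last by rewrite leq_mul2r qK orbT.
  by rewrite mulSn addnC ltn_add2r.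
- move=> t; rewrite (_ : [set _ | _] = [set x | q x = (t %/ N)%N] `&` [set x | j x = (t %% N)%N]).
    by apply: measurableI.
  apply/seteqP; split => x /= => [<-|[-> ->]]; last by rewrite -divn_eq.
  by rewrite divnMDl// divn_small// addn0 modnMDl modn_small.
- move=> i x y iN E.
  have Ej : j x = j y.
    by have := congr1 (modn^~ N) E; rewrite !modnMDl !modn_small.
  have Eq : q x = q y.
    by have := congr1 (divn^~ N) E; rewrite !divnMDl// !divn_small// !addn0.
  move: iN; rewrite ltnS leq_eqVlt => /orP[/eqP ->|iN]; last exact: qf.
  have /andP[a1 a2] := jP x; have /andP[b1 b2] := jP y; rewrite Ej in a1 a2.
  by rewrite -natr1 mulrDl mul1r in a2 b2; rewrite ler_norml; apply/andP; split; lra.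
Qed.

Lemma Rintegral_grid_le (m : {finite_measure set T -> \bar R}) (f : T -> R) (C delta : R) K q (r : nat -> T) :
  measurable_fun setT f -> (forall x, `|f x| <= C) ->
  (forall x, (q x < K)%N) -> (forall t, measurable [set x | q x = t]) ->
  (forall x, `|f x - f (r (q x))| <= delta) ->
  `|\int[m]_x f x - \sum_(t < K) f (r t) * fine (m [set x | q x = t])| <=
    delta * fine (m setT).
Proof.
move=> mf fC qK mq fd.
pose h t x := f (r t) * \1_[set x | q x = t] x.
have ih t : m.-integrable setT (EFin \o h t).
  apply: (@bounded_integrable _ _ _ _ _ C).
    by apply: measurable_funM => //; apply: measurable_indic.
  move=> x; rewrite normrM indicE; case: (_ \in _); rewrite ?normr1 ?normr0 ?mulr1 ?mulr0//.
  exact: le_trans (fC x).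
have hE x : \sum_(t < K) h t x = f (r (q x)).
  rewrite (bigD1 (Ordinal (qK x)))//= big1 => [|t tx].
    by rewrite addr0 /h indicE mem_set ?mulr1.
  rewrite /h indicE memNset ?mulr0//= => E; move/eqP: tx; apply.
  exact/val_inj.
have int_h : \int[m]_x f (r (q x)) = \sum_(t < K) f (r t) * fine (m [set x | q x = t]).
  transitivity (\int[m]_x (\sum_(t < K) h t x)); first by apply: eq_Rintegral => x _; rewrite hE.
  rewrite (Rintegral_sum _ (fun t : 'I_K => ih t)); apply: eq_bigr => t _.
  rewrite RintegralZl//.
    by congr (_ * _); rewrite /Rintegral integral_indic// setIT.
  by apply: integrable_indic => //; rewrite -ge0_fin_numE// fin_num_measure.
have mh : measurable_fun setT (fun x => f (r (q x))).
  rewrite (_ : (fun x => _) = (fun x => \sum_(t < K) h t x)); last by apply/funext => x; rewrite hE.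
  by apply: measurable_sum => t; apply: measurable_funM => //; apply: measurable_indic.
have i1 := bounded_integrable m mf fC.
have i2 : m.-integrable setT (EFin \o (fun x => f (r (q x)))).
  by apply: (@bounded_integrable _ _ _ _ _ C).
rewrite -int_h -RintegralB//.
have i3 : m.-integrable setT (EFin \o (fun x => f x - f (r (q x)))).
  by have := integrableB measurableT i1 i2.
rewrite (le_trans (le_normr_Rintegral measurableT i3))// -Rintegral_cst//.
apply: le_Rintegral => //; first by have := integrable_norm i3.
by apply: (@bounded_integrable _ _ _ _ _ (`|delta|)).
Qed.

End grid.

Section total_variation_lower_bound.
Context {R : realType} {X : completeNormedModType R}.
Variable ip : X -> X -> R.
Hypothesis ip_inner : is_inner_product ip.
Local Notation BX := (borel_of X).
Variables (nu : probability BX R) (Rop : {linear X -> X}) (v : X -> X -> R) (u : X -> R).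
Hypothesis u_int : nu.-integrable setT (EFin \o u).
Hypothesis uv_int : forall z, nu.-integrable setT (fun x => (u x * v z x)%:E).
Local Notation pairing := (div_pairing ip nu Rop v u).

Lemma nabla_star_integral n (f : 'I_n -> X -> R) g w : (forall i, C1b ip (f i) (g i)) ->
  (\int[nu]_x ((u x * nabla_star ip Rop v f g w x)%R)%:E =
   (\sum_(i < n) pairing (f i) (g i) (w i))%:E)%E.
Proof.
move=> fg.
have ii i := @div_pairing_integrable _ _ _ ip_inner _ Rop _ _ u_int uv_int _ _ (w i) (fg i).
rewrite -(Rintegral_sum _ ii) /Rintegral fineK.
  by apply: eq_integral => x _; rewrite /nabla_star mulr_sumr.
apply: integrable_fin_num => //.
have := integrable_sum measurableT (index_enum 'I_n) (P := xpredT) (fun i _ => ii i).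
by congr (nu.-integrable _ _); apply/funext => x /=; rewrite sumEFin.
Qed.

(** [signed_integral] lets the decomposition depend on [phi]. One pair, obtained from [phi = 0],
    serves all: if [p - n = p' - n'] then [p + n'] and [p' + n] are the same measure on Borel
    sets. *)
Lemma BV0_measure_pairing m0 w : BV0_measure nu ip Rop v u m0 ->
  exists p n : {finite_measure set BX -> \bar R},
    (forall B, measurable B -> ip (m0 B) (Rop w) = fine (p B) - fine (n B)) /\
    forall phi g, C1b ip phi g -> \int[p]_x phi x - \int[n]_x phi x = pairing phi g w.
Proof.
move=> [_ H]; have [p [n [pn _]]] := H w _ _ (C1b_cst ip_inner 0).
exists p, n; split => // phi g phig.
have [C _ phiC] := C1b_bounded phig.
have phiC' x : `|phi x| <= C by have [] := phiC x.
have mphi : measurable_fun [set: BX] phi by apply: continuous_borel; exact: C1b_continuous phig.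
have ik (k : {finite_measure set BX -> \bar R}) : k.-integrable setT (EFin \o phi).
  exact: (bounded_integrable _ mphi phiC').
have [p' [n' [pn' E]]] := H w _ _ phig.
have -> : \int[p]_x phi x - \int[n]_x phi x = \int[p']_x phi x - \int[n']_x phi x.
  have [k [kA kf]] := finite_measure_add p n'.
  have [l [lA lf]] := finite_measure_add p' n.
  have : \int[k]_x phi x = \int[l]_x phi x.
    suff kl A : measurable A -> k A = l A.
      by congr fine; apply: eq_measure_integral => A mA _; exact: kl.
    move=> mA; rewrite kA lA.
    have := pn A mA; rewrite (pn' A mA) => h.
    rewrite -[LHS]fineK ?fin_numD ?fin_num_measure// -[RHS]fineK ?fin_numD ?fin_num_measure//.
    by congr EFin; rewrite !fineD ?fin_num_measure//; lra.
  by rewrite (kf _ C)// (lf _ C)//; lra.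
have fin (k : {finite_measure set BX -> \bar R}) : (\int[k]_x (phi x)%:E)%E \is a fin_num.
  exact: integrable_fin_num (ik k).
move: E; rewrite -(fineK (fin p')) -(fineK (fin n')) -EFinB => -[<-].
transitivity (- 1 * \int[nu]_x (u x * (ip (g x) (Rop w) - v w x * phi x))).
  by rewrite mulN1r.
rewrite -RintegralZl//; first by apply: eq_Rintegral => x _; ring.
have := integrableZl measurableT (-1)
  (@div_pairing_integrable _ _ _ ip_inner _ Rop _ _ u_int uv_int _ _ w phig).
by congr (nu.-integrable _ _); apply/funext => x /=; rewrite -EFinM; congr EFin; ring.
Qed.

(** Replacing the coefficients by their values at one point of each cell turns the pairing into a
    sum of inner products of [m0 (A t)] with vectors of norm at most 1. *)
Lemma V0_le_total_variation m0 : BV0_measure nu ip Rop v u m0 ->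
  (V0 nu ip Rop v u <= vector_total_variation m0)%E.
Proof.
move=> Hm0; apply: ge_ereal_sup => _ [n [f [g [w [fg F1 ->]]]]].
rewrite nabla_star_integral//.
have [[_ tvoo] _] := Hm0.
have [tvr tvE] : exists r, vector_total_variation m0 = r%:E.
  have t0 : (0 <= vector_total_variation m0)%E.
    apply: (@le_trans _ _ (\sum_(0 <= k <oo) (`|m0 (if k is 0%N then setT else set0)|)%:E)%E).
      by apply: nneseries_ge0 => k _ _; rewrite lee_fin.
    apply: ereal_sup_ubound; exists (fun k => if k is 0%N then setT else set0); split => //.
    - by case.
    - by apply/trivIsetP => -[|i] [|j] //=; rewrite ?set0I ?setI0.
    - by apply/seteqP; split => // x _; exists 0%N.
  by exists (fine (vector_total_variation m0)); rewrite fineK// ge0_fin_numE.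
rewrite tvE lee_fin; apply/ler_addgt0Pr => eps eps0.
have /choice[pn pnP] i : exists pn : {finite_measure set BX -> \bar R} * {finite_measure set BX -> \bar R},
    (forall B, measurable B -> ip (m0 B) (Rop (w i)) = fine (pn.1 B) - fine (pn.2 B)) /\
    \int[pn.1]_x f i x - \int[pn.2]_x f i x = pairing (f i) (g i) (w i).
  by have [p [k [a b]]] := BV0_measure_pairing (w i) Hm0; exists (p, k); split => //; exact: b.
pose c i := fine ((pn i).1 setT) + fine ((pn i).2 setT).
have c0 i : 0 <= c i by rewrite addr_ge0// fine_ge0.
pose S := \sum_(i < n) c i.
have S0 : 0 <= S by apply: sumr_ge0.
(* Discretizing [f i] costs [delta] times the masses of its two measures; these sum to [S]. *)
pose delta := eps / (S + 1).
have delta0 : 0 < delta by rewrite divr_gt0//; lra.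
have /choice[C CP] i : exists C, forall x, `|f i x| <= C.
  by have [C _ fC] := C1b_bounded (fg i); exists C => x; have [] := fC x.
have C_ge0 i : 0 <= C i by exact: le_trans (CP i 0).
pose C0 := \sum_(i < n) C i.
have fC0 i x : `|f i x| <= C0.
  rewrite (le_trans (CP i x))// /C0 (bigD1 i)//= lerDl.
  by apply: sumr_ge0.
have C00 : 0 <= C0 by apply: sumr_ge0.
have mf i : measurable_fun [set: BX] (f i).
  by apply: continuous_borel; exact: C1b_continuous (fg i).
pose f' (k : nat) : X -> R := oapp f (fun=> 0) (insub k).
have [||K [q [qK mq qf]]] := @grid_exists _ BX R n f' C0 delta delta0.
- by move=> k; rewrite /f'; case: insubP => //= _; exact: measurable_cst.
- by move=> k x; rewrite /f'; case: insubP => //= _; rewrite normr0.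
have f'E (i : 'I_n) : f' i = f i by rewrite /f' valK.
(* An empty cell is sampled at 0, harmlessly: the field has norm at most 1 at every point. *)
have /choice[r rP] (t : nat) : exists x, (exists y, q y = t) -> q x = t.
  by have [[y yt]|ny] := pselect (exists y, q y = t); [exists y|exists 0].
have fr i x : `|f i x - f i (r (q x))| <= delta.
  by rewrite -f'E qf// rP//; exists x.
pose A t : set BX := [set x | q x = t].
have term_le i : pairing (f i) (g i) (w i) <=
    \sum_(t < K) f i (r t) * ip (m0 (A t)) (Rop (w i)) + delta * c i.
  have [pnA <-] := pnP i.
  have h1 := Rintegral_grid_le (pn i).1 (mf i) (fC0 i) qK mq (fr i).
  have h2 := Rintegral_grid_le (pn i).2 (mf i) (fC0 i) qK mq (fr i).
  have -> : \sum_(t < K) f i (r t) * ip (m0 (A t)) (Rop (w i)) =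
      \sum_(t < K) f i (r t) * fine ((pn i).1 (A t)) -
      \sum_(t < K) f i (r t) * fine ((pn i).2 (A t)).
    by rewrite -sumrB; apply: eq_bigr => t _; rewrite (pnA _ (mq t)) mulrBr.
  move: h1 h2; rewrite !ler_norml => /andP[_ h1] /andP[h2 _].
  by rewrite /c /A mulrDr; lra.
have sum_le : \sum_(i < n) pairing (f i) (g i) (w i) <=
    \sum_(t < K) ip (m0 (A t)) (\sum_(i < n) f i (r t) *: Rop (w i)) + delta * S.
  apply: (le_trans (ler_sum _ (fun i _ => term_le i))).
  rewrite big_split/= -mulr_sumr lerD2r exchange_big/=.
  apply: ler_sum => t _; rewrite (ip_sumr ip_inner); apply: ler_sum => i _.
  by rewrite (ipZr ip_inner).
have norm_le : \sum_(t < K) ip (m0 (A t)) (\sum_(i < n) f i (r t) *: Rop (w i)) <=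
    \sum_(t < K) `|m0 (A t)|.
  apply: ler_sum => t _; rewrite (le_trans (ler_norm _))//.
  rewrite (le_trans (cauchy_schwarz ip_inner _ _))// ler_piMr//; exact: F1.
have tv_le : \sum_(t < K) `|m0 (A t)| <= tvr.
  rewrite -lee_fin -tvE -sumEFin.
  apply: (@le_trans _ _ (\sum_(0 <= k <oo) (`|m0 (A k)|)%:E)%E).
    rewrite -(big_mkord xpredT (fun k => (`|m0 (A k)|)%:E)).
    by apply: nneseries_lim_ge => k _ _; rewrite lee_fin.
  apply: ereal_sup_ubound; exists A; split => //.
  - by apply/trivIsetP => i j _ _ ij; apply/seteqP; split => // x [qi qj]; move: ij; rewrite -(qi : q x = i) -(qj : q x = j) eqxx.
  - by apply/seteqP; split => // x _; exists (q x).
have dS : delta * S <= eps.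
  rewrite /delta -mulrA ler_piMr ?(ltW eps0)// ler_pdivrMl ?mulr1; lra.
lra.
Qed.

End total_variation_lower_bound.

(** * Integrability of [u] and of its products with the [v_z] *)

Section Lp_products.
Context d (T : measurableType d) (R : realType) (m : probability T R).

Lemma powR_integrable (p : R) (f : T -> R) : measurable_fun setT f ->
  (\int[m]_x ((`|f x| `^ p)%:E) < +oo)%E ->
  m.-integrable setT (EFin \o (fun x => `|f x| `^ p)).
Proof.
move=> mf fp; apply/integrableP; split.
  apply/measurable_EFinP; apply: (measurableT_comp (measurable_powR p)).
  exact: measurableT_comp.
by under eq_integral do rewrite /= ger0_norm ?powR_ge0//.
Qed.

Lemma Lp_integrable (p : R) (f : T -> R) : 1 < p -> measurable_fun setT f ->
  (\int[m]_x ((`|f x| `^ p)%:E) < +oo)%E -> m.-integrable setT (EFin \o f).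
Proof.
move=> p1 mf fp.
have i1 : m.-integrable setT (EFin \o (fun=> 1 : R)).
  by apply: (@bounded_integrable _ _ _ m _ 1) => // x; rewrite normr1.
have := integrableD measurableT i1 (powR_integrable mf fp).
apply: le_integrable => //; first exact/measurable_EFinP.
move=> x _ /=; rewrite lee_fin.
have h := powR_ge0 `|f x| p.
rewrite [leRHS]ger0_norm; last by lra.
have [f1|f1] := leP 1 `|f x|; last by lra.
by have := le1r_powR f1 (ltW p1); lra.
Qed.

(** Young's inequality for the conjugate exponents [p] and [p / (p - 1)], with the coefficients
    [1 / p] and [(p - 1) / p] bounded by 1. *)
Lemma Lp_mul_integrable (p : R) (f g : T -> R) : 1 < p ->
  measurable_fun setT f -> measurable_fun setT g ->
  (\int[m]_x ((`|f x| `^ p)%:E) < +oo)%E ->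
  (\int[m]_x ((`|g x| `^ (p / (p - 1)))%:E) < +oo)%E ->
  m.-integrable setT (fun x => (f x * g x)%:E).
Proof.
move=> p1 mf mg fp gq.
have := integrableD measurableT (powR_integrable mf fp) (powR_integrable mg gq).
apply: le_integrable => //; first by apply/measurable_EFinP; exact: measurable_funM.
move=> x _ /=; rewrite lee_fin.
have hf := powR_ge0 `|f x| p; have hg := powR_ge0 `|g x| (p / (p - 1)).
rewrite [leRHS]ger0_norm; last by lra.
have q1 : 1 < p / (p - 1) by rewrite ltr_pdivlMr; lra.
have := @conjugate_powR _ `|f x| `|g x| p (p / (p - 1)) (normr_ge0 _) (normr_ge0 _).
rewrite normrM => H.
have {}H : `|f x| * `|g x| <= `|f x| `^ p / p + `|g x| `^ (p / (p - 1)) / (p / (p - 1)).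
  by apply: H; [lra|lra|field; lra].
apply: (le_trans H); apply: lerD; rewrite ler_piMr//.
  by rewrite invf_le1; lra.
by rewrite invf_le1; lra.
Qed.

End Lp_products.

(** * Existence and uniqueness of the measure *)

Section main.
Context {R : realType} {X : completeNormedModType R}.
Variable ip : X -> X -> R.
Hypothesis ip_inner : is_inner_product ip.
Hypothesis X_sep : separable_space (X := X).
Local Notation BX := (borel_of X).
Variables (nu : probability BX R) (Rop : {linear X -> X}) (v : X -> X -> R) (u : X -> R).
Hypothesis u_int : nu.-integrable setT (EFin \o u).
Hypothesis uv_int : forall z, nu.-integrable setT (fun x => (u x * v z x)%:E).
Hypothesis Rop_sym : forall x y, ip (Rop x) y = ip x (Rop y).
Hypothesis Rop_inj : injective Rop.

Lemma V0_ge0 : (0 <= V0 nu ip Rop v u)%E.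
Proof.
apply: ereal_sup_ubound; exists 0%N, (fun=> fun=> 0), (fun=> fun=> 0), (fun=> 0); split.
- by case.
- by move=> x; rewrite big_ord0 normr0.
- by rewrite (nabla_star_integral ip_inner Rop u_int uv_int) ?big_ord0//; case.
Qed.

Lemma field_div_le_V0 (s : seq (field_term ip)) : (forall x, `|field_val Rop s x| <= 1) ->
  ((field_div nu Rop v u s)%:E <= V0 nu ip Rop v u)%E.
Proof.
move=> s1; apply: ereal_sup_ubound.
pose t i := tnth (in_tuple s) i.
exists (size s), (fun i => term_fun (t i)), (fun i => term_grad (t i)), (fun i => term_dir (t i)).
split; first by move=> i; exact: term_C1b.
  by move=> x; have := s1 x; rewrite /field_val big_tnth.
rewrite (nabla_star_integral ip_inner Rop u_int uv_int); last by move=> i; exact: term_C1b.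
by rewrite /field_div big_tnth.
Qed.

Lemma V0_field_approx eps : (V0 nu ip Rop v u < +oo)%E -> 0 < eps ->
  exists s : seq (field_term ip), (forall x, `|field_val Rop s x| <= 1) /\
    fine (V0 nu ip Rop v u) - eps <= field_div nu Rop v u s.
Proof.
move=> Voo eps0; have Vfin : V0 nu ip Rop v u \is a fin_num by rewrite ge0_fin_numE ?V0_ge0.
have [_ [n [f [g [w [fg F1 ->]]]]]] := ub_ereal_sup_adherent eps0 Vfin.
rewrite -/(V0 nu ip Rop v u) (nabla_star_integral ip_inner Rop u_int uv_int)//.
rewrite -{1}(fineK Vfin) -EFinB lte_fin => /ltW h.
exists [seq FieldTerm (w i) (fg i) | i <- index_enum 'I_n]; split.
  by move=> x; rewrite /field_val big_map; exact: F1.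
by rewrite /field_div big_map.
Qed.

Variable B : set X.
Hypothesis B_basis : orthonormal_basis ip B.
Hypothesis B_eigen : forall b, B b -> exists lambda, Rop b = lambda *: b.

(** Injectivity excludes the eigenvalue 0, so an eigenvector is the image of its quotient by the
    eigenvalue; zero entries are images of 0. *)
Lemma range_orthonormal_seq : exists2 e, orthonormal_seq ip e &
  exists ew, forall k, Rop (ew k) = e k.
Proof.
have [e e_on eB] := orthonormal_seq_exists ip_inner X_sep B_basis.
exists e => //; suff ex k : exists w, Rop w = e k by have [ew ?] := choice ex; exists ew.
have [ek0|ek0] := eqVneq (e k) 0; first by exists 0; rewrite linear0.
have [/B_eigen[l le]|/eqP] := eB k; last by rewrite (negbTE ek0).
have l0 : l != 0.
  apply: contra ek0 => /eqP l0; apply/eqP/Rop_inj.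
  by rewrite le l0 scale0r linear0.
by exists (l^-1 *: e k); rewrite linearZ/= le scalerA mulVf// scale1r.
Qed.

Lemma BV0_measure_exists : (V0 nu ip Rop v u < +oo)%E ->
  exists m0, BV0_measure nu ip Rop v u m0 /\
    (vector_total_variation m0 <= V0 nu ip Rop v u)%E.
Proof.
move=> Voo; have Vfin : V0 nu ip Rop v u \is a fin_num by rewrite ge0_fin_numE ?V0_ge0.
have [e e_on [ew ewe]] := range_orthonormal_seq.
have Vub (s : seq (field_term ip)) : (forall x, `|field_val Rop s x| <= 1) ->
    field_div nu Rop v u s <= fine (V0 nu ip Rop v u).
  by move=> s1; rewrite -lee_fin fineK//; exact: field_div_le_V0.
have Vap eps := @V0_field_approx eps Voo.
have [mu [M [N [muV MNle MNp]]]] :=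
  variation_measures_exist ip_inner e_on X_sep u_int uv_int Vub Vap.
rewrite -(fineK Vfin).
exact: (BV0_measure_of_differences ip_inner e_on X_sep u_int uv_int Rop_sym Rop_inj ewe Vub
  muV MNle MNp).
Qed.

Lemma BV0_measure_unique m m' : BV0_measure nu ip Rop v u m -> BV0_measure nu ip Rop v u m' ->
  forall A : set BX, measurable A -> m A = m' A.
Proof.
move=> Hm Hm' A mA; have [e e_on _] := range_orthonormal_seq.
apply/eqP; rewrite -subr_eq0; apply/eqP/Rop_inj; rewrite linear0.
apply: (ip_sep ip_inner) => w; rewrite Rop_sym (ipBl ip_inner).
have [p [n [pnA pnf]]] := BV0_measure_pairing ip_inner u_int uv_int w Hm.
have [p' [n' [pnA' pnf']]] := BV0_measure_pairing ip_inner u_int uv_int w Hm'.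
rewrite pnA// pnA'// (cylC1_difference_ext ip_inner e_on X_sep (n1 := p') (n2 := n')) ?subrr//.
by move=> f [[g fg] _] _; rewrite (pnf _ _ fg) (pnf' _ _ fg).
Qed.

End main.

(** Uniqueness identifies vector measures on measurable sets only, and the total variation sees no
    others. *)
Lemma eq_vector_total_variation (R : realType) (X : completeNormedModType R)
  (m m' : set (borel_of X) -> X) :
  (forall A, measurable A -> m A = m' A) ->
  vector_total_variation m = vector_total_variation m'.
Proof.
move=> mm'; congr ereal_sup; apply/seteqP; split => _ [B [mB tB BT ->]]; exists B; split => //;
  by apply: eq_eseriesr => i _; rewrite mm'.
Qed.

Unset Implicit Arguments.

Theorem theorem3p12 (R : realType) (X : completeNormedModType R)
  (ip : X -> X -> R) (nu : probability (borel_of X) R)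
  (Rop : {linear X -> X}) (v : X -> X -> R) (u : X -> R) :
  is_inner_product ip ->
  separable_space (X := X) ->
  continuous Rop ->
  (* standing assumption on nu and R *)
  (forall z : X,
     (forall p : R, 1 < p -> in_Lp nu p (v z)) /\
     (forall (phi : X -> R) (g : X -> X), C1b ip phi g ->
        (\int[nu]_x (ip (Rop (g x)) z)%:E =
         \int[nu]_x (v z x * phi x)%:E)%E)) ->
  (* R = R^*, R one to one, orthonormal basis of eigenvectors *)
  (forall x y, ip (Rop x) y = ip x (Rop y)) ->
  injective Rop ->
  (exists B : set X, orthonormal_basis ip B /\
     (forall e, B e -> exists lambda : R, Rop e = lambda *: e)) ->
  (exists p : R, 1 < p /\ in_Lp nu p u) ->
  (in_BV0 nu ip Rop v u <-> (V0 nu ip Rop v u < +oo)%E) /\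
  (forall m0 : set (borel_of X) -> X, BV0_measure nu ip Rop v u m0 ->
     vector_total_variation m0 = V0 nu ip Rop v u).
Proof.
move=> ip_inner X_sep _ v_hyp Rop_sym Rop_inj [B [B_basis B_eigen]] [p [p1 [u_meas u_p]]].
have u_int := Lp_integrable p1 u_meas u_p.
have uv_int z : nu.-integrable setT (fun x => (u x * v z x)%:E).
  have q1 : 1 < p / (p - 1) by rewrite ltr_pdivlMr; lra.
  have [/(_ _ q1)[v_meas v_q] _] := v_hyp z.
  exact: Lp_mul_integrable p1 u_meas v_meas u_p v_q.
have V0_le m0 (Hm0 : BV0_measure nu ip Rop v u m0) :=
  V0_le_total_variation ip_inner u_int uv_int Hm0.
have exists_m0 := BV0_measure_exists ip_inner X_sep u_int uv_int Rop_sym Rop_inj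
  B_basis B_eigen.
split; first split.
- move=> [_ [_ [m0 Hm0]]]; apply: le_lt_trans (V0_le _ Hm0) _.
  by have [[_ ?] _] := Hm0.
- by move=> /exists_m0[m0 [Hm0 _]]; split => //; split => //; exists m0.
- move=> m0 Hm0; apply/eqP; rewrite eq_le (V0_le _ Hm0) andbT.
  (* The given [m0] makes [V0] finite, so the constructed measure [m1] exists; it agrees with [m0]
     by uniqueness and carries the upper bound. *)
  have [|m1 [Hm1 m1_le]] := exists_m0.
    by apply: le_lt_trans (V0_le _ Hm0) _; have [[_ ?] _] := Hm0.
  rewrite (@eq_vector_total_variation _ _ m0 m1)// => A mA.
  exact: (BV0_measure_unique ip_inner X_sep u_int uv_int Rop_sym Rop_inj B_basis B_eigen Hm0 Hm1 mA).
Qed.
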